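(* Let $k\ge2$ and let $T\in\mathbb{R}^{n\times\cdots\times n}$ be a symmetric order-$k$ tensor that is $(\mu_1,\mu_2)$-incoherent. Assume $A=\operatorname{unfold}_1(T)\in\mathbb{R}^{n\times n^{k-1}}$ has rank $r$ and condition number $\kappa$. Let $\hat T$ be the output of the following procedure: (i) form the wedge matrix $Z$ of $A$ at rate $p$, let $\hat U\in\mathbb{R}^{n\times r}$ consist of orthonormal eigenvectors of $Z$ for its $r$ largest eigenvalues and $Q=\hat U\hat U^\top$; (ii) independently of the wedge samples, observe each entry of $T$ independently with probability $q$, let $\tilde T$ be the tensor equal to $T$ on observed entries and $0$ elsewhere, and $Y=\operatorname{unfold}_1(q^{-1}\tilde T)$; (iii) let $\hat T$ be the order-$k$ tensor whose mode-1 unfolding is $QY(Q\otimes\cdots\otimes Q)$ ($k-1$ Kronecker factors). For any $a\ge2$ there exist universal constants $C_0,C>0$ such that if $p\ge \frac{C_0\kappa^4a\mu_1\mu_2r^2\log n}{n^k}$ and $q\ge\frac{a(k-1)\log n}{n^k}$, then with probability $1-O(n^{-a})$, \[ \|T-\hat T\|_F\le C\left(k\sqrt r\,\kappa^2\sqrt{\frac{a\mu_1\mu_2r^2\log n}{pn^k}}+2^kr^{1.5+k/2}\kappa^{2k}\sqrt{\frac{a(k-1)\mu_1^{k+1}\mu_2\log n}{qn^k}}\right)\|T\|_F . \]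
   Context: The mode-1 unfolding $\operatorname{unfold}_1(T)\in\mathbb{R}^{n\times n^{k-1}}$ has entries $[\operatorname{unfold}_1(T)]_{i_1,(i_2,\dots,i_k)}=T_{i_1,\dots,i_k}$, with the column multi-index $(i_2,\dots,i_k)$ identified with $e_{i_2}\otimes\cdots\otimes e_{i_k}$, so that right multiplication by $Q\otimes\cdots\otimes Q$ is well defined. A tensor $T$ is $(\mu_1,\mu_2)$-incoherent if for every mode $j$, the compact SVD $\operatorname{unfold}_j(T)=U^{(j)}\Sigma^{(j)}(V^{(j)})^\top$ satisfies $\max_i\|U^{(j)}_{i,\cdot}\|_2^2\le\mu_1r_j/n_j$ and $\max_i\|V^{(j)}_{i,\cdot}\|_2^2\le\mu_2r_j/m_j$, where $r_j$ is the rank of the unfolding and $m_j=\prod_{\ell\ne j}n_\ell$. Condition number: $\kappa=\sigma_1(A)/\sigma_r(A)$. Wedge matrix of $A\in\mathbb{R}^{n\times m}$ at rate $p$: each triple of $\mathcal W=\{(i,\ell,j):1\le i\le j\le n,\ \ell\in[m]\}$ is sampled independently with probability $p$ (giving $\tilde{\mathcal W}$); with $Z_{i\ell j}=p^{-1}A_{i\ell}A_{j\ell}e_ie_j^\top\mathbf 1\{(i,\ell,j)\in\tilde{\mathcal W}\}$, $Z=\sum_{i<j,\ell}(Z_{i\ell j}+Z_{i\ell j}^\top)+\sum_{i,\ell}Z_{i\ell i}$. *)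

(* Defs.v *)
From HB Require Import structures.
From mathcomp Require Import all_boot all_order all_algebra all_fingroup.
From mathcomp Require Import all_classical all_reals all_analysis.
Set Implicit Arguments. Unset Strict Implicit. Unset Printing Implicit Defensive.
Import Order.TTheory GRing.Theory Num.Theory.
Local Open Scope ring_scope.

Definition mindex (k n : nat) := {ffun 'I_k -> 'I_n}.

Definition ncol (k n : nat) : nat := #|{ffun 'I_k.-1 -> 'I_n}|.

Definition insert_at (k n : nat) (j : 'I_k) (i : 'I_n) (J : {ffun 'I_k.-1 -> 'I_n})
  : mindex k n :=
  [ffun l => match unlift j l with None => i | Some l' => J l' end].

Definition drop_at (k n : nat) (j : 'I_k) (f : mindex k n) : {ffun 'I_k.-1 -> 'I_n} :=
  [ffun l' => f (lift j l')].

Definition unfold (R : realType) (k n : nat) (j : 'I_k) (T : mindex k n -> R)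
  : 'M[R]_(n, ncol k n) :=
  \matrix_(i < n, c < ncol k n) T (insert_at j i (enum_val c)).

Definition fold (R : realType) (k n : nat) (j : 'I_k) (M : 'M[R]_(n, ncol k n))
  : mindex k n -> R :=
  fun f => M (f j) (enum_rank (drop_at j f)).

(* mode 1 (index 0), given k >= 2 *)
Definition mode1 (k : nat) (hk : (1 < k)%N) : 'I_k := Ordinal (ltnW hk).

Definition symmetric_tensor (R : realType) (k n : nat) (T : mindex k n -> R) : Prop :=
  forall (s : 'S_k) (f : mindex k n), T [ffun l => f (s l)] = T f.

Definition frob (R : realType) (k n : nat) (T : mindex k n -> R) : R :=
  Num.sqrt (\sum_(f : mindex k n) T f ^+ 2).

Definition compact_svd (R : realType) (a b r : nat) (M : 'M[R]_(a, b))
  (U : 'M[R]_(a, r)) (s : 'rV[R]_r) (V : 'M[R]_(b, r)) : Prop :=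
  [/\ U^T *m U = 1%:M, V^T *m V = 1%:M,
      (forall i, 0 < s 0 i),
      (forall i j : 'I_r, (i <= j)%N -> s 0 j <= s 0 i)
    & M = U *m diag_mx s *m V^T].

Definition row_norm2 (R : realType) (a r : nat) (U : 'M[R]_(a, r)) (i : 'I_a) : R :=
  \sum_(c < r) U i c ^+ 2.

(* (mu1,mu2)-incoherence; here n_j = n and m_j = n^(k-1) = ncol k n *)
Definition incoherent (R : realType) (k n : nat) (T : mindex k n -> R) (mu1 mu2 : R)
  : Prop :=
  forall j : 'I_k,
    exists (U : 'M[R]_(n, \rank (unfold j T))) (s : 'rV[R]_(\rank (unfold j T)))
           (V : 'M[R]_(ncol k n, \rank (unfold j T))),
      compact_svd (unfold j T) U s V /\
      (forall i, row_norm2 U i <= mu1 * (\rank (unfold j T))%:R / n%:R) /\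
      (forall i, row_norm2 V i <= mu2 * (\rank (unfold j T))%:R / (ncol k n)%:R).

Definition cond_number (R : realType) (a b : nat) (M : 'M[R]_(a, b)) (kappa : R) : Prop :=
  exists (U : 'M[R]_(a, \rank M)) (s : 'rV[R]_(\rank M)) (V : 'M[R]_(b, \rank M)),
    compact_svd M U s V /\
    forall i j : 'I_(\rank M), val i = 0%N -> val j = (\rank M).-1 -> kappa = s 0 i / s 0 j.

Definition wsample (n m : nat) := {ffun 'I_n * 'I_m * 'I_n -> bool}.

Definition wedge_term (R : realType) (n m : nat) (p : R) (A : 'M[R]_(n, m))
  (w : wsample n m) (i : 'I_n) (l : 'I_m) (j : 'I_n) : 'M[R]_n :=
  (p^-1 * A i l * A j l * (w (i, l, j))%:R) *: delta_mx i j.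

Definition wedge_matrix (R : realType) (n m : nat) (p : R) (A : 'M[R]_(n, m))
  (w : wsample n m) : 'M[R]_n :=
  \sum_(i < n) \sum_(j < n | (i < j)%N) \sum_(l < m)
      (wedge_term p A w i l j + (wedge_term p A w i l j)^T)
  + \sum_(i < n) \sum_(l < m) wedge_term p A w i l i.

Definition top_eigvecs (R : realType) (n r : nat) (Z : 'M[R]_n) (U : 'M[R]_(n, r)) : Prop :=
  exists (V : 'M[R]_n) (lam : 'rV[R]_n),
    [/\ V^T *m V = 1%:M, V^T *m Z *m V = diag_mx lam,
        (forall i j : 'I_n, (i <= j)%N -> lam 0 j <= lam 0 i)
      & forall (i : 'I_n) (c : 'I_r) (c' : 'I_n), val c = val c' -> U i c = V i c'].

(* the matrix Q (x) ... (x) Q (k-1 factors) with rows/columns indexed by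
   (k-1)-multi-indices (identified with e_{i2} (x) ... (x) e_{ik}) *)
Definition kron_pow (R : realType) (k n : nat) (Q : 'M[R]_n) : 'M[R]_(ncol k n) :=
  \matrix_(c' < ncol k n, c < ncol k n)
     \prod_(l < k.-1) Q (enum_val c' l) (enum_val c l).

Definition esample (k n : nat) := {ffun mindex k n -> bool}.

Definition estimator (R : realType) (k n r : nat) (hk : (1 < k)%N) (T : mindex k n -> R)
  (q : R) (U : 'M[R]_(n, r)) (e : esample k n) : mindex k n -> R :=
  let Q := U *m U^T in
  let Y := unfold (mode1 hk) (fun f => q^-1 * (if e f then T f else 0)) in
  fold (mode1 hk) (Q *m Y *m kron_pow k Q).

Definition bern (R : realType) (X : finType) (p : R) (s : {ffun X -> bool}) : R :=
  \prod_(x : X) (if s x then p else 1 - p).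

Definition prob2 (R : realType) (X Y : finType) (p q : R)
  (E : {ffun X -> bool} -> {ffun Y -> bool} -> Prop) : R :=
  \sum_(w : {ffun X -> bool}) \sum_(e : {ffun Y -> bool})
     bern p w * bern q e * (if `[< E w e >] then 1 else 0).

(* Main.v *)
(** Write [A] for the mode-1 unfolding and [Z] for the wedge matrix, so that
    [Z = A A^T + E] with [E] a sum of independent centred matrices.

    The operator norm of [E] is controlled by its trace moments. Convexity of
    [tr x^(2s)] lets one replace [E] by [E - E'] for an independent copy [E'],
    whose signs may be randomised; a mean value inequality for traces then gives
    a Khintchine bound in terms of a diagonal variance proxy, the moments of which
    come from a scalar exponential moment. The same argument with [|x|^(2s)]
    gives dimension-free tails for sums of independent vectors.

    Weyl's inequality and the Davis-Kahan theorem in Frobenius norm bound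
    [(1 - Q) U], hence the bias [T - (Q (x) ... (x) Q) T], which telescopes over
    the modes. For the sampling noise the rows of [Q] have to be small as well.
    This is a leave-one-out argument: zeroing row and column [i] of [E] gives a
    projection [Q_i] that is independent of row [i] of [E] and close to [Q], so the
    vector tail bounds row [i] of [E Q_i], thus of [E Q], and row [i] of
    [Z Q = A A^T Q + E Q] dominates row [i] of [Q]. *)
Require Import Defs.
From HB Require Import structures.
From mathcomp Require Import all_boot all_order all_algebra all_fingroup.
From mathcomp Require Import all_classical all_reals all_analysis.
From mathcomp Require Import ring lra zify.
From mathcomp Require Import complex.
Import Order.TTheory GRing.Theory Num.Theory.
Set Implicit Arguments.
Unset Strict Implicit.
Unset Printing Implicit Defensive.
Local Open Scope ring_scope.

(** A wedge contributes a matrix with at most one nonzero entry per row. Its square is therefore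
    diagonal, which reduces the variance proxy to one scalar sum per row; and its row [i] times a
    matrix [M] involves a single row of [M], which is why the leave-one-out bound can be stated with
    the largest row norm of a projection instead of its Frobenius norm. Rows of [Q] matter because
    the entry-sampling noise combines columns of the Kronecker power of [Q], whose norms are
    products of row norms of [Q]. A row bound 2 kappa^2 sqrt(mu1 r / n) in each of the [k] modes is
    the source of [2 ^+ k] and [kappa ^+ (2 * k)]. The row argument is self-referential: it bounds
    the largest row by a small multiple of itself plus the part of [A A^T], so the noise has to be a
    small fraction of the squared least singular value; this fixes the sampling rate and its
    [kappa ^+ 4]. All tails use one moment order [K], about (a + 2) ln n, each costing exp(-K).
    Eigenvectors are not unique, so the event quantifies over every choice of them; on good samples
    the eigengap makes the projection unique. *)

(** * Frobenius inner product and norm, operator norm bounds *)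

Section FrobeniusNorm.
Variable R : realType.
Implicit Types a b c : nat.

Definition fdot a b (M N : 'M[R]_(a, b)) : R := \sum_i \sum_j M i j * N i j.

Definition sqnorm a b (M : 'M[R]_(a, b)) : R := fdot M M.

Definition fnorm a b (M : 'M[R]_(a, b)) : R := Num.sqrt (sqnorm M).

Lemma fdot_trace a b (M N : 'M[R]_(a, b)) : fdot M N = \tr (M *m N^T).
Proof.
rewrite /fdot /mxtrace; apply: eq_bigr => i _; rewrite mxE.
by apply: eq_bigr => j _; rewrite mxE.
Qed.

Lemma fdotC a b (M N : 'M[R]_(a, b)) : fdot M N = fdot N M.
Proof. by apply: eq_bigr => i _; apply: eq_bigr => j _; rewrite mulrC. Qed.

Lemma fdotDl a b (M N P : 'M[R]_(a, b)) : fdot (M + N) P = fdot M P + fdot N P.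
Proof. by rewrite !fdot_trace mulmxDl raddfD. Qed.

Lemma fdotNl a b (M N : 'M[R]_(a, b)) : fdot (- M) N = - fdot M N.
Proof. by rewrite !fdot_trace mulNmx raddfN. Qed.

Lemma fdotZl a b x (M N : 'M[R]_(a, b)) : fdot (x *: M) N = x * fdot M N.
Proof. by rewrite !fdot_trace -scalemxAl mxtraceZ. Qed.

Lemma fdotDr a b (M N P : 'M[R]_(a, b)) : fdot P (M + N) = fdot P M + fdot P N.
Proof. by rewrite fdotC fdotDl !(fdotC P). Qed.

Lemma fdotNr a b (M N : 'M[R]_(a, b)) : fdot N (- M) = - fdot N M.
Proof. by rewrite fdotC fdotNl fdotC. Qed.

Lemma fdotZr a b x (M N : 'M[R]_(a, b)) : fdot N (x *: M) = x * fdot N M.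
Proof. by rewrite fdotC fdotZl fdotC. Qed.

Lemma fdot0r a b (M : 'M[R]_(a, b)) : fdot M 0 = 0.
Proof. by rewrite -(scale0r 0) fdotZr mul0r. Qed.

Lemma sqnormE a b (M : 'M[R]_(a, b)) : sqnorm M = \sum_i \sum_j M i j ^+ 2.
Proof. by apply: eq_bigr => i _; apply: eq_bigr => j _; rewrite expr2. Qed.

Lemma sqnorm_ge0 a b (M : 'M[R]_(a, b)) : 0 <= sqnorm M.
Proof. by rewrite sqnormE; do 2!apply: sumr_ge0 => ? _; exact: sqr_ge0. Qed.

Lemma sqnorm_trace a b (M : 'M[R]_(a, b)) : sqnorm M = \tr (M *m M^T).
Proof. exact: fdot_trace. Qed.

Lemma sqnormT a b (M : 'M[R]_(a, b)) : sqnorm M^T = sqnorm M.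
Proof. by rewrite !sqnorm_trace trmxK mxtrace_mulC. Qed.

Lemma sqnormZ a b x (M : 'M[R]_(a, b)) : sqnorm (x *: M) = x ^+ 2 * sqnorm M.
Proof. by rewrite /sqnorm fdotZl fdotZr mulrA expr2. Qed.

Lemma sqnormN a b (M : 'M[R]_(a, b)) : sqnorm (- M) = sqnorm M.
Proof. by rewrite /sqnorm fdotNl fdotNr opprK. Qed.

Lemma sqnorm0 a b : sqnorm (0 : 'M[R]_(a, b)) = 0.
Proof. exact: fdot0r. Qed.

Lemma sqnormD a b (M N : 'M[R]_(a, b)) :
  sqnorm (M + N) = sqnorm M + 2 * fdot M N + sqnorm N.
Proof. by rewrite /sqnorm fdotDl !fdotDr (fdotC N M); ring. Qed.

Lemma sqnormB a b (M N : 'M[R]_(a, b)) :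
  sqnorm (M - N) = sqnorm M - 2 * fdot M N + sqnorm N.
Proof. by rewrite sqnormD fdotNr sqnormN; ring. Qed.

Lemma sqnorm_eq0 a b (M : 'M[R]_(a, b)) : sqnorm M = 0 -> M = 0.
Proof.
rewrite sqnormE => /eqP; rewrite psumr_eq0 => [/allP h|i _]; last first.
  by apply: sumr_ge0 => j _; exact: sqr_ge0.
apply/matrixP => i j; rewrite mxE; have := h i (mem_index_enum _).
rewrite /= psumr_eq0 => [/allP/(_ j (mem_index_enum _))|k _]; last exact: sqr_ge0.
by rewrite /= sqrf_eq0 => /eqP.
Qed.

Lemma fdot_CS a b (M N : 'M[R]_(a, b)) : fdot M N ^+ 2 <= sqnorm M * sqnorm N.
Proof.
have [N0|N0] := eqVneq (sqnorm N) 0.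
  by rewrite (sqnorm_eq0 N0) fdot0r sqnorm0 expr0n mulr0.
have Np : 0 < sqnorm N by rewrite lt_def N0 sqnorm_ge0.
have := sqnorm_ge0 (sqnorm N *: M - fdot M N *: N).
rewrite sqnormB !sqnormZ fdotZl fdotZr => h.
have {}h : 0 <= sqnorm N * (sqnorm M * sqnorm N - fdot M N ^+ 2).
  by apply: le_trans h _; rewrite le_eqVlt; apply/orP; left; apply/eqP; ring.
by rewrite -subr_ge0 -(pmulr_rge0 _ Np).
Qed.

Lemma fnorm_ge0 a b (M : 'M[R]_(a, b)) : 0 <= fnorm M.
Proof. exact: sqrtr_ge0. Qed.

Lemma fnorm_sq a b (M : 'M[R]_(a, b)) : fnorm M ^+ 2 = sqnorm M.
Proof. by rewrite sqr_sqrtr ?sqnorm_ge0. Qed.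

Lemma fnorm_le a b (M : 'M[R]_(a, b)) t : 0 <= t -> (fnorm M <= t) = (sqnorm M <= t ^+ 2).
Proof. by move=> t0; rewrite -fnorm_sq ler_pXn2r // nnegrE fnorm_ge0. Qed.

Lemma fdot_le a b (M N : 'M[R]_(a, b)) : fdot M N <= fnorm M * fnorm N.
Proof.
apply: le_trans (ler_norm _) _.
rewrite -(ler_pXn2r (n := 2)) ?nnegrE ?mulr_ge0 ?fnorm_ge0 //.
by rewrite exprMn !fnorm_sq real_normK ?num_real // fdot_CS.
Qed.

Lemma fnormD a b (M N : 'M[R]_(a, b)) : fnorm (M + N) <= fnorm M + fnorm N.
Proof.
rewrite fnorm_le ?addr_ge0 ?fnorm_ge0 // sqnormD -!fnorm_sq.
by have := fdot_le M N; lra.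
Qed.

Lemma fnormN a b (M : 'M[R]_(a, b)) : fnorm (- M) = fnorm M.
Proof. by rewrite /fnorm sqnormN. Qed.

Lemma fnormB a b (M N : 'M[R]_(a, b)) : fnorm (M - N) <= fnorm M + fnorm N.
Proof. by rewrite -(fnormN N) fnormD. Qed.

Lemma fnormT a b (M : 'M[R]_(a, b)) : fnorm M^T = fnorm M.
Proof. by rewrite /fnorm sqnormT. Qed.

Lemma sqnorm_rows a b (M : 'M[R]_(a, b)) : sqnorm M = \sum_i sqnorm (row i M).
Proof.
rewrite sqnormE; apply: eq_bigr => i _; rewrite sqnormE big_ord1.
by apply: eq_bigr => j _; rewrite mxE.
Qed.

Lemma sqnorm_cols a b (M : 'M[R]_(a, b)) : sqnorm M = \sum_j sqnorm (col j M).
Proof.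
rewrite -sqnormT sqnorm_rows; apply: eq_bigr => j _.
by rewrite -tr_col sqnormT.
Qed.

Lemma sqnorm_row_le a b (M : 'M[R]_(a, b)) i : sqnorm (row i M) <= sqnorm M.
Proof.
by rewrite (sqnorm_rows M) (bigD1 i) //= lerDl sumr_ge0 // => j _; exact: sqnorm_ge0.
Qed.

Lemma row_norm2E a b (M : 'M[R]_(a, b)) i : row_norm2 M i = sqnorm (row i M).
Proof. by rewrite sqnormE big_ord1; apply: eq_bigr => j _; rewrite mxE. Qed.

Lemma sqnormM a b c (M : 'M[R]_(a, b)) (N : 'M[R]_(b, c)) :
  sqnorm (M *m N) <= sqnorm M * sqnorm N.
Proof.
rewrite (sqnormE (M *m N)) (sqnorm_rows M) (sqnorm_cols N) mulr_suml.
apply: ler_sum => i _; rewrite mulr_sumr; apply: ler_sum => j _.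
have -> : (M *m N) i j = fdot (row i M) (col j N)^T.
  by rewrite /fdot big_ord1 mxE; apply: eq_bigr => k _; rewrite !mxE.
by apply: le_trans (fdot_CS _ _) _; rewrite sqnormT.
Qed.

Lemma fnormM a b c (M : 'M[R]_(a, b)) (N : 'M[R]_(b, c)) :
  fnorm (M *m N) <= fnorm M * fnorm N.
Proof.
by rewrite fnorm_le ?mulr_ge0 ?fnorm_ge0 // exprMn !fnorm_sq sqnormM.
Qed.

Lemma sqnorm_isom a b c (V : 'M[R]_(a, b)) (M : 'M[R]_(b, c)) :
  V^T *m V = 1%:M -> sqnorm (V *m M) = sqnorm M.
Proof.
move=> VV; rewrite -sqnormT -(sqnormT M) !sqnorm_trace !trmxK trmx_mul.
by rewrite -mulmxA (mulmxA V^T) VV mul1mx.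
Qed.

(** Pythagoras for the orthogonal projection [V *m V^T]: the squared distance from [M] to its image
    is the difference of the two sides. *)
Lemma sqnorm_coisom a b c (V : 'M[R]_(a, b)) (M : 'M[R]_(a, c)) :
  V^T *m V = 1%:M -> sqnorm (V^T *m M) <= sqnorm M.
Proof.
move=> VV; have := sqnorm_ge0 (M - V *m (V^T *m M)).
rewrite sqnormB sqnorm_isom //.
suff -> : fdot M (V *m (V^T *m M)) = sqnorm (V^T *m M) by lra.
rewrite fdotC fdot_trace sqnorm_trace trmx_mul trmxK -!mulmxA mxtrace_mulC.
by rewrite !mulmxA.
Qed.

(** The operator norm enters only through upper bounds, so it is a predicate rather than a
    supremum. *)
Definition opnorm_le n (E : 'M[R]_n) (t : R) :=
  forall x : 'cV[R]_n, sqnorm (E *m x) <= t ^+ 2 * sqnorm x.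

Lemma opnorm_le_mul n b (E : 'M[R]_n) t (M : 'M[R]_(n, b)) :
  opnorm_le E t -> sqnorm (E *m M) <= t ^+ 2 * sqnorm M.
Proof.
move=> Et; rewrite (sqnorm_cols M) sqnorm_cols mulr_sumr; apply: ler_sum => j _.
by rewrite !colE -mulmxA Et.
Qed.

Lemma fnorm_opnorm n b (E : 'M[R]_n) t (M : 'M[R]_(n, b)) : 0 <= t ->
  opnorm_le E t -> fnorm (E *m M) <= t * fnorm M.
Proof.
move=> t0 Et; rewrite fnorm_le ?mulr_ge0 ?fnorm_ge0 // exprMn fnorm_sq.
exact: opnorm_le_mul.
Qed.

End FrobeniusNorm.

Ltac nonneg := repeat first
  [ done | exact: sqr_ge0 | exact: sqnorm_ge0 | exact: fnorm_ge0 | exact: expR_ge0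
  | exact: ler0n | exact: sqrtr_ge0 | by apply: ltW | apply: exprn_ge0
  | apply: divr_ge0 | apply: mulr_ge0 | apply: addr_ge0 | apply: sumr_ge0 => ? _ ].

(** Turns a goal [0 <= e], given a certificate [H : 0 <= e'], into the identity [e' = e], which is
    left to [ring] or [field]. *)
Ltac from_nonneg H :=
  apply: (le_trans H); rewrite le_eqVlt; apply/orP; left; apply/eqP.

(** * Spectral theorem for real symmetric matrices, with sorted eigenvalues *)

Section SpectralTheorem.
Variable R : realType.

Lemma singular_kernel (F : fieldType) n (B : 'M[F]_n) :
  B \notin unitmx -> exists2 u : 'rV[F]_n, u != 0 & u *m B = 0.
Proof.
rewrite -row_free_unit -kermx_eq0 => /rowV0Pn[u /sub_kermxP uB u0].
by exists u.
Qed.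

(* If [x + iy] is a complex eigenvalue of [A], then [(A - x)^2 + y^2] is a
   singular real matrix, and a real vector [u] in its kernel satisfies
   [|(A - x) u|^2 + y^2 |u|^2 = 0]. *)
Lemma symmetric_eigenvector n (A : 'M[R]_n.+1) : A^T = A ->
  exists (x : R) (u : 'cV[R]_n.+1), sqnorm u = 1 /\ A *m u = x *: u.
Proof.
move=> Asym.
pose C : numClosedFieldType := complex R.
pose f : {rmorphism R -> C} := real_complex R.
have [z] := @eigenvalue_closed C _ (map_mx f A) (ltn0Sn n).
case/eigenvalueP => v vA v0.
pose x : R := complex.Re z; pose y : R := complex.Im z.
pose B := (A - x%:M) *m (A - x%:M) + (y ^+ 2)%:M.
have zxy : z = f x + (Complex 0 1 : C) * f y.
  by rewrite [LHS]complexE.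
have i2 : (Complex 0 1 : C) ^+ 2 = -1.
  exact: sqr_i.
have vB : v *m map_mx f B = 0.
  have vAx : v *m (map_mx f A - (f x)%:M) = (z - f x) *: v.
    by rewrite mulmxBr vA mul_mx_scalar scalerBl.
  rewrite map_mxD map_mxM map_mxB !map_scalar_mx mulmxDr mulmxA vAx.
  rewrite -scalemxAl vAx scalerA mul_mx_scalar -scalerDl.
  have -> : (z - f x) * (z - f x) + f (y ^+ 2) = 0.
    rewrite zxy [_ + _ - _]addrC addKr rmorphXn -expr2 exprMn i2; ring.
  by rewrite scale0r.
have /singular_kernel[u u0 uB] : B \notin unitmx.
  rewrite -(map_unitmx f); apply: contra v0 => uf.
  by rewrite -(mulmx1 v) -(mulmxV uf) mulmxA vB mul0mx.
have h : sqnorm (u *m (A - x%:M)) + y ^+ 2 * sqnorm u = 0.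
  have : u *m B *m u^T = 0 by rewrite uB mul0mx.
  rewrite /B mulmxDr mulmxDl mul_mx_scalar -scalemxAl mulmxA => /(congr1 mxtrace).
  rewrite mxtraceD mxtraceZ -sqnorm_trace mxtrace0 => <-.
  have Ax : (A - x%:M)^T = A - x%:M by rewrite linearB /= Asym tr_scalar_mx.
  by rewrite sqnorm_trace trmx_mul Ax !mulmxA.
have /sqnorm_eq0/eqP : sqnorm (u *m (A - x%:M)) = 0.
  have h1 := sqnorm_ge0 (u *m (A - x%:M)).
  have h2 : 0 <= y ^+ 2 * sqnorm u by rewrite mulr_ge0 ?sqr_ge0 ?sqnorm_ge0.
  lra.
rewrite mulmxBr mul_mx_scalar subr_eq0 => /eqP uA.
have up : 0 < sqnorm u.
  rewrite lt_def sqnorm_ge0 andbT; apply: contra_neq u0; exact: sqnorm_eq0.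
exists x, ((fnorm u)^-1 *: u^T); split.
  rewrite sqnormZ sqnormT exprVn fnorm_sq mulVf //; exact: lt0r_neq0.
by rewrite -scalemxAr -{1}Asym -trmx_mul uA linearZ /= !scalerA mulrC.
Qed.

(** The reflection along [e - u] exchanges the unit vectors [e] and [u], since equal lengths give
    [fdot v e = sqnorm v / 2] for [v = e - u]. When [u = e] this direction vanishes and the identity
    is used. *)
Lemma householder n (u : 'cV[R]_n.+1) : sqnorm u = 1 ->
  exists H : 'M[R]_n.+1, [/\ H^T = H, H *m H = 1%:M & col 0 H = u].
Proof.
move=> u1; pose e : 'cV[R]_n.+1 := delta_mx 0 0.
have e1 : sqnorm e = 1.
  rewrite sqnormE (bigD1 0) //= big_ord1 big1 => [|i i0].
    by rewrite mxE !eqxx expr1n addr0.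
  by rewrite big_ord1 mxE (negPf i0) expr0n.
have colE (H : 'M[R]_n.+1) : col 0 H = H *m e by rewrite colE.
have [ue|ue] := eqVneq u e.
  by exists 1%:M; rewrite tr_scalar_mx mulmx1 colE mul1mx ue.
pose v := e - u.
have v0 : sqnorm v != 0.
  apply: contra_neq ue => /sqnorm_eq0/eqP; rewrite subr_eq0 => /eqP; exact: esym.
have vv : v^T *m v = (sqnorm v)%:M.
  by rewrite [LHS]mx11_scalar -sqnormT sqnorm_trace trmxK /mxtrace big_ord1.
have ve : v^T *m e = (sqnorm v / 2)%:M.
  rewrite [LHS]mx11_scalar; congr (_%:M).
  have -> : (v^T *m e) 0 0 = fdot v e.
    by rewrite fdotC fdot_trace mxtrace_mulC /mxtrace big_ord1.
  rewrite /v sqnormB fdotDl fdotNl e1 u1 -[fdot e e]/(sqnorm e) e1 fdotC.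
  by lra.
pose H := 1%:M - (2 / sqnorm v) *: (v *m v^T).
exists H; split.
- by rewrite /H linearB /= tr_scalar_mx linearZ /= trmx_mul trmxK.
- rewrite /H mulmxBl mul1mx mulmxBr mulmx1 -scalemxAl -scalemxAr scalerA.
  rewrite -mulmxA (mulmxA v^T) vv mul_scalar_mx -scalemxAr scalerA.
  have -> : 2 / sqnorm v * (2 / sqnorm v) * sqnorm v = 2 / sqnorm v + 2 / sqnorm v.
    by field.
  by rewrite scalerDl; apply/matrixP => i j; rewrite !mxE; ring.
- rewrite colE /H mulmxBl mul1mx -scalemxAl -mulmxA ve mul_mx_scalar scalerA.
  have -> : 2 / sqnorm v * (sqnorm v / 2) = 1 by field.
  by rewrite scale1r /v subKr.
Qed.

Lemma symmetric_diagonalizable n (A : 'M[R]_n) : A^T = A ->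
  exists (V : 'M[R]_n) (l : 'rV[R]_n),
    V^T *m V = 1%:M /\ V^T *m A *m V = diag_mx l.
Proof.
elim: n A => [|n IH] A Asym; first by exists 1%:M, 0; split; apply/matrixP => -[].
have [x [u [u1 Au]]] := symmetric_eigenvector Asym.
have [H [Hs HH Hu]] := householder u1.
(* [B] is introduced opaquely and at size [1 + n], so that block operations apply without unfolding
   it. *)
have [B BE] : {B : 'M[R]_(1 + n) | B = H *m A *m H} by exists (H *m A *m H).
have Bsym : B^T = B by rewrite BE !trmx_mul Hs Asym mulmxA.
have B0 : col 0 B = x *: delta_mx 0 0.
  rewrite colE BE -!mulmxA -colE Hu Au -scalemxAr -Hu colE (mulmxA H H) HH mul1mx.
  by [].
have Bcol i : B i 0 = x * (i == 0)%:R.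
  by have := congr1 (fun M : 'cV_n.+1 => M i 0) B0; rewrite !mxE eqxx andbT.
have [P [l [PP PBP]]] : exists (V : 'M[R]_n) (l : 'rV[R]_n),
    V^T *m V = 1%:M /\ V^T *m drsubmx B *m V = diag_mx l.
  by apply: IH; rewrite trmx_drsub Bsym.
have l0 (i : 'I_1) : lshift n i = 0 by apply: val_inj; rewrite /= ord1.
have Bblk : B = block_mx x%:M 0 0 (drsubmx B).
  rewrite -{1}(submxK B); congr block_mx.
  - by apply/matrixP => i j; rewrite !mxE !l0 Bcol !ord1 !eqxx mulr1 mulr1n.
  - by apply/matrixP => i j; rewrite -Bsym !mxE l0 Bcol mulr0.
  - by apply/matrixP => i j; rewrite !mxE l0 Bcol mulr0.
pose W : 'M[R]_(1 + n) := block_mx 1%:M 0 0 P.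
have WT : W^T = block_mx 1%:M 0 0 P^T by rewrite /W tr_block_mx !trmx0 tr_scalar_mx.
have WW : W^T *m W = 1%:M.
  rewrite WT /W mulmx_block.
  by rewrite !(mul0mx, mulmx0, mulmx1, mul1mx, addr0, add0r) PP -scalar_mx_block.
have WBW : W^T *m B *m W = diag_mx (row_mx x%:M l).
  rewrite Bblk WT /W !mulmx_block.
  rewrite !(mul0mx, mulmx0, mulmx1, mul1mx, addr0, add0r) PBP diag_mx_row.
  by congr block_mx; apply/matrixP => i j; rewrite !mxE !ord1.
exists (H *m W), (row_mx x%:M l); rewrite trmx_mul Hs; split.
  by rewrite mulmxA -(mulmxA W^T) HH mulmx1; exact: WW.
by rewrite -WBW BE !mulmxA.
Qed.

Lemma symmetric_spectral n (A : 'M[R]_n) : A^T = A ->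
  exists (V : 'M[R]_n) (l : 'rV[R]_n),
    [/\ V^T *m V = 1%:M, V^T *m A *m V = diag_mx l
      & forall i j : 'I_n, (i <= j)%N -> l 0 j <= l 0 i].
Proof.
move=> /symmetric_diagonalizable[V [l [VV VAV]]].
(* Sorting along the reversed order makes the eigenvalues decrease; the same permutation is then
   applied to the columns of [V]. *)
pose geR : rel R := fun x y => y <= x.
pose t := [tuple l 0 i | i < n].
have tsort : perm_eq (sort_tuple geR t) t by rewrite perm_sort.
have [s hs] := tuple_permP tsort.
have ls i : l 0 (s i) = nth 0 (sort geR t) i.
  by rewrite -[sort _ _]/(tval (sort_tuple geR t)) hs -tnth_nth !tnth_mktuple.
exists (col_perm s V), (\row_i l 0 (s i)); split.
- apply/matrixP => i j; have := congr1 (fun M : 'M[R]_n => M (s i) (s j)) VV.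
  rewrite !mxE (inj_eq perm_inj) => <-.
  by apply: eq_bigr => k _; rewrite !mxE.
- apply/matrixP => i j; have := congr1 (fun M : 'M[R]_n => M (s i) (s j)) VAV.
  rewrite !mxE (inj_eq perm_inj) => <-.
  apply: eq_bigr => k _; rewrite !mxE; congr (_ * _).
  by apply: eq_bigr => k' _; rewrite !mxE.
move=> i j ij; rewrite !mxE !ls.
have geR_trans : transitive geR by move=> x y z h1 h2; exact: le_trans h2 h1.
have geR_total : total geR by move=> x y; exact: le_total.
have sz : size (sort geR t) = n by rewrite size_sort size_tuple.
apply: (sorted_leq_nth geR_trans _ 0 (sort_sorted geR_total t)) ij.
- by move=> x; exact: lexx.
- by rewrite inE sz.
- by rewrite inE sz.
Qed.

End SpectralTheorem.

(** * Product Bernoulli measures: independence, resampling, union bounds, exponential moments *)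

Section BernoulliExpectation.
Variables (R : realType) (I : finType).
Implicit Types (F G : {ffun I -> bool} -> R) (w : {ffun I -> bool}).

Definition expect (p : R) F : R := \sum_w bern p w * F w.

Definition prob (p : R) (P : {ffun I -> bool} -> Prop) : R :=
  expect p (fun w => if `[< P w >] then 1 else 0).

(** Two uses: exchanging independent copies on a set of coordinates (symmetrisation), and redrawing
    the coordinates in [S] while the others stay frozen (conditioning). *)
Definition splice (S : pred I) w w' : {ffun I -> bool} :=
  [ffun x => if S x then w x else w' x].

(** Independence of the coordinates, as distributivity of a product over sums. *)
Lemma expect_prod p (g : I -> bool -> R) :
  expect p (fun w => \prod_x g x (w x)) =
  \prod_x (p * g x true + (1 - p) * g x false).
Proof.
transitivity (\sum_(w : {ffun I -> bool}) \prod_x ((if w x then p else 1 - p) * g x (w x))).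
  by apply: eq_bigr => w _; rewrite big_split.
rewrite -(bigA_distr_bigA (fun x b => (if b then p else 1 - p) * g x b)).
by apply: eq_bigr => x _; rewrite big_bool.
Qed.

Lemma expectD p F G : expect p (fun w => F w + G w) = expect p F + expect p G.
Proof. by rewrite -big_split /=; apply: eq_bigr => w _; rewrite mulrDr. Qed.

Lemma expectZ p c F : expect p (fun w => c * F w) = c * expect p F.
Proof. by rewrite mulr_sumr; apply: eq_bigr => w _; rewrite mulrCA. Qed.

Lemma expectMr p c F : expect p (fun w => F w * c) = expect p F * c.
Proof. by rewrite mulr_suml; apply: eq_bigr => w _; rewrite mulrA. Qed.

Lemma expect_cst p c : expect p (fun=> c) = c.
Proof.
have h : expect p (fun=> 1) = 1.
  transitivity (expect p (fun w : {ffun I -> bool} => \prod_(x : I) 1)).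
    by apply: eq_bigr => w _; rewrite big1.
  by rewrite (expect_prod p (fun _ _ => 1)) big1 // => x _; ring.
by rewrite -[in RHS](mulr1 c) -h -expectZ; apply: eq_bigr => w _; rewrite mulr1.
Qed.

Lemma expect_sum p (J : finType) (F : J -> {ffun I -> bool} -> R) :
  expect p (fun w => \sum_j F j w) = \sum_j expect p (F j).
Proof. by rewrite exchange_big; apply: eq_bigr => w _; rewrite mulr_sumr. Qed.

Lemma eq_expect p F G : F =1 G -> expect p F = expect p G.
Proof. by move=> FG; apply: eq_bigr => w _; rewrite FG. Qed.

Lemma expect_coord p x : expect p (fun w => (w x)%:R) = p.
Proof.
transitivity (expect p (fun w => \prod_y (if y == x then (w y)%:R else 1))).
  by apply: eq_expect => w; rewrite -big_mkcond /= big_pred1_eq.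
rewrite (expect_prod p (fun y b => if y == x then b%:R else 1)) (bigD1 x) //= eqxx.
rewrite big1 => [|y /negPf->]; first by rewrite !mulr1 mulr0 addr0.
by rewrite !mulr1; ring.
Qed.

(** Exchanging the coordinates in [S] is an involution on pairs of samples that preserves the
    product weight, coordinate by coordinate. *)
Lemma expect_swap p (S : pred I) (F : {ffun I -> bool} -> {ffun I -> bool} -> R) :
  expect p (fun w => expect p (fun w' => F w w')) =
  expect p (fun w => expect p (fun w' => F (splice S w w') (splice S w' w))).
Proof.
have pairE (G : {ffun I -> bool} -> {ffun I -> bool} -> R) :
    expect p (fun w => expect p (fun w' => G w w')) =
    \sum_(u : {ffun I -> bool} * {ffun I -> bool}) bern p u.1 * bern p u.2 * G u.1 u.2.
  rewrite -(pair_bigA _ (fun w w' => bern p w * bern p w' * G w w')) /=.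
  by apply: eq_bigr => w _; rewrite mulr_sumr; apply: eq_bigr => w' _; rewrite mulrA.
rewrite !pairE.
pose h (u : {ffun I -> bool} * {ffun I -> bool}) := (splice S u.1 u.2, splice S u.2 u.1).
have hK : involutive h.
  by case=> w w'; rewrite /h /=; congr pair; apply/ffunP => x; rewrite !ffunE; case: (S x).
rewrite (reindex_inj (inv_inj hK)); apply: eq_bigr => -[w w'] _ /=; congr (_ * _).
rewrite /bern -!big_split /=; apply: eq_bigr => x _; rewrite !ffunE.
by case: (S x) => //; rewrite mulrC.
Qed.

(** The form in which conditioning is used: the outer sample supplies the coordinates outside [S],
    the inner one those inside. *)
Lemma expect_resample p (S : pred I) F :
  expect p F = expect p (fun w' => expect p (fun w => F (splice S w w'))).
Proof.
have /= := expect_swap p S (fun w w' => F w).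
rewrite (@eq_expect p (fun w => expect p (fun=> F w)) F) => [->|w]; last exact: expect_cst.
rewrite /expect.
rewrite (eq_bigr _ (fun w _ => mulr_sumr _ _ _ _)) exchange_big /=.
apply: eq_bigr => w _; rewrite mulr_sumr; apply: eq_bigr => w' _; by rewrite mulrCA.
Qed.

Section Monotone.
Variable p : R.
Hypothesis p01 : 0 <= p <= 1.

Lemma bern_ge0 w : 0 <= bern p w.
Proof. by case/andP: p01 => p0 p1; apply: prodr_ge0 => x _; case: ifP => _; lra. Qed.

Lemma expect_le F G : (forall w, F w <= G w) -> expect p F <= expect p G.
Proof. by move=> FG; apply: ler_sum => w _; apply: ler_wpM2l; [exact: bern_ge0|]. Qed.

Lemma expect_ge0 F : (forall w, 0 <= F w) -> 0 <= expect p F.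
Proof. by move=> h; rewrite -(expect_cst p 0); exact: expect_le. Qed.

Lemma prob_le (P Q : {ffun I -> bool} -> Prop) :
  (forall w, P w -> Q w) -> prob p P <= prob p Q.
Proof.
move=> PQ; apply: expect_le => w; case: asboolP => [/PQ Qw|_].
  by rewrite asboolT.
by case: ifP => _; rewrite ?ler01.
Qed.

(** Markov's inequality divides by [t]; the case [t = 0] is kept as an alternative that each
    application excludes. *)
Lemma prob_markov F t c : 0 <= t -> (forall w, 0 <= F w) -> expect p F <= t * c ->
  t = 0 \/ prob p (fun w => t < F w) <= c.
Proof.
move=> t0 F0 h; have [->|tn0] := eqVneq t 0; [by left|right].
have tp : 0 < t by rewrite lt_def tn0.
rewrite -(ler_pM2l tp); apply: le_trans h; rewrite -expectZ; apply: expect_le => w.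
case: asboolP => [/ltW|_]; first by rewrite mulr1.
by rewrite mulr0.
Qed.

Lemma prob_or (P Q : {ffun I -> bool} -> Prop) :
  prob p (fun w => P w \/ Q w) <= prob p P + prob p Q.
Proof.
rewrite /prob -expectD; apply: expect_le => w.
case: asboolP => [[Pw|Qw]|_]; last by do 2!case: ifP; rewrite ?addr0 ?add0r ?ler01 // => _ _; lra.
  by rewrite (asboolT Pw) lerDl; case: ifP; rewrite ?ler01.
by rewrite (asboolT Qw) lerDr; case: ifP; rewrite ?ler01.
Qed.

Lemma prob_exists (J : finType) (P : J -> {ffun I -> bool} -> Prop) c :
  (forall j, prob p (P j) <= c) ->
  prob p (fun w => exists j, P j w) <= #|J|%:R * c.
Proof.
move=> Pc; apply: (@le_trans _ _ (\sum_j prob p (P j))); last first.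
  apply: (le_trans (ler_sum _ (fun j _ => Pc j))).
  by rewrite sumr_const mulr_natl.
rewrite /prob -expect_sum; apply: expect_le => w.
have h0 j : 0 <= (if `[< P j w >] then 1 else 0) :> R by case: ifP.
case: asboolP => [[j Pj]|_]; last exact: sumr_ge0.
by rewrite (bigD1 j) //= (asboolT Pj) lerDl sumr_ge0.
Qed.

(** From 1 - x <= exp(-x) one gets exp(x) <= 1 / (1 - x), which is at most 1 + 2x on this
    interval. *)
Lemma expR_le1D2x (x : R) : 0 <= x <= 1 / 2 -> expR x <= 1 + 2 * x.
Proof.
move=> /andP[x0 x1]; have := expR_ge1Dx (- x); rewrite expRN => h.
have ep := expR_gt0 x.
have : (1 - x) * expR x <= 1.
  by rewrite -[leRHS](mulVf (lt0r_neq0 ep)) ler_pM2r.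
by nra.
Qed.

Lemma expect_expR_le (b : I -> R) : (forall x, 0 <= b x <= 1 / 2) ->
  expect p (fun w => expR (\sum_x b x * (w x)%:R)) <= expR (2 * (p * \sum_x b x)).
Proof.
move=> b01; case/andP: (p01) => p0 p1.
rewrite (@eq_expect p _ (fun w => \prod_x expR (b x * (w x)%:R))) => [|w]; last first.
  by rewrite expR_sum.
rewrite (expect_prod p (fun x c => expR (b x * c%:R))).
rewrite mulrA mulr_sumr expR_sum; apply: ler_prod => x _.
rewrite mulr1 mulr0 expR0 mulr1; have ep := expR_gt0 (b x); apply/andP; split.
  by apply: addr_ge0; [apply: mulr_ge0 => //; exact: ltW | lra].
apply: le_trans (expR_ge1Dx _).
by have := expR_le1D2x (b01 x) => h; nra.
Qed.

(** With [y] the sum, y <= 2v exp(y / 2v), so its power [s] is at most (2v)^s exp(s y / 2v), and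
    this exponential factorises over the coordinates. The bound [s%:R * b x <= v] keeps each
    exponent below 1/2; each of the two copies then contributes exp(s), whence the factor
    [expR 2]. *)
Lemma expect_moment_le (b : I -> R) (v : R) (s : nat) : 0 < v ->
  (forall x, 0 <= b x) -> (forall x, s%:R * b x <= v) -> p * (\sum_x b x) <= v ->
  expect p (fun w => expect p (fun w' =>
    (\sum_x b x * ((w x)%:R + (w' x)%:R)) ^+ s)) <= (2 * expR 2 * v) ^+ s.
Proof.
move=> v0 b0 bs bv.
pose t := s%:R / (2 * v).
have tb x : 0 <= t * b x <= 1 / 2.
  have vp : 0 < 2 * v by lra.
  apply/andP; split; first by rewrite mulr_ge0 // divr_ge0 ?ler0n // ltW.
  have -> : t * b x = (s%:R * b x) / (2 * v) by rewrite /t mulrAC.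
  by rewrite ler_pdivrMr //; have := bs x; lra.
pose G w := expR (\sum_x t * b x * (w x)%:R).
have key w w' : (\sum_x b x * ((w x)%:R + (w' x)%:R)) ^+ s <= (2 * v) ^+ s * (G w * G w').
  rewrite /G -expRD -big_split /=.
  set y := \sum_x b x * _.
  have -> : \sum_x (t * b x * (w x)%:R + t * b x * (w' x)%:R) = s%:R * (y / (2 * v)).
    rewrite /y mulrA mulrAC mulr_sumr.
    by apply: eq_bigr => x _; rewrite /t; ring.
  rewrite expRM_natl -exprMn.
  have y0 : 0 <= y by apply: sumr_ge0 => x _; rewrite mulr_ge0 // addr_ge0 ?ler0n.
  have vp : 0 < 2 * v by lra.
  have yle : y <= 2 * v * expR (y / (2 * v)).
    rewrite -ler_pdivrMl // mulrC.
    by have := expR_ge1Dx (y / (2 * v)); lra.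
  by rewrite lerXn2r // nnegrE // mulr_ge0 ?expR_ge0 // ltW.
apply: le_trans (_ : (2 * v) ^+ s * (expect p G * expect p G) <= _).
  rewrite -expectMr -expectZ; apply: expect_le => w.
  rewrite -!expectZ; apply: expect_le => w'; exact: key.
have GE : expect p G <= expR s%:R.
  apply: le_trans (expect_expR_le tb) _; rewrite ler_expR -mulr_sumr.
  have -> : 2 * (p * (t * \sum_x b x)) = s%:R * (p * (\sum_x b x) / v).
    by rewrite /t; field; exact: lt0r_neq0.
  by rewrite -{2}(mulr1 s%:R) ler_wpM2l ?ler0n // ler_pdivrMr // mul1r.
have G0 : 0 <= expect p G by apply: expect_ge0 => w; exact: expR_ge0.
have -> : (2 * expR 2 * v) ^+ s = (2 * v) ^+ s * (expR s%:R * expR s%:R).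
  have -> : expR s%:R * expR s%:R = expR 2 ^+ s :> R.
    by rewrite -expRD -expRM_natl; congr expR; ring.
  by rewrite -exprMn; congr (_ ^+ _); ring.
apply: ler_wpM2l; first by rewrite exprn_ge0 // mulr_ge0 // ltW.
exact: ler_pM.
Qed.

End Monotone.
End BernoulliExpectation.

(** * Abstract symmetrisation and Khintchine inequality *)

(* [Phi s], [B s] and [N s] stand for [tr x^(2s)], [tr (x^(2s+1) y)] and
   [tr (x^(2s) h^2)], or for their scalar analogues on a Euclidean space. *)
Section Khintchine.
Variables (R : realType) (I : finType) (X : lmodType R) (H : I -> X).
Variables (Phi : nat -> X -> R) (B N : nat -> X -> X -> R).

Definition lincomb (c : I -> R) : X := \sum_i c i *: H i.

Hypothesis Phi_ge0 : forall s c, 0 <= Phi s (lincomb c).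
Hypothesis BD : forall s x y z, B s x (y + z) = B s x y + B s x z.
Hypothesis BZ : forall s x a y, B s x (a *: y) = a * B s x y.
Hypothesis NZ : forall s x a y, N s x (a *: y) = a ^+ 2 * N s x y.
Hypothesis PhiE : forall s c, Phi s.+1 (lincomb c) = B s (lincomb c) (lincomb c).
Hypothesis Phi_convex : forall s c d,
  Phi s.+1 (lincomb c) - (2 * s.+1)%:R * B s (lincomb c) (lincomb d)
  <= Phi s.+1 (lincomb c - lincomb d).
Hypothesis B_meanvalue : forall s c d (x := lincomb c) (y := lincomb d),
  B s x (x - y) - B s y (x - y) <= (2 * s).+1%:R / 2 * (N s x (x - y) + N s y (x - y)).

Lemma lincombB c d : lincomb c - lincomb d = lincomb (fun i => c i - d i).
Proof. by rewrite -sumrB; apply: eq_bigr => i _; rewrite scalerBl. Qed.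

Lemma B_sum s x (F : I -> X) : B s x (\sum_i F i) = \sum_i B s x (F i).
Proof.
apply: (big_morph (B s x)) => [y z|]; first exact: BD.
by rewrite -(scale0r (0 : X)) BZ mul0r.
Qed.

Definition flip (i : I) (e : {ffun I -> bool}) : {ffun I -> bool} :=
  [ffun j => if j == i then ~~ e j else e j].

Lemma flipK i : involutive (flip i).
Proof. by move=> e; apply/ffunP => j; rewrite !ffunE; case: eqP => // _; rewrite negbK. Qed.

Definition signed (c : I -> R) (e : {ffun I -> bool}) : I -> R :=
  fun i => (-1) ^+ e i * c i.

(** Averaging the term of index [i] over a sign pattern and its flip at [i] turns it into an
    increment of [B] along [D e - D (flip i e)], a multiple of [H i]. The mean value hypothesis
    bounds this increment by [N], so one order of the moment is traded for a factor [beta]. *)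
Lemma khintchine_step (c : I -> R) (beta : R) s :
  (forall d, \sum_i c i ^+ 2 * N s (lincomb d) (H i) <= beta * Phi s (lincomb d)) ->
  \sum_e Phi s.+1 (lincomb (signed c e)) <=
  (2 * s).+1%:R * beta * \sum_e Phi s (lincomb (signed c e)).
Proof.
move=> hbeta; pose D e := lincomb (signed c e).
have Dflip e i : D e - D (flip i e) = (2 * signed c e i) *: H i.
  rewrite /D lincombB /lincomb (bigD1 i) //= big1 ?addr0 => [|j ji].
    congr (_ *: _); rewrite /signed ffunE eqxx.
    by case: (e i); rewrite /= ?expr0 ?expr1; ring.
  by rewrite /signed ffunE (negPf ji) subrr scale0r.
have eq1 : \sum_e Phi s.+1 (D e) = \sum_i \sum_e B s (D e) (signed c e i *: H i).
  rewrite exchange_big; apply: eq_bigr => e _.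
  by rewrite /D PhiE {3}/lincomb B_sum.
have eq2 i : \sum_e B s (D e) (signed c e i *: H i) =
    \sum_e 4^-1 * (B s (D e) (D e - D (flip i e)) - B s (D (flip i e)) (D e - D (flip i e))).
  have h1 : \sum_e B s (D e) (signed c e i *: H i) =
            \sum_e - B s (D (flip i e)) (signed c e i *: H i).
    rewrite (reindex_inj (inv_inj (flipK i))) /=; apply: eq_bigr => e _.
    rewrite !BZ /signed ffunE eqxx -mulNr; congr (_ * _).
    by case: (e i); rewrite /= ?expr0 ?expr1; ring.
  have -> : \sum_e B s (D e) (signed c e i *: H i) =
     2^-1 * (\sum_e B s (D e) (signed c e i *: H i) +
             \sum_e - B s (D (flip i e)) (signed c e i *: H i)).
    by rewrite -h1; field.
  rewrite -big_split /= mulr_sumr; apply: eq_bigr => e _.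
  by rewrite Dflip !BZ; field.
have N_flip i : \sum_e N s (D (flip i e)) (signed c e i *: H i) =
    \sum_e N s (D e) (signed c e i *: H i).
  rewrite [RHS](reindex_inj (inv_inj (flipK i))) /=; apply: eq_bigr => e _.
  by rewrite !NZ /signed !exprMn !sqrr_sign.
rewrite -/D eq1.
apply: le_trans (_ : \sum_i (2 * s).+1%:R * (\sum_e N s (D e) (signed c e i *: H i)) <= _).
  apply: ler_sum => i _; rewrite eq2.
  apply: le_trans (_ : \sum_e (2 * s).+1%:R / 2 * (N s (D e) (signed c e i *: H i) +
     N s (D (flip i e)) (signed c e i *: H i)) <= _).
    apply: ler_sum => e _; rewrite mulrC ler_pdivrMr //.
    apply: le_trans (B_meanvalue s _ _) _; rewrite -/(D _) -/(D _) Dflip !NZ.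
    by rewrite le_eqVlt; apply/orP; left; apply/eqP; ring.
  rewrite -mulr_sumr big_split /= N_flip le_eqVlt; apply/orP; left; apply/eqP.
  by field.
rewrite -mulr_sumr -mulrA ler_wpM2l ?ler0n // exchange_big /= mulr_sumr.
apply: ler_sum => e _; apply: le_trans (hbeta (signed c e)).
apply: ler_sum => i _; rewrite NZ /signed exprMn sqrr_sign mul1r //.
Qed.

Lemma khintchine (c : I -> R) (beta D : R) s : 0 <= beta ->
  (forall s d, \sum_i c i ^+ 2 * N s (lincomb d) (H i) <= beta * Phi s (lincomb d)) ->
  (forall d, Phi 0 (lincomb d) <= D) ->
  \sum_e Phi s (lincomb (signed c e)) <=
  ((2 * s)%:R * beta) ^+ s * \sum_(e : {ffun I -> bool}) D.
Proof.
move=> beta0 hbeta hD.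
(* The target order [s] is fixed during the induction: each factor [(2 * k).+1] with [k < s] is at
   most [2 * s], which yields a pure power. *)
suff h k : (k <= s)%N -> \sum_e Phi k (lincomb (signed c e)) <=
    ((2 * s)%:R * beta) ^+ k * \sum_(e : {ffun I -> bool}) D by exact: h.
elim: k => [_|k IH ks]; first by rewrite mul1r; apply: ler_sum => e _; exact: hD.
apply: le_trans (khintchine_step (hbeta k)) _; rewrite exprS -[leRHS]mulrA.
apply: ler_pM => //; last exact: IH (ltnW ks).
- by rewrite mulr_ge0 ?ler0n.
- by apply: sumr_ge0 => e _; exact: Phi_ge0.
apply: ler_wpM2r => //; rewrite ler_nat; lia.
Qed.

Lemma symmetrized_moment (p D : R) (beta : {ffun I -> bool} -> {ffun I -> bool} -> R) s :
  0 < p <= 1 ->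
  (forall w w', 0 <= beta w w') ->
  (forall (w w' : {ffun I -> bool}) s d,
     \sum_i (((w i)%:R - (w' i)%:R) / p) ^+ 2 * N s (lincomb d) (H i)
     <= beta w w' * Phi s (lincomb d)) ->
  (forall d, Phi 0 (lincomb d) <= D) ->
  expect p (fun w : {ffun I -> bool} => Phi s (lincomb (fun i => (w i)%:R / p - 1))) <=
  D * expect p (fun w => expect p (fun w' => ((2 * s)%:R * beta w w') ^+ s)).
Proof.
move=> /andP[p0 p1] beta0 hbeta hD.
have p01 : 0 <= p <= 1 by rewrite ltW.
case: s => [|s].
  have -> : expect p (fun w => expect p (fun w' => ((2 * 0)%:R * beta w w') ^+ 0)) = 1.
    rewrite -[RHS](expect_cst I p); apply: eq_expect => w.
    by rewrite -[RHS](expect_cst I p); apply: eq_expect => w'; exact: expr0.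
  rewrite mulr1.
  by rewrite -[leRHS](expect_cst I p D); apply: expect_le.
pose S (w : {ffun I -> bool}) := lincomb (fun i => (w i)%:R / p - 1).
pose z (w w' : {ffun I -> bool}) i : R := ((w i)%:R - (w' i)%:R) / p.
have SS w w' : S w - S w' = lincomb (z w w').
  by rewrite /S lincombB; congr lincomb; apply/funext => i; rewrite /z; ring.
have ES0 x : expect p (fun w => B s x (S w)) = 0.
  transitivity (\sum_i expect p (fun w => ((w i)%:R / p - 1) * B s x (H i))).
    rewrite -expect_sum; apply: eq_expect => w; rewrite /S /lincomb B_sum.
    by apply: eq_bigr => i _; rewrite BZ.
  rewrite big1 // => i _; rewrite expectMr expectD expectMr expect_coord expect_cst.
  by rewrite divff ?subrr ?mul0r // lt0r_neq0.
(* Jensen's inequality: in the tangent bound [Phi_convex] at [S w], the linear term has mean zero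
   over the independent copy. *)
apply: le_trans (_ : expect p (fun w => expect p (fun w' => Phi s.+1 (S w - S w'))) <= _).
  apply: expect_le => // w.
  apply: le_trans (_ : expect p (fun w' => Phi s.+1 (S w) +
    - (2 * s.+1)%:R * B s (S w) (S w')) <= _).
    by rewrite expectD expectZ ES0 mulr0 addr0 expect_cst.
  by apply: expect_le => // w'; rewrite mulNr; exact: Phi_convex.
(* Exchanging the two copies at the coordinates where [e] is true negates exactly those
   coefficients, so every sign pattern gives the same expectation and they may be averaged. *)
have swapE (e : {ffun I -> bool}) : expect p (fun w => expect p (fun w' => Phi s.+1 (S w - S w'))) =
    expect p (fun w => expect p (fun w' => Phi s.+1 (lincomb (signed (z w w') e)))).
  rewrite (expect_swap p (fun i => ~~ e i)); apply: eq_expect => w; apply: eq_expect => w'.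
  rewrite SS; congr (Phi _ (lincomb _)); apply/funext => i; rewrite /z /signed !ffunE.
  by case: (e i); rewrite /= ?expr0 ?expr1; ring.
have cardp : 0 < #|{ffun I -> bool}|%:R :> R.
  by rewrite ltr0n card_ffun expn_gt0 card_bool.
rewrite -(ler_pM2l cardp).
have -> : #|{ffun I -> bool}|%:R * expect p (fun w => expect p (fun w' => Phi s.+1 (S w - S w')))
  = expect p (fun w => expect p (fun w' => \sum_e Phi s.+1 (lincomb (signed (z w w') e)))).
  rewrite mulr_natl -sumr_const.
  rewrite (eq_bigr _ (fun e _ => swapE e)) -expect_sum; apply: eq_expect => w.
  by rewrite -expect_sum.
rewrite mulrA -expectZ; apply: expect_le => // w; rewrite -expectZ; apply: expect_le => // w'.
apply: le_trans (khintchine _ (beta0 w w') (hbeta w w') hD) _.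
by rewrite sumr_const mulrC [#|_|%:R * D]mulr_natl.
Qed.

End Khintchine.

(** * Tangent and mean value inequalities for integer powers *)

Section PowerInequalities.
Variable R : realType.
Implicit Types x y t u : R.

Lemma expr_tangent t u s : 0 <= t -> 0 <= u ->
  u ^+ s.+1 + s.+1%:R * u ^+ s * (t - u) <= t ^+ s.+1.
Proof.
move=> t0 u0; elim: s => [|s IH]; first by rewrite !expr1 expr0; lra.
rewrite [leRHS]exprS; apply: le_trans (ler_wpM2l t0 IH).
have h : 0 <= s.+1%:R * u ^+ s * (t - u) ^+ 2.
  by nonneg.
rewrite -subr_ge0; apply: le_trans h _; rewrite le_eqVlt; apply/orP; left; apply/eqP.
by rewrite !exprS -[s.+2]addn1 natrD; ring.
Qed.

(** Composes the tangent of [t ^+ s.+1] at [x ^+ 2] with y^2 - x^2 >= 2x(y - x), which removes any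
    sign condition on [x] and [y]. *)
Lemma expr_even_tangent x y s :
  x ^+ (2 * s.+1) + (2 * s.+1)%:R * x ^+ (2 * s).+1 * (y - x) <= y ^+ (2 * s.+1).
Proof.
rewrite !exprM; apply: le_trans (expr_tangent s (sqr_ge0 y) (sqr_ge0 x)).
rewrite lerD2l -subr_ge0 [x ^+ (2 * s).+1]exprS exprM natrM.
have h : 0 <= s.+1%:R * (x ^+ 2) ^+ s * (y - x) ^+ 2.
  by nonneg.
by apply: le_trans h _; rewrite le_eqVlt; apply/orP; left; apply/eqP; ring.
Qed.

(** For odd m, x^(m+2) - y^(m+2) equals (x^2 + y^2)/2 times x^m - y^m plus (x^2 - y^2)/2 times x^m +
    y^m; the second part is the induction hypothesis at [x] and [- y]. *)
Lemma expr_odd_mono x y s : 0 <= (x - y) * (x ^+ (2 * s).+1 - y ^+ (2 * s).+1).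
Proof.
elim: s x y => [|s IH] x y; first by rewrite -expr2 sqr_ge0.
have h1 : 0 <= (x ^+ 2 + y ^+ 2) / 2 * ((x - y) * (x ^+ (2 * s).+1 - y ^+ (2 * s).+1)).
  by rewrite mulr_ge0 ?IH // divr_ge0 // addr_ge0 ?sqr_ge0.
have h2 : 0 <= (x - y) ^+ 2 / 2 * ((x - - y) * (x ^+ (2 * s).+1 - (- y) ^+ (2 * s).+1)).
  by rewrite mulr_ge0 ?IH // divr_ge0 // sqr_ge0.
apply: le_trans (addr_ge0 h1 h2) _; rewrite le_eqVlt; apply/orP; left; apply/eqP.
have -> : (2 * s.+1)%N = (2 * s).+2 by lia.
by rewrite !exprS !exprM sqrrN; field.
Qed.

(** The trapezoidal bound for the integral of the convex derivative of [t ^+ (2 * s).+1] between [y]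
    and [x]. The induction replaces the integral by a polynomial identity with nonnegative terms. *)
Lemma expr_meanvalue x y s :
  (x - y) * (x ^+ (2 * s).+1 - y ^+ (2 * s).+1) <=
  (2 * s).+1%:R / 2 * (x - y) ^+ 2 * (x ^+ (2 * s) + y ^+ (2 * s)).
Proof.
elim: s => [|s IH].
  by rewrite !muln0 !expr1 !expr0 -expr2 le_eqVlt; apply/orP; left; apply/eqP; field.
set a := _ * _ in IH; have a0 : 0 <= a := expr_odd_mono x y s.
have h1 : 0 <= (x - y) ^+ 2 / 2 * a by rewrite mulr_ge0 // divr_ge0 ?sqr_ge0.
have h2 : 0 <= (x ^+ 2 + y ^+ 2) / 2 * ((2 * s).+1%:R / 2 * (x - y) ^+ 2 *
    (x ^+ (2 * s) + y ^+ (2 * s)) - a).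
  by apply: mulr_ge0; [nonneg | rewrite subr_ge0].
have h3 : 0 <= (x ^+ 2 - y ^+ 2) * (x ^+ (2 * s) - y ^+ (2 * s)).
  rewrite !exprM; have := sqr_ge0 x; have := sqr_ge0 y.
  move: (x ^+ 2) (y ^+ 2) => X Y Y0 X0; rewrite subrXX mulrA -expr2.
  by rewrite mulr_ge0 ?sqr_ge0 // sumr_ge0 // => i _; rewrite mulr_ge0 ?exprn_ge0.
have h4 : 0 <= (2 * s).+1%:R / 4 * (x - y) ^+ 2 *
    ((x ^+ 2 - y ^+ 2) * (x ^+ (2 * s) - y ^+ (2 * s))).
  by rewrite mulr_ge0 // mulr_ge0 ?sqr_ge0 // divr_ge0 ?ler0n.
rewrite -subr_ge0; apply: le_trans (addr_ge0 (addr_ge0 h1 h2) h4) _.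
rewrite le_eqVlt; apply/orP; left; apply/eqP; rewrite /a.
have -> : (2 * s.+1)%N = (2 * s).+2 by lia.
rewrite !exprS -[(2 * s).+3]addn2 -[(2 * s).+1]addn1 !natrD.
by move: (x ^+ (2 * s)) (y ^+ (2 * s)) ((2 * s)%:R : R) => X Y k; field.
Qed.

End PowerInequalities.

(** * Dimension-free moments and tails for sums of independent vectors *)

Section VectorTail.
Variables (R : realType) (I : finType) (a b : nat) (H : I -> 'M[R]_(a, b)).

(** Makes the variance proxy linear in the two samples, so that its exponential factorises. *)
Lemma sq_bool_diff_le (u v : bool) : (u%:R - v%:R : R) ^+ 2 <= u%:R + v%:R.
Proof. by case: u; case: v; rewrite /= ?expr2; lra. Qed.

Lemma vector_moment (p v : R) s : 0 < p <= 1 -> 0 < v ->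
  (\sum_x sqnorm (H x)) / p <= v -> (forall x, s%:R * (sqnorm (H x) / p ^+ 2) <= v) ->
  expect p (fun w : {ffun I -> bool} =>
    sqnorm (\sum_x ((w x)%:R / p - 1) *: H x) ^+ s) <= (4 * expR 2 * s%:R * v) ^+ s.
Proof.
move=> p01 v0 hsum hmax; have /andP[p0 p1] := p01.
pose beta (w w' : {ffun I -> bool}) : R :=
  \sum_x sqnorm (H x) / p ^+ 2 * ((w x)%:R + (w' x)%:R).
have b0 x : 0 <= sqnorm (H x) / p ^+ 2 by rewrite divr_ge0 ?sqnorm_ge0 ?sqr_ge0.
have beta0 w w' : 0 <= beta w w'.
  by apply: sumr_ge0 => x _; rewrite mulr_ge0 // addr_ge0 ?ler0n.
have := @symmetrized_moment R I _ H (fun s x => sqnorm x ^+ s)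
  (fun s x y => sqnorm x ^+ s * fdot x y) (fun s x h => sqnorm x ^+ s * sqnorm h)
  _ _ _ _ _ _ _ p 1 beta s p01 beta0.
rewrite /lincomb mul1r => h; apply: le_trans (h _ _ _ _ _ _ _ _ _) _.
- by move=> k c; rewrite exprn_ge0 ?sqnorm_ge0.
- by move=> k x y z; rewrite fdotDr mulrDr.
- by move=> k x c y; rewrite fdotZr mulrCA.
- by move=> k x c y; rewrite sqnormZ mulrCA.
- by move=> k c; rewrite exprSr.
- move=> k c d /=; rewrite sqnormB; move: (\sum_i c i *: H i) (\sum_i d i *: H i) => x y.
  have xy0 : 0 <= sqnorm x - 2 * fdot x y + sqnorm y by rewrite -sqnormB sqnorm_ge0.
  apply: le_trans (expr_tangent k xy0 (sqnorm_ge0 x)).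
  have h' : 0 <= k.+1%:R * (sqnorm x ^+ k * sqnorm y) by nonneg.
  by rewrite -subr_ge0; from_nonneg h'; rewrite natrM; ring.
- move=> k c d /=; move: (\sum_i c i *: H i) (\sum_i d i *: H i) => x y.
  rewrite sqnormB !fdotDr !fdotNr -!/(sqnorm _) (fdotC y x).
  (* With [fdot x y] replaced by the product of the norms, the claim is the scalar inequality for
     the norms. The replacement shifts the gap by [h2], nonnegative by Cauchy-Schwarz. *)
  have := expr_meanvalue (fnorm x) (fnorm y) k.
  rewrite !exprS !exprM !fnorm_sq -subr_ge0 => h1.
  have h2 : 0 <= (2 * k)%:R * (fnorm x * fnorm y - fdot x y) * (sqnorm x ^+ k + sqnorm y ^+ k).
    rewrite mulr_ge0 ?addr_ge0 ?exprn_ge0 ?sqnorm_ge0 // mulr_ge0 ?ler0n // subr_ge0.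
    exact: fdot_le.
  rewrite -subr_ge0; apply: le_trans (addr_ge0 h1 h2) _.
  rewrite le_eqVlt; apply/orP; left; apply/eqP.
  rewrite -[(2 * k).+1]addn1 natrD -!fnorm_sq; by field.
- move=> w w' k d; rewrite /beta mulr_suml; apply: ler_sum => x _.
  have h0 : 0 <= (w x)%:R + (w' x)%:R - ((w x)%:R - (w' x)%:R) ^+ 2 :> R.
    by rewrite subr_ge0 sq_bool_diff_le.
  have h' := mulr_ge0 h0 (mulr_ge0 (b0 x) (exprn_ge0 k (sqnorm_ge0 (\sum_i d i *: H i)))).
  by rewrite -subr_ge0 expr_div_n; from_nonneg h'; ring.
- by move=> d; rewrite expr0.
have p01' : 0 <= p <= 1 by rewrite ltW.
have hpv : p * (\sum_x sqnorm (H x) / p ^+ 2) <= v.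
  apply: le_trans hsum; rewrite -mulr_suml le_eqVlt; apply/orP; left; apply/eqP.
  by field; exact: lt0r_neq0.
have hm := expect_moment_le p01' v0 b0 hmax hpv.
rewrite (@eq_expect _ _ _ _ (fun w => (2 * s)%:R ^+ s * expect p (fun w' => beta w w' ^+ s))).
  rewrite expectZ; apply: le_trans (ler_wpM2l _ hm) _; first by rewrite exprn_ge0 ?ler0n.
  rewrite -exprMn le_eqVlt; apply/orP; left; apply/eqP; congr (_ ^+ _).
  by rewrite natrM; ring.
by move=> w; rewrite -expectZ; apply: eq_expect => w'; rewrite exprMn.
Qed.

(** Markov at the power [s]: the threshold has [expR 3] where the moment has [expR 2], and this
    factor e to the power [s] is the gain. *)
Lemma vector_tail (p v : R) s : (0 < s)%N -> 0 < p <= 1 -> 0 <= v ->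
  (\sum_x sqnorm (H x)) / p <= v -> (forall x, s%:R * (sqnorm (H x) / p ^+ 2) <= v) ->
  prob p (fun w : {ffun I -> bool} =>
    4 * expR 3 * s%:R * v < sqnorm (\sum_x ((w x)%:R / p - 1) *: H x)) <= expR (- s%:R).
Proof.
move=> s0 p01 v0 hsum hmax; have /andP[p0 p1] := p01.
have p01' : 0 <= p <= 1 by rewrite ltW.
(* If [v = 0], every [H x] vanishes and the strict inequality never occurs; the moment bound
   requires [0 < v]. *)
have [vE|vn0] := eqVneq v 0.
  rewrite (_ : prob _ _ = 0) ?expR_ge0 //.
  rewrite /prob -[RHS](expect_cst I p); apply: eq_expect => w.
  rewrite asboolF // big1 ?sqnorm0 ?vE ?mulr0 ?ltxx // => x _.
  rewrite (sqnorm_eq0 (M := H x)) ?scaler0 //; apply/eqP; rewrite eq_le sqnorm_ge0 andbT.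
  have := hmax x; rewrite vE mulrA pmulr_lle0 ?invr_gt0 ?exprn_gt0 //.
  by rewrite pmulr_rle0 ?ltr0n.
have vp : 0 < v by rewrite lt_def vn0.
have h := vector_moment p01 vp hsum hmax.
set t := 4 * expR 3 * s%:R * v.
have tp : 0 < t by rewrite !mulr_gt0 ?expR_gt0 ?ltr0n.
have ht : (4 * expR 2 * s%:R * v) ^+ s = t ^+ s * expR (- s%:R).
  have -> : expR (- s%:R) = expR (-1) ^+ s :> R by rewrite -expRM_natl mulrN1.
  have -> : expR 2 = expR 3 * expR (-1) :> R by rewrite -expRD; congr expR; ring.
  by rewrite -exprMn /t; congr (_ ^+ _); ring.
rewrite ht in h.
case: (prob_markov p01' _ _ h) => [|w|/eqP|].
- by rewrite exprn_ge0 // ltW.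
- by rewrite exprn_ge0 ?sqnorm_ge0.
- by rewrite expf_eq0 s0 (gt_eqF tp).
apply: le_trans; apply: prob_le => // w htw.
by rewrite ltrXn2r // ?nnegrE ?ltW // -lt0n.
Qed.

End VectorTail.

(** * Trace inequalities for pairs of symmetric matrices *)

Section TraceInequalities.
Variables (R : realType) (n : nat).
Implicit Types (X Y V W : 'M[R]_n) (l k : 'rV[R]_n).

Lemma diagonalization_recompose V l X : V^T *m V = 1%:M -> V^T *m X *m V = diag_mx l ->
  X = V *m diag_mx l *m V^T.
Proof.
move=> VV VX; have VV' := mulmx1C VV.
by rewrite -VX !mulmxA VV' mul1mx -mulmxA VV' mulmx1.
Qed.

Lemma expmx_diagonalization V l X m : V^T *m V = 1%:M -> V^T *m X *m V = diag_mx l ->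
  X ^+ m = V *m diag_mx (\row_i l 0 i ^+ m) *m V^T.
Proof.
move=> VV VX; elim: m => [|m IH].
  rewrite expr0 (_ : diag_mx _ = 1%:M) ?mulmx1 ?(mulmx1C VV) //.
  by apply/matrixP => i j; rewrite !mxE expr0.
rewrite exprS IH -[X * _]/(X *m _) {1}(diagonalization_recompose VV VX).
rewrite !mulmxA -(mulmxA _ V^T) VV mulmx1 -(mulmxA V) mulmx_diag.
by congr (V *m diag_mx _ *m V^T); apply/rowP => i; rewrite !mxE exprS.
Qed.

Lemma expmx_sym X m : X^T = X -> (X ^+ m)^T = X ^+ m.
Proof.
move=> Xs; elim: m => [|m IH]; first by rewrite expr0 trmx1.
by rewrite {1}exprS -[X * _]/(X *m _) trmx_mul IH Xs exprSr.
Qed.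

Lemma expmx_even_diag_ge0 X m i : X^T = X -> 0 <= (X ^+ (2 * m)) i i.
Proof.
move=> Xs; rewrite mulnC exprM expr2 -[_ * _]/(_ *m _) mxE; apply: sumr_ge0 => j _.
by rewrite -{1}(expmx_sym m Xs) mxE -expr2 sqr_ge0.
Qed.

(** The squared overlaps of two eigenbases are nonnegative weights that turn a trace in two
    non-commuting matrices into a double sum over pairs of eigenvalues. *)
Lemma trace_mul_overlap V l X W k Y m m' :
  V^T *m V = 1%:M -> V^T *m X *m V = diag_mx l ->
  W^T *m W = 1%:M -> W^T *m Y *m W = diag_mx k ->
  \tr (X ^+ m *m Y ^+ m') =
  \sum_i \sum_j (V^T *m W) i j ^+ 2 * (l 0 i ^+ m * k 0 j ^+ m').
Proof.
move=> VV VX WW WY; rewrite (expmx_diagonalization m VV VX) (expmx_diagonalization m' WW WY).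
set M := V^T *m W.
have -> : V *m diag_mx (\row_i l 0 i ^+ m) *m V^T *m
  (W *m diag_mx (\row_i k 0 i ^+ m') *m W^T) =
  V *m (diag_mx (\row_i l 0 i ^+ m) *m M *m diag_mx (\row_i k 0 i ^+ m') *m W^T).
  by rewrite /M !mulmxA.
rewrite mxtrace_mulC -[_ *m W^T *m V]mulmxA.
have -> : W^T *m V = M^T by rewrite /M trmx_mul trmxK.
rewrite /mxtrace; apply: eq_bigr => i _; rewrite mxE; apply: eq_bigr => j _.
by rewrite mul_diag_mx mul_mx_diag !mxE; ring.
Qed.

(** Every word that arises is cyclically equal to some [X ^+ u *m Y ^+ v], so each trace is the
    corresponding scalar expression in the eigenvalues, and scalar inequalities transfer
    termwise. *)
Lemma trace_overlap_diff V l X W k Y (c := fun i j => (V^T *m W) i j ^+ 2) m :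
  V^T *m V = 1%:M -> V^T *m X *m V = diag_mx l ->
  W^T *m W = 1%:M -> W^T *m Y *m W = diag_mx k ->
  [/\ \tr (X ^+ m) = \sum_i \sum_j c i j * l 0 i ^+ m,
      \tr (Y ^+ m) = \sum_i \sum_j c i j * k 0 j ^+ m,
      \tr (X ^+ m *m (X - Y)) = \sum_i \sum_j c i j * (l 0 i ^+ m * (l 0 i - k 0 j)),
      \tr (Y ^+ m *m (X - Y)) = \sum_i \sum_j c i j * (k 0 j ^+ m * (l 0 i - k 0 j)) &
      \tr (X ^+ m *m ((X - Y) *m (X - Y))) =
        \sum_i \sum_j c i j * (l 0 i ^+ m * (l 0 i - k 0 j) ^+ 2) /\
      \tr (Y ^+ m *m ((X - Y) *m (X - Y))) =
        \sum_i \sum_j c i j * (k 0 j ^+ m * (l 0 i - k 0 j) ^+ 2)].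
Proof.
move=> VV VX WW WY.
have T u v : \tr (X ^+ u *m Y ^+ v) = _ := trace_mul_overlap u v VV VX WW WY.
have mulE (A B : 'M[R]_n) : A *m B = A * B by [].
have XT u : \tr (X ^+ u) = \sum_i \sum_j c i j * l 0 i ^+ u.
  rewrite -(mulmx1 (X ^+ u)) -[1%:M]/(Y ^+ 0) T.
  by apply: eq_bigr => i _; apply: eq_bigr => j _; rewrite expr0 mulr1.
have YT u : \tr (Y ^+ u) = \sum_i \sum_j c i j * k 0 j ^+ u.
  rewrite -(mul1mx (Y ^+ u)) -[1%:M]/(X ^+ 0) T.
  by apply: eq_bigr => i _; apply: eq_bigr => j _; rewrite expr0 mul1r.
have sum2 (F G : 'I_n -> 'I_n -> R) :
    \sum_i \sum_j F i j - \sum_i \sum_j G i j = \sum_i \sum_j (F i j - G i j).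
  by rewrite -sumrB; apply: eq_bigr => i _; rewrite sumrB.
have sum2D (F G : 'I_n -> 'I_n -> R) :
    \sum_i \sum_j F i j + \sum_i \sum_j G i j = \sum_i \sum_j (F i j + G i j).
  by rewrite -big_split /=; apply: eq_bigr => i _; rewrite big_split.
have sqE : (X - Y) *m (X - Y) = X ^+ 2 - X *m Y - Y *m X + Y ^+ 2.
  rewrite mulmxBr !mulmxBl !expr2 -!mulE.
  move: (X *m X) (X *m Y) (Y *m X) (Y *m Y) => A B C D.
  by apply/matrixP => i j; rewrite !mxE; ring.
split; [exact: XT | exact: YT | | |split].
- rewrite mulmxBr raddfB /= mulE -exprSr XT -[\tr (X ^+ m *m Y)]/(\tr (X ^+ m *m Y ^+ 1)) T sum2.
  by apply: eq_bigr => i _; apply: eq_bigr => j _; rewrite -/(c i j) expr1 exprSr; ring.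
- rewrite mulmxBr raddfB /= mxtrace_mulC.
  rewrite -[\tr (X *m Y ^+ m)]/(\tr (X ^+ 1 *m Y ^+ m)) T [Y ^+ m *m Y]mulE -exprSr YT sum2.
  by apply: eq_bigr => i _; apply: eq_bigr => j _; rewrite -/(c i j) expr1 exprSr; ring.
- rewrite sqE !(mulmxDr, mulmxN) !raddfD !raddfN /=.
  have -> : \tr (X ^+ m *m X ^+ 2) = \tr (X ^+ (m + 2)) by rewrite exprD.
  have -> : \tr (X ^+ m *m (X *m Y)) = \tr (X ^+ m.+1 *m Y ^+ 1) by rewrite mulmxA exprSr expr1.
  have -> : \tr (X ^+ m *m (Y *m X)) = \tr (X ^+ m.+1 *m Y ^+ 1).
    by rewrite mulmxA mxtrace_mulC mulmxA exprS expr1.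
  rewrite XT !T !sum2 !sum2D; apply: eq_bigr => i _; apply: eq_bigr => j _.
  by rewrite -/(c i j) exprD expr1 [l 0 i ^+ m.+1]exprSr; ring.
- rewrite sqE !(mulmxDr, mulmxN) !raddfD !raddfN /=.
  have -> : \tr (Y ^+ m *m Y ^+ 2) = \tr (Y ^+ (m + 2)) by rewrite exprD.
  have -> : \tr (Y ^+ m *m (X *m Y)) = \tr (X ^+ 1 *m Y ^+ m.+1).
    by rewrite expr1 exprS mulmxA mxtrace_mulC mulmxA mxtrace_mulC.
  have -> : \tr (Y ^+ m *m (Y *m X)) = \tr (X ^+ 1 *m Y ^+ m.+1).
    by rewrite expr1 exprSr mulmxA mxtrace_mulC.
  rewrite [\tr (Y ^+ m *m X ^+ 2)]mxtrace_mulC YT !T !sum2 !sum2D.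
  apply: eq_bigr => i _; apply: eq_bigr => j _.
  by rewrite -/(c i j) exprD expr1 [k 0 j ^+ m.+1]exprSr; ring.
Qed.

Lemma trace_expr_convex X Y s : X^T = X -> Y^T = Y ->
  \tr (X ^+ (2 * s.+1)) - (2 * s.+1)%:R * \tr (X ^+ (2 * s).+1 *m Y)
  <= \tr ((X - Y) ^+ (2 * s.+1)).
Proof.
move=> Xs Ys; have Ds : (X - Y)^T = X - Y by rewrite linearB /= Xs Ys.
have [V [l [VV VX]]] := symmetric_diagonalizable Xs.
(* The second basis diagonalises [X - Y] instead of [Y], since [X] and [X - Y] are the matrices
   raised to powers; [Y] is recovered as their difference. *)
have [W [k [WW WD]]] := symmetric_diagonalizable Ds.
have [XE YE _ _ _] := trace_overlap_diff (2 * s.+1) VV VX WW WD.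
have [_ _ ZE _ _] := trace_overlap_diff (2 * s).+1 VV VX WW WD.
rewrite subKr in ZE; rewrite XE YE ZE mulr_sumr -sumrB; apply: ler_sum => i _.
rewrite mulr_sumr -sumrB; apply: ler_sum => j _.
have h0 : 0 <= k 0 j ^+ (2 * s.+1) - (l 0 i ^+ (2 * s.+1) +
    (2 * s.+1)%:R * l 0 i ^+ (2 * s).+1 * (k 0 j - l 0 i)).
  by rewrite subr_ge0 expr_even_tangent.
have h := mulr_ge0 (sqr_ge0 ((V^T *m W) i j)) h0.
by rewrite -subr_ge0; from_nonneg h; ring.
Qed.

Lemma trace_expr_meanvalue X Y s : X^T = X -> Y^T = Y ->
  \tr (X ^+ (2 * s).+1 *m (X - Y)) - \tr (Y ^+ (2 * s).+1 *m (X - Y)) <=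
  (2 * s).+1%:R / 2 * (\tr (X ^+ (2 * s) *m ((X - Y) *m (X - Y))) +
                       \tr (Y ^+ (2 * s) *m ((X - Y) *m (X - Y)))).
Proof.
move=> Xs Ys.
have [V [l [VV VX]]] := symmetric_diagonalizable Xs.
have [W [k [WW WY]]] := symmetric_diagonalizable Ys.
have [_ _ -> -> _] := trace_overlap_diff (2 * s).+1 VV VX WW WY.
have [_ _ _ _ [-> ->]] := trace_overlap_diff (2 * s) VV VX WW WY.
rewrite -sumrB -big_split /= mulr_sumr; apply: ler_sum => i _.
rewrite -sumrB -big_split /= mulr_sumr; apply: ler_sum => j _.
have := expr_meanvalue (l 0 i) (k 0 j) s; set u := (X in X <= _); set v := (X in _ <= X) => uv.
have h0 : 0 <= v - u by rewrite subr_ge0.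
have h := mulr_ge0 (sqr_ge0 ((V^T *m W) i j)) h0.
by rewrite -subr_ge0; from_nonneg h; rewrite /u /v; ring.
Qed.

(** The trace of an even power is a sum of nonnegative eigenvalue powers and dominates each of
    them. *)
Lemma opnorm_le_trace X (t : R) s : (0 < s)%N -> X^T = X -> 0 <= t ->
  \tr (X ^+ (2 * s)) <= t ^+ s -> opnorm_le X (Num.sqrt t).
Proof.
move=> s0 Xs t0 ht x; have [V [l [VV VX]]] := symmetric_diagonalizable Xs.
rewrite sqr_sqrtr // (diagonalization_recompose VV VX) -!mulmxA sqnorm_isom //.
have VV' : (V^T)^T *m V^T = 1%:M by rewrite trmxK (mulmx1C VV).
rewrite -[sqnorm x](sqnorm_isom x VV'); move: (V^T *m x) => y.
rewrite mul_diag_mx !sqnormE mulr_sumr; apply: ler_sum => i _.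
rewrite !big_ord1 mxE exprMn; apply: ler_wpM2r; first exact: sqr_ge0.
rewrite -(ler_pXn2r s0) ?nnegrE ?sqr_ge0 //; apply: le_trans ht.
have -> : \tr (X ^+ (2 * s)) = \sum_i l 0 i ^+ (2 * s).
  rewrite (expmx_diagonalization _ VV VX) -mulmxA mxtrace_mulC -mulmxA VV mulmx1.
  by rewrite /mxtrace; apply: eq_bigr => j _; rewrite !mxE eqxx.
rewrite (bigD1 i) //= exprM lerDl sumr_ge0 // => j _.
by rewrite exprM exprn_ge0 ?sqr_ge0.
Qed.

End TraceInequalities.

(** * Operator norm tails for sums of independent matrices with diagonal squares *)

Section MatrixTail.
Variables (R : realType) (I : finType) (n : nat) (H : I -> 'M[R]_n).
Hypothesis Hsym : forall x, (H x)^T = H x.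
Hypothesis Hdiag : forall x i j, i != j -> (H x *m H x) i j = 0.

Lemma lincomb_sym c : (lincomb H c)^T = lincomb H c.
Proof.
by rewrite /lincomb linear_sum; apply: eq_bigr => x _; rewrite linearZ /= Hsym.
Qed.

Lemma mul_self_diag x i : (H x *m H x) i i = sqnorm (row i (H x)).
Proof.
rewrite mxE sqnormE big_ord1; apply: eq_bigr => j _.
by rewrite !mxE -{2}(Hsym x) mxE expr2.
Qed.

(** As the squares of the [H x] are diagonal, [\tr (P *m (H x *m H x))] sees only the nonnegative
    diagonal of the even power [P], and the largest row sum [g i] serves as proxy. One factor [n] is
    the trace at order 0, the other bounds the power of the maximum by the sum over rows. *)
Lemma matrix_moment (p v : R) s : (0 < s)%N -> 0 < p <= 1 -> 0 < v ->
  (forall i, (\sum_x sqnorm (row i (H x))) / p <= v) ->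
  (forall i x, s%:R * (sqnorm (row i (H x)) / p ^+ 2) <= v) ->
  expect p (fun w : {ffun I -> bool} =>
    \tr ((\sum_x ((w x)%:R / p - 1) *: H x) ^+ (2 * s))) <=
  n%:R ^+ 2 * (4 * expR 2 * s%:R * v) ^+ s.
Proof.
move=> s0 p01 v0 hsum hmax; have /andP[p0 p1] := p01.
pose g i (w w' : {ffun I -> bool}) : R :=
  \sum_x sqnorm (row i (H x)) / p ^+ 2 * ((w x)%:R + (w' x)%:R).
have g0 i w w' : 0 <= g i w w' by apply: sumr_ge0 => x _; nonneg.
pose beta (w w' : {ffun I -> bool}) : R := \big[Num.max/0]_i g i w w'.
have gbeta i w w' : g i w w' <= beta w w' by rewrite /beta (bigD1 i) //= le_max lexx.
have betaP w w' : 0 <= beta w w' /\ beta w w' ^+ s <= \sum_i g i w w' ^+ s.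
  rewrite /beta; elim/big_ind2: _ => [|x1 y1 x2 y2 [a1 b1] [a2 b2]|i _].
  - by rewrite expr0n -[s == 0]negbK -lt0n s0.
  - split; first by rewrite le_max a1.
    have y10 := le_trans (exprn_ge0 s a1) b1; have y20 := le_trans (exprn_ge0 s a2) b2.
    by rewrite maxEle; case: ifP => _; lra.
  - by split.
have beta0 w w' : 0 <= beta w w' by case: (betaP w w').
have := @symmetrized_moment R I _ H (fun s X => \tr (X ^+ (2 * s)))
  (fun s X Y => \tr (X ^+ (2 * s).+1 *m Y)) (fun s X Y => \tr (X ^+ (2 * s) *m (Y *m Y)))
  _ _ _ _ _ _ _ p n%:R beta s p01 beta0.
rewrite -/(lincomb H) => h; apply: le_trans (h _ _ _ _ _ _ _ _ _) _.
- move=> k c; apply: sumr_ge0 => i _; apply: expmx_even_diag_ge0; exact: lincomb_sym.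
- by move=> k x y z; rewrite mulmxDr raddfD.
- by move=> k x c y; rewrite -scalemxAr mxtraceZ.
- by move=> k x c y; rewrite -scalemxAl -!scalemxAr scalerA mxtraceZ expr2.
- by move=> k c; rewrite -[_ *m _]/(_ * _) -exprSr; congr (\tr (_ ^+ _)); lia.
- by move=> k c d; apply: trace_expr_convex; exact: lincomb_sym.
- by move=> k c d; apply: trace_expr_meanvalue; exact: lincomb_sym.
- move=> w w' k d; set P := lincomb H d ^+ (2 * k).
  have P0 i : 0 <= P i i by apply: expmx_even_diag_ge0; exact: lincomb_sym.
  have trP x : \tr (P *m (H x *m H x)) = \sum_i P i i * sqnorm (row i (H x)).
    rewrite /mxtrace; apply: eq_bigr => i _; rewrite mxE (bigD1 i) //= mul_self_diag.
    by rewrite big1 ?addr0 // => j ji; rewrite Hdiag ?mulr0 // .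
  rewrite (eq_bigr _ (fun x _ => congr1 _ (trP x))).
  rewrite (eq_bigr _ (fun x _ => mulr_sumr _ _ _ _)) exchange_big /= /mxtrace mulr_sumr.
  apply: ler_sum => i _; apply: le_trans (ler_wpM2r (P0 i) (gbeta i w w')).
  rewrite /g mulr_suml; apply: ler_sum => x _.
  have h0 : 0 <= (w x)%:R + (w' x)%:R - ((w x)%:R - (w' x)%:R) ^+ 2 :> R.
    by rewrite subr_ge0 sq_bool_diff_le.
  have h' : 0 <= sqnorm (row i (H x)) / p ^+ 2 by nonneg.
  have h'' := mulr_ge0 h0 (mulr_ge0 h' (P0 i)).
  by rewrite -subr_ge0 expr_div_n; from_nonneg h''; ring.
- by move=> d; rewrite muln0 expr0 mxtrace1.
rewrite expr2 -mulrA; apply: ler_wpM2l; first exact: ler0n.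
have p01' : 0 <= p <= 1 by rewrite ltW.
have hm i : expect p (fun w => expect p (fun w' => g i w w' ^+ s)) <= (2 * expR 2 * v) ^+ s.
  apply: expect_moment_le => //; first by move=> x; nonneg.
  apply: le_trans (hsum i); rewrite -mulr_suml le_eqVlt; apply/orP; left; apply/eqP.
  by field; exact: lt0r_neq0.
apply: le_trans (_ : (2 * s)%:R ^+ s * \sum_i
    expect p (fun w => expect p (fun w' => g i w w' ^+ s)) <= _).
  rewrite -expect_sum -expectZ; apply: expect_le => // w.
  rewrite -expect_sum -expectZ; apply: expect_le => // w'.
  rewrite exprMn; apply: ler_wpM2l; [by nonneg | by case: (betaP w w')].
apply: le_trans (ler_wpM2l _ (ler_sum _ (fun i _ => hm i))) _; first by nonneg.
rewrite sumr_const card_ord -[_ *+ n]mulr_natl mulrCA -exprMn.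
rewrite le_eqVlt; apply/orP; left; apply/eqP; congr (_ * _ ^+ _).
by rewrite natrM; ring.
Qed.

Lemma matrix_tail (p v : R) s : (0 < s)%N -> 0 < p <= 1 -> 0 < v ->
  (forall i, (\sum_x sqnorm (row i (H x))) / p <= v) ->
  (forall i x, s%:R * (sqnorm (row i (H x)) / p ^+ 2) <= v) ->
  prob p (fun w : {ffun I -> bool} =>
    ~ opnorm_le (\sum_x ((w x)%:R / p - 1) *: H x) (Num.sqrt (4 * expR 3 * s%:R * v)))
  <= n%:R ^+ 2 * expR (- s%:R).
Proof.
move=> s0 p01 v0 hsum hmax; have /andP[p0 p1] := p01.
have p01' : 0 <= p <= 1 by rewrite ltW.
have h := matrix_moment s0 p01 v0 hsum hmax.
set t := 4 * expR 3 * s%:R * v.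
have tp : 0 < t by rewrite !mulr_gt0 ?expR_gt0 ?ltr0n.
have ht : (4 * expR 2 * s%:R * v) ^+ s = t ^+ s * expR (- s%:R).
  have -> : expR (- s%:R) = expR (-1) ^+ s :> R by rewrite -expRM_natl mulrN1.
  have -> : expR 2 = expR 3 * expR (-1) :> R by rewrite -expRD; congr expR; ring.
  by rewrite -exprMn /t; congr (_ ^+ _); ring.
rewrite ht mulrCA in h.
have S_sym (w : {ffun I -> bool}) :
    (\sum_x ((w x)%:R / p - 1) *: H x)^T = \sum_x ((w x)%:R / p - 1) *: H x.
  exact: lincomb_sym.
case: (prob_markov p01' _ _ h) => [|w|/eqP|]; [by nonneg| |by rewrite expf_eq0 s0 (gt_eqF tp)|].
  by apply: sumr_ge0 => i _; apply: expmx_even_diag_ge0.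
apply: le_trans; apply: prob_le => // w; apply: contra_notP => /negP; rewrite -leNgt.
by apply: opnorm_le_trace => //; exact: ltW.
Qed.

End MatrixTail.

(** * Top eigenprojections, Davis-Kahan and Weyl inequalities *)

Section SpectralPerturbation.
Variable R : realType.

Definition eigenbasis n (Z V : 'M[R]_n) (lam : 'rV[R]_n) : Prop :=
  [/\ V^T *m V = 1%:M, V^T *m Z *m V = diag_mx lam
    & forall i j : 'I_n, (i <= j)%N -> lam 0 j <= lam 0 i].

Definition topmask n r : 'M[R]_n := diag_mx (\row_(j < n) (j < r)%N%:R).

(** A square mask instead of a column submatrix keeps [r <= n] out of the types. *)
Definition topproj n r (V : 'M[R]_n) : 'M[R]_n := V *m topmask n r *m V^T.

Lemma topmaskT n r : (topmask n r)^T = topmask n r.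
Proof. by rewrite tr_diag_mx. Qed.

Lemma topmask_idem n r : topmask n r *m topmask n r = topmask n r.
Proof.
rewrite mulmx_diag; congr diag_mx; apply/rowP => j; rewrite !mxE.
by case: (j < r)%N; rewrite ?mulr1 ?mulr0.
Qed.

Lemma topprojT n r (V : 'M[R]_n) : (topproj r V)^T = topproj r V.
Proof. by rewrite /topproj !trmx_mul trmxK topmaskT mulmxA. Qed.

Lemma topproj_idem n r (V : 'M[R]_n) : V^T *m V = 1%:M ->
  topproj r V *m topproj r V = topproj r V.
Proof.
move=> VV; rewrite /topproj !mulmxA -(mulmxA _ V^T V) VV mulmx1.
by rewrite -(mulmxA V) topmask_idem.
Qed.

Lemma trace_topproj n r (V : 'M[R]_n) : (r <= n)%N -> V^T *m V = 1%:M ->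
  \tr (topproj r V) = r%:R.
Proof.
move=> rn VV; rewrite /topproj -mulmxA mxtrace_mulC -mulmxA VV mulmx1 /mxtrace.
rewrite (eq_bigr (fun i : 'I_n => (i < r)%N%:R)) => [|i _]; last by rewrite !mxE eqxx.
rewrite -natr_sum -(big_mkcond (fun i : 'I_n => (i < r)%N) (fun=> 1%N)) /=.
by rewrite -(big_ord_widen n (fun=> 1%N) rn) sum1_card card_ord.
Qed.

Lemma top_eigvecs_topproj n r (Z : 'M[R]_n) (U : 'M[R]_(n, r)) : (r <= n)%N ->
  top_eigvecs Z U -> exists V lam, eigenbasis Z V lam /\ U *m U^T = topproj r V.
Proof.
move=> rn [V [lam [VV VZ srt UV]]]; exists V, lam; split; first by split.
apply/matrixP => i j; rewrite /topproj mul_mx_diag !mxE.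
rewrite (eq_bigr (fun c : 'I_n => if (c < r)%N then V i c * V j c else 0)); last first.
  by move=> c _; rewrite !mxE; case: ifP; rewrite ?mulr1 ?mulr0 ?mul0r.
rewrite -big_mkcond /= (big_ord_narrow rn) /=.
by apply: eq_bigr => c _; rewrite !mxE !(UV _ c (widen_ord rn c)).
Qed.

Lemma topproj_nonexp n m r (V : 'M[R]_n) (M : 'M[R]_(m, n)) : V^T *m V = 1%:M ->
  sqnorm (M *m topproj r V) <= sqnorm M.
Proof.
move=> VV; have PT := topprojT r V; have PP := topproj_idem r VV.
move: (topproj r V) PT PP => P PT PP; have := sqnorm_ge0 (M - M *m P); rewrite sqnormB.
suff -> : fdot M (M *m P) = sqnorm (M *m P) by lra.
by rewrite sqnorm_trace fdot_trace !trmx_mul PT !mulmxA -(mulmxA M P P) PP.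
Qed.

(** Both projections have trace [r], so either side equals 2r minus twice the trace of their
    product. A one-sided Davis-Kahan bound thus controls the difference. *)
Lemma sqnorm_diff_topproj n r (V W : 'M[R]_n) : (r <= n)%N ->
  V^T *m V = 1%:M -> W^T *m W = 1%:M ->
  sqnorm (topproj r V - topproj r W) =
  2 * sqnorm ((1%:M - topproj r W) *m topproj r V).
Proof.
move=> rn VV WW; rewrite mulmxBl mul1mx !sqnormB.
have nE (M : 'M[R]_n) : M^T *m M = 1%:M -> sqnorm (topproj r M) = r%:R.
  by move=> MM; rewrite sqnorm_trace topprojT topproj_idem // trace_topproj.
rewrite !nE //.
have := topprojT r V; have := topproj_idem r VV.
have := topprojT r W; have := topproj_idem r WW.
move: (topproj r V) (topproj r W) => P Q QQ QT PP PT.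
rewrite fdot_trace QT sqnorm_trace fdot_trace trmx_mul PT QT.
have -> : \tr (P *m (P *m Q)) = \tr (P *m Q) by rewrite mulmxA PP.
have -> : \tr (Q *m P *m (P *m Q)) = \tr (P *m Q).
  by rewrite mxtrace_mulC mulmxA -(mulmxA P) QQ mxtrace_mulC mulmxA PP.
by ring.
Qed.

(* Davis-Kahan in Frobenius norm: in the bases [V], [mu] the entry [(j, c)] of
   [V^T (Z1 - Z2) X] is [(mu_c - lam_j) (V^T X)_jc]. *)
Lemma davis_kahan n m r (Z1 Z2 V : 'M[R]_n) (lam : 'rV[R]_n) (X : 'M[R]_(n, m))
    (mu : 'rV[R]_m) (al be : R) :
  V^T *m V = 1%:M -> V^T *m Z2 *m V = diag_mx lam ->
  Z1 *m X = X *m diag_mx mu -> be <= al ->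
  (forall c, (forall i, X i c = 0) \/ al <= mu 0 c) ->
  (forall j : 'I_n, (r <= j)%N -> lam 0 j <= be) ->
  (al - be) ^+ 2 * sqnorm ((1%:M - topproj r V) *m X) <= sqnorm ((Z1 - Z2) *m X).
Proof.
move=> VV VZ ZX ab hmu hlam; have VV' := mulmx1C VV.
have VVt : (V^T)^T *m V^T = 1%:M by rewrite trmxK.
rewrite -(sqnorm_isom _ VVt) -[leRHS](sqnorm_isom _ VVt).
have -> : V^T *m ((1%:M - topproj r V) *m X) = (1%:M - topmask n r) *m (V^T *m X).
  rewrite !mulmxBl !mul1mx mulmxBr /topproj !mulmxA VV mul1mx.
  by [].
have VZ2 : V^T *m Z2 = diag_mx lam *m V^T by rewrite -VZ -mulmxA VV' mulmx1.
have -> : V^T *m ((Z1 - Z2) *m X) = V^T *m X *m diag_mx mu - diag_mx lam *m (V^T *m X).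
  by rewrite mulmxBl mulmxBr ZX !mulmxA VZ2.
have XY j c : (forall i, X i c = 0) -> (V^T *m X) j c = 0.
  by move=> h; rewrite mxE big1 // => i _; rewrite h mulr0.
move: (V^T *m X) XY => Y XY; rewrite !sqnormE mulr_sumr; apply: ler_sum => j _.
rewrite mulr_sumr; apply: ler_sum => c _.
rewrite mulmxBl mul1mx mul_mx_diag !mul_diag_mx !mxE.
case: (hmu c) => [/XY ->|hc]; first by rewrite !(mul0r, mulr0, subr0) expr0n mulr0.
have [jr|rj] := ltnP j r; first by rewrite mul1r subrr expr0n mulr0 sqr_ge0.
rewrite mul0r subr0 [Y j c * _]mulrC -mulrBl exprMn; apply: ler_wpM2r; first exact: sqr_ge0.
by move: (hlam j rj) => hj; rewrite ler_sqr ?nnegrE; lra.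
Qed.

(** The general bound is applied to [V1 *m topmask n r]; its columns from [r] on vanish, which is
    the alternative that [davis_kahan] allows. *)
Lemma davis_kahan_proj n r (Z1 Z2 V1 V2 : 'M[R]_n) (lam1 lam2 : 'rV[R]_n) (al be : R) :
  eigenbasis Z1 V1 lam1 -> eigenbasis Z2 V2 lam2 -> be <= al ->
  (forall j : 'I_n, (j < r)%N -> al <= lam1 0 j) ->
  (forall j : 'I_n, (r <= j)%N -> lam2 0 j <= be) ->
  (al - be) ^+ 2 * sqnorm ((1%:M - topproj r V2) *m topproj r V1)
  <= sqnorm ((Z1 - Z2) *m topproj r V1).
Proof.
move=> [VV1 VZ1 _] [VV2 VZ2 _] ab h1 h2.
have ZX : Z1 *m (V1 *m topmask n r) = (V1 *m topmask n r) *m diag_mx lam1.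
  have -> : Z1 *m (V1 *m topmask n r) = V1 *m diag_mx lam1 *m topmask n r.
    by rewrite -VZ1 !mulmxA (mulmx1C VV1) mul1mx.
  rewrite -!mulmxA !mulmx_diag; congr (_ *m diag_mx _); apply/rowP => j.
  by rewrite !mxE mulrC.
have VVt : (V1^T)^T *m V1^T = 1%:M by rewrite trmxK (mulmx1C VV1).
have isoR (M : 'M[R]_n) : sqnorm (M *m V1^T) = sqnorm M.
  by rewrite -sqnormT trmx_mul trmxK sqnorm_isom // sqnormT.
have projE (M : 'M[R]_n) : sqnorm (M *m topproj r V1) = sqnorm (M *m (V1 *m topmask n r)).
  by rewrite /topproj mulmxA isoR.
rewrite !projE; apply: davis_kahan VV2 VZ2 ZX ab _ h2 => c.
have [cr|rc] := ltnP c r; first by right; exact: h1.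
by left => i; rewrite mul_mx_diag !mxE ltnNge rc mulr0.
Qed.

Lemma wide_kernel a b (M : 'M[R]_(a, b)) : (b < a)%N ->
  exists2 u : 'rV[R]_a, u != 0 & u *m M = 0.
Proof.
move=> ba; have : kermx M != 0.
  rewrite -mxrank_eq0 mxrank_ker subn_eq0 -ltnNge.
  exact: leq_ltn_trans (rank_leq_col M) ba.
by case/rowV0Pn => u /sub_kermxP uM u0; exists u.
Qed.

Lemma sqnorm_gt0 a b (M : 'M[R]_(a, b)) : M != 0 -> 0 < sqnorm M.
Proof.
by move=> M0; rewrite lt_def sqnorm_ge0 andbT; apply: contra_neq M0; exact: sqnorm_eq0.
Qed.

Lemma quadform_opnorm n (E : 'M[R]_n) t (x : 'rV[R]_n) : 0 <= t -> opnorm_le E t ->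
  `|\tr (x *m E *m x^T)| <= t * sqnorm x.
Proof.
move=> t0 Et.
have h (y : 'rV[R]_n) : fdot y^T (E *m x^T) <= fnorm y * (t * fnorm x).
  apply: le_trans (fdot_le _ _) _; rewrite fnormT; apply: ler_wpM2l; first exact: fnorm_ge0.
  by apply: le_trans (fnorm_opnorm _ t0 Et) _; rewrite fnormT.
have xE : \tr (x *m E *m x^T) = fdot x^T (E *m x^T).
  by rewrite fdotC fdot_trace trmxK [RHS]mxtrace_mulC !mulmxA.
rewrite xE ler_norml lerNl; apply/andP; split.
  have := h (- x); rewrite linearN /= fdotNl fnormN; rewrite -fnorm_sq.
  by rewrite expr2 mulrCA.
by have := h x; rewrite -fnorm_sq expr2 mulrCA.
Qed.

Section Weyl.
Variables (n r : nat) (U : 'M[R]_(n, r)) (d : 'rV[R]_r) (E V : 'M[R]_n) (lam : 'rV[R]_n).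
Variables (sig tau : R).
Hypotheses (UU : U^T *m U = 1%:M) (tau0 : 0 <= tau) (Etau : opnorm_le E tau).
Hypothesis Vbasis : eigenbasis (U *m diag_mx d *m U^T + E) V lam.
Hypothesis dsig : forall c, sig <= d 0 c.

Let Z := U *m diag_mx d *m U^T + E.

Lemma quadform_diag a (u x : 'rV[R]_a) :
  \tr (u *m diag_mx x *m u^T) = \sum_i x 0 i * u 0 i ^+ 2.
Proof.
rewrite /mxtrace big_ord1 mxE; apply: eq_bigr => i _.
by rewrite mul_mx_diag !mxE; ring.
Qed.

Lemma sqnorm_rV a (u : 'rV[R]_a) : sqnorm u = \sum_i u 0 i ^+ 2.
Proof. by rewrite sqnormE big_ord1. Qed.

(** The first [j.+1 > r] eigenvectors span a nonzero vector orthogonal to the columns of [U]; there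
    the quadratic form of [Z] reduces to that of [E]. *)
Lemma weyl_upper (j : 'I_n) : (r <= j)%N -> lam 0 j <= tau.
Proof.
move=> rj; have [VV VZ srt] := Vbasis.
have jn : (j.+1 <= n)%N := ltn_ord j.
pose f := widen_ord jn.
pose W := rowsub f V^T.
have [u u0 uK] : exists2 u : 'rV[R]_(j.+1), u != 0 & u *m (W *m U) = 0.
  exact: wide_kernel.
have WW : W *m W^T = 1%:M.
  apply/matrixP => a b; have := congr1 (fun M : 'M[R]_n => M (f a) (f b)) VV.
  rewrite !mxE => h; rewrite -[RHS]h.
  by apply: eq_bigr => c _; rewrite !mxE.
have WZ : W *m Z *m W^T = diag_mx (\row_a lam 0 (f a)).
  apply/matrixP => a b; have := congr1 (fun M : 'M[R]_n => M (f a) (f b)) VZ.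
  rewrite !mxE => h; rewrite (_ : (a == b) = (f a == f b)) // -[RHS]h.
  apply: eq_bigr => c _; rewrite !mxE; congr (_ * _).
  by apply: eq_bigr => c' _; rewrite !mxE.
pose x := u *m W.
have xx : sqnorm x = sqnorm u.
  by rewrite !sqnorm_trace /x trmx_mul mulmxA -(mulmxA u) WW mulmx1.
have xU : x *m U = 0 by rewrite /x -mulmxA.
have up := sqnorm_gt0 u0.
have q1 : \tr (x *m Z *m x^T) = \tr (x *m E *m x^T).
  by rewrite /Z mulmxDr !mulmxA xU !mul0mx add0r.
have q2 : \tr (x *m Z *m x^T) = \sum_a lam 0 (f a) * u 0 a ^+ 2.
  rewrite /x trmx_mul !mulmxA -(mulmxA u) -(mulmxA u) WZ quadform_diag.
  by apply: eq_bigr => a _; rewrite mxE.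
have q3 : lam 0 j * sqnorm u <= \tr (x *m Z *m x^T).
  rewrite q2 sqnorm_rV mulr_sumr; apply: ler_sum => a _; apply: ler_wpM2r; first exact: sqr_ge0.
  by apply: srt; rewrite /= -ltnS.
have q4 : \tr (x *m Z *m x^T) <= tau * sqnorm u.
  rewrite q1 -xx; exact: le_trans (ler_norm _) (quadform_opnorm _ tau0 Etau).
by rewrite -(ler_pM2r up); exact: le_trans q3 q4.
Qed.

(** The range of [U] has dimension [r > j] and so contains a nonzero vector orthogonal to the first
    [j] eigenvectors. *)
Lemma weyl_lower (j : 'I_n) : (j < r)%N -> sig - tau <= lam 0 j.
Proof.
move=> jr; have [VV VZ srt] := Vbasis.
have jn : (j <= n)%N := ltnW (ltn_ord j).
pose f := widen_ord jn.
have [u u0 uK] : exists2 u : 'rV[R]_r, u != 0 & u *m colsub f (U^T *m V) = 0.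
  exact: wide_kernel.
pose x := u *m U^T.
have xx : sqnorm x = sqnorm u.
  by rewrite !sqnorm_trace /x trmx_mul trmxK mulmxA -(mulmxA u) UU mulmx1.
have up := sqnorm_gt0 u0.
have VVt : V *m V^T = 1%:M := mulmx1C VV.
pose y := x *m V.
have y0 (i : 'I_n) : (i < j)%N -> y 0 i = 0.
  move=> ij; have := congr1 (fun M : 'rV[R]_j => M 0 (Ordinal ij)) uK.
  rewrite [in RHS]mxE => <-; rewrite /y /x -mulmxA !mxE; apply: eq_bigr => c _.
  by congr (_ * _); rewrite [RHS]mxE; congr ((_ *m _) _ _); apply: val_inj.
have yy : sqnorm y = sqnorm u.
  by rewrite -xx !sqnorm_trace /y trmx_mul mulmxA -(mulmxA x) VVt mulmx1.
have q2 : \tr (x *m Z *m x^T) = \sum_i lam 0 i * y 0 i ^+ 2.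
  rewrite -quadform_diag -VZ /y (trmx_mul x V) !mulmxA -(mulmxA x V V^T) VVt mulmx1.
  by rewrite -(mulmxA _ V V^T) VVt mulmx1.
have q3 : \tr (x *m Z *m x^T) <= lam 0 j * sqnorm u.
  rewrite q2 -yy sqnorm_rV mulr_sumr; apply: ler_sum => i _.
  have [ij|ji] := ltnP i j; first by rewrite y0 // expr0n !mulr0.
  by apply: ler_wpM2r; [exact: sqr_ge0|]; exact: srt.
have q4 : (sig - tau) * sqnorm u <= \tr (x *m Z *m x^T).
  have -> : \tr (x *m Z *m x^T) = \sum_c d 0 c * u 0 c ^+ 2 + \tr (x *m E *m x^T).
    rewrite /Z mulmxDr mulmxDl mxtraceD -quadform_diag; congr (\tr _ + _).
    rewrite /x trmx_mul trmxK !mulmxA -(mulmxA u U^T) UU mulmx1.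
    by rewrite -(mulmxA _ U^T U) UU mulmx1.
  have h1 : sig * sqnorm u <= \sum_c d 0 c * u 0 c ^+ 2.
    rewrite sqnorm_rV mulr_sumr; apply: ler_sum => c _; apply: ler_wpM2r; first exact: sqr_ge0.
    exact: dsig.
  have := quadform_opnorm x tau0 Etau; rewrite xx ler_norml => /andP[h2 _].
  by rewrite mulrBl; lra.
by rewrite -(ler_pM2r up); exact: le_trans q4 q3.
Qed.

End Weyl.

(** In the eigenbasis, [Z] multiplies each coordinate retained by the projection by at least [al].
    Taking for [X] a coordinate projection gives the bound row by row. *)
Lemma topproj_lower n m r (Z V : 'M[R]_n) lam al (X : 'M[R]_(m, n)) : 0 <= al ->
  eigenbasis Z V lam -> (forall j : 'I_n, (j < r)%N -> al <= lam 0 j) ->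
  al * fnorm (X *m topproj r V) <= fnorm (X *m (Z *m topproj r V)).
Proof.
move=> al0 [VV VZ _] hlam; have VVt : (V^T)^T *m V^T = 1%:M by rewrite trmxK (mulmx1C VV).
have isoR (M : 'M[R]_(m, n)) : fnorm (M *m V^T) = fnorm M.
  by rewrite -fnormT trmx_mul trmxK /fnorm sqnorm_isom // sqnormT.
have -> : X *m (Z *m topproj r V) = X *m V *m diag_mx lam *m topmask n r *m V^T.
  by rewrite -VZ /topproj !mulmxA -(mulmxA X V V^T) (mulmx1C VV) mulmx1.
rewrite /topproj !mulmxA !isoR; move: (X *m V) => Y.
rewrite -[_ * _]ger0_norm ?mulr_ge0 ?fnorm_ge0 // -[fnorm (_ *m _ *m _)]ger0_norm ?fnorm_ge0 //.
rewrite -ler_sqr ?nnegrE ?normr_ge0 // !real_normK ?num_real // exprMn !fnorm_sq.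
rewrite !sqnormE mulr_sumr; apply: ler_sum => i _; rewrite mulr_sumr; apply: ler_sum => j _.
rewrite !mul_mx_diag !mxE; have [jr|rj] := ltnP j r; last by rewrite !mulr0 expr0n mulr0.
rewrite !mulr1 mulrC exprMn; apply: ler_wpM2l; first exact: sqr_ge0.
by move: (hlam j jr) => hj; rewrite ler_sqr ?nnegrE; lra.
Qed.

End SpectralPerturbation.

(** * Row norms of the top eigenprojection by the leave-one-out argument *)

Section LeaveOneOut.
Variable R : realType.

Definition rowmax a b (M : 'M[R]_(a, b)) : R := \big[Num.max/0]_i fnorm (row i M).

Lemma rowmax_ge0 a b (M : 'M[R]_(a, b)) : 0 <= rowmax M.
Proof. by rewrite /rowmax; elim/big_rec: _ => // i x _ x0; rewrite le_max x0 orbT. Qed.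

Lemma le_rowmax a b (M : 'M[R]_(a, b)) i : fnorm (row i M) <= rowmax M.
Proof. by rewrite /rowmax (bigD1 i) //= le_max lexx. Qed.

Lemma rowmax_le a b (M : 'M[R]_(a, b)) t : 0 <= t ->
  (forall i, fnorm (row i M) <= t) -> rowmax M <= t.
Proof.
by move=> t0 h; rewrite /rowmax; elim/big_rec: _ => // i x _ xt; rewrite ge_max h.
Qed.

Definition coord_compl n (i : 'I_n) : 'M[R]_n := 1%:M - delta_mx i i.

Lemma delta_mul n b (i : 'I_n) (M : 'M[R]_(n, b)) :
  delta_mx i i *m M = \matrix_(j, c) (if j == i then M i c else 0).
Proof.
apply/matrixP => j c; rewrite !mxE (bigD1 i) //= big1 => [|k ki]; last first.
  by rewrite mxE (negPf ki) andbF mul0r.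
by rewrite mxE eqxx andbT addr0; case: eqP; rewrite ?mul1r ?mul0r.
Qed.

Lemma sqnorm_delta_mul n b (i : 'I_n) (M : 'M[R]_(n, b)) :
  sqnorm (delta_mx i i *m M) = sqnorm (row i M).
Proof.
rewrite delta_mul sqnorm_rows (bigD1 i) //= big1 ?addr0 => [|j ji].
  by congr sqnorm; apply/rowP => c; rewrite !mxE eqxx.
rewrite (_ : row j _ = 0) ?sqnorm0 //.
by apply/rowP => c; rewrite !mxE (negPf ji).
Qed.

Lemma fnorm_delta_mul n b (i : 'I_n) (M : 'M[R]_(n, b)) :
  fnorm (delta_mx i i *m M) = fnorm (row i M).
Proof. by rewrite /fnorm sqnorm_delta_mul. Qed.

Lemma sqnorm_coord_compl n b (i : 'I_n) (M : 'M[R]_(n, b)) :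
  sqnorm (coord_compl i *m M) <= sqnorm M.
Proof.
rewrite /coord_compl mulmxBl mul1mx delta_mul !sqnormE.
apply: ler_sum => j _; apply: ler_sum => c _; rewrite !mxE.
by case: eqP => [->|_]; rewrite ?subr0 // subrr expr0n sqr_ge0.
Qed.

Lemma coord_complT n (i : 'I_n) : (coord_compl i)^T = coord_compl i.
Proof. by rewrite /coord_compl linearB /= trmx1 trmx_delta. Qed.

Lemma opnorm_le_compress n (i : 'I_n) (E : 'M[R]_n) t : opnorm_le E t ->
  opnorm_le (coord_compl i *m E *m coord_compl i) t.
Proof.
move=> Et x; rewrite -!mulmxA; apply: le_trans (sqnorm_coord_compl _ _) _.
apply: le_trans (Et _) _; apply: ler_wpM2l; first exact: sqr_ge0.
exact: sqnorm_coord_compl.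
Qed.

(** The hypotheses bound row [i] of the noise only by the unknown row norms of [Qs i]. The argument
    closes because these are at most 6/5 of the largest row norm [M] of [Q], so that [M] reappears
    on the right with a coefficient below that on the left. *)
Lemma leave_one_out n r (U : 'M[R]_(n, r)) (d : 'rV[R]_r) (E V : 'M[R]_n) lam
    (sig tau g : R) (Qs : 'I_n -> 'M[R]_n) (G := U *m diag_mx d *m U^T) :
  (r <= n)%N -> U^T *m U = 1%:M -> 0 < sig -> 0 <= tau <= sig / 20 ->
  opnorm_le E tau -> (forall c, sig <= d 0 c) -> eigenbasis (G + E) V lam ->
  (forall i, exists W l,
     eigenbasis (G + coord_compl i *m E *m coord_compl i) W l /\ Qs i = topproj r W) ->
  (forall i, fnorm (row i (E *m Qs i)) <= sig / 20 * rowmax (Qs i)) ->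
  0 <= g -> (forall i, fnorm (row i G) <= g) ->
  forall i, fnorm (row i (topproj r V)) <= 2 * g / sig.
Proof.
move=> rn UU sig0 /andP[tau0 tausig] Etau dsig VZ hQs hEQ g0 hG.
have [VV VZV _] := VZ.
set Q := topproj r V; set M := rowmax Q.
have M0 : 0 <= M := rowmax_ge0 Q.
have lamr := weyl_lower UU tau0 Etau VZ dsig.
have lamu := weyl_upper tau0 Etau VZ.
have step i : fnorm (row i (E *m Q)) <= 7 / 100 * sig * M.
  have [W [l [WZ QE]]] := hQs i; have [WW _ _] := WZ.
  set Mi := rowmax (Qs i); have Mi0 : 0 <= Mi := rowmax_ge0 _.
  have Eitau := opnorm_le_compress i Etau.
  have lr := weyl_lower UU tau0 Eitau WZ dsig.
  have bea : tau <= sig - tau by lra.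
  have := davis_kahan_proj WZ VZ bea lr lamu.
  (* The removed part splits into all of row [i] and the rest of column [i]. The latter sees only
     row [i] of [Qs i], so both pieces are bounded by [Mi]. *)
  have -> : G + coord_compl i *m E *m coord_compl i - (G + E) =
      - (delta_mx i i *m E + coord_compl i *m E *m delta_mx i i).
    rewrite {2}/coord_compl mulmxBr mulmx1 /coord_compl !mulmxBl !mul1mx.
    move: (delta_mx i i *m E) (E *m delta_mx i i) => A B.
    move: (_ *m delta_mx i i) => C; by apply/matrixP => a b; rewrite !mxE; ring.
  rewrite mulNmx sqnormN -QE -/Q => dk.
  set D := fnorm (Qs i - Q).
  have D0 : 0 <= D := fnorm_ge0 _.
  have DE : D ^+ 2 = 2 * sqnorm ((1%:M - Q) *m Qs i).
    by rewrite /D fnorm_sq QE /Q sqnorm_diff_topproj.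
  have rhs : fnorm ((delta_mx i i *m E + coord_compl i *m E *m delta_mx i i) *m Qs i)
      <= sig / 10 * Mi.
    rewrite mulmxDl; apply: le_trans (fnormD _ _) _.
    have h1 : fnorm (delta_mx i i *m E *m Qs i) <= sig / 20 * Mi.
      by rewrite -mulmxA fnorm_delta_mul; exact: hEQ.
    have h2 : fnorm (coord_compl i *m E *m delta_mx i i *m Qs i) <= tau * Mi.
      rewrite -!mulmxA.
      have h3 : fnorm (coord_compl i *m (E *m (delta_mx i i *m Qs i))) <=
                fnorm (E *m (delta_mx i i *m Qs i)).
        by rewrite fnorm_le ?fnorm_ge0 // fnorm_sq sqnorm_coord_compl.
      apply: le_trans h3 _; apply: le_trans (fnorm_opnorm _ tau0 Etau) _.
      by rewrite fnorm_delta_mul; apply: ler_wpM2l => //; exact: le_rowmax.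
    have h4 : tau * Mi <= sig / 20 * Mi by exact: ler_wpM2r.
    by lra.
  have {}dk : (sig - tau - tau) ^+ 2 * (D ^+ 2 / 2) <= (sig / 10 * Mi) ^+ 2.
    have -> : D ^+ 2 / 2 = sqnorm ((1%:M - Q) *m Qs i) by rewrite DE; field.
    apply: le_trans dk _; rewrite -fnorm_sq ler_sqr ?nnegrE ?fnorm_ge0 //.
    by apply: mulr_ge0 => //; lra.
  (* The eigengap is at least 9/10 of [sig] and the perturbation at most [sig / 10 * Mi], so [D] is
     at most sqrt(2)/9 times [Mi], and sqrt(2)/9 < 1/6. *)
  have DM : D <= Mi / 6.
    have h1 : (9 / 10 * sig) ^+ 2 <= (sig - tau - tau) ^+ 2 by rewrite ler_sqr ?nnegrE; lra.
    have h2 : (9 / 10 * sig) ^+ 2 * (D ^+ 2 / 2) <= (sig / 10 * Mi) ^+ 2.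
      by apply: le_trans dk; apply: ler_wpM2r h1; nonneg.
    have h3 : sig ^+ 2 * (81 / 2 * D ^+ 2) <= sig ^+ 2 * Mi ^+ 2.
      by move: h2; rewrite !exprMn; lra.
    have h4 : 81 / 2 * D ^+ 2 <= Mi ^+ 2 by rewrite -(ler_pM2l (exprn_gt0 2 sig0)).
    rewrite -ler_sqr ?nnegrE ?divr_ge0 // exprMn.
    by have := sqr_ge0 Mi; have := sqr_ge0 D; lra.
  have MiM : Mi <= M + D.
    apply: rowmax_le => [|j]; first exact: addr_ge0.
    have -> : row j (Qs i) = row j Q + row j (Qs i - Q) by rewrite -raddfD /= addrC subrK.
    apply: le_trans (fnormD _ _) _; apply: lerD; first exact: le_rowmax.
    by rewrite /D fnorm_le ?fnorm_ge0 // fnorm_sq sqnorm_row_le.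
  have -> : row i (E *m Q) = row i (E *m Qs i) - row i (E *m (Qs i - Q)).
    by rewrite -raddfB /= -mulmxBr subKr.
  apply: le_trans (fnormB _ _) _.
  have h1 := hEQ i; rewrite -/Mi in h1.
  have h2 : fnorm (row i (E *m (Qs i - Q))) <= tau * D.
    apply: le_trans (fnorm_opnorm _ tau0 Etau).
    by rewrite fnorm_le ?fnorm_ge0 // fnorm_sq sqnorm_row_le.
  have h3 : tau * D <= sig / 20 * D by exact: ler_wpM2r.
  (* [D <= Mi / 6] and [Mi <= M + D] give [Mi <= 6 / 5 * M] and [D <= M / 5]. *)
  have h4 : sig / 20 * (Mi + D) <= sig / 20 * (7 / 5 * M) by apply: ler_wpM2l; lra.
  by lra.
have al0 : 0 <= sig - tau by lra.
have rows i : (sig - tau) * fnorm (row i Q) <= g + 7 / 100 * sig * M.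
  have := topproj_lower (delta_mx i i) al0 VZ lamr.
  rewrite !fnorm_delta_mul -/Q => h; apply: le_trans h _.
  have -> : row i ((G + E) *m Q) = row i G *m Q + row i (E *m Q).
    by rewrite mulmxDl raddfD /= row_mul.
  apply: le_trans (fnormD _ _) _; apply: lerD; last exact: step.
  apply: le_trans (hG i).
  by rewrite fnorm_le ?fnorm_ge0 // fnorm_sq; exact: topproj_nonexp.
have sM : 0 <= sig * M by apply: mulr_ge0 => //; exact: ltW.
(* Absorbing the last term leaves 88/100 of [sig * M] on the left, more than the half needed for the
   factor 2. *)
have : (19 / 20 * sig) * M <= g + 7 / 100 * sig * M.
  have alp : 0 < 19 / 20 * sig by lra.
  rewrite mulrC -ler_pdivlMr //; apply: rowmax_le => [|j].
    by apply: divr_ge0; lra.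
  rewrite ler_pdivlMr // mulrC; apply: le_trans (rows j); apply: ler_wpM2r; [exact: fnorm_ge0|lra].
move=> hM i; apply: le_trans (le_rowmax _ i) _; rewrite -/M ler_pdivlMr // mulrC.
by lra.
Qed.

Definition is_spectral_proj n r (Z Q : 'M[R]_n) : Prop :=
  exists V lam, eigenbasis Z V lam /\ Q = topproj r V.

(** A choice that depends on [Z] alone: equal matrices receive equal projections, so the projection
    stays frozen when resampling leaves the matrix unchanged. For symmetric [Z] the default 0 is not
    reached. *)
Definition spectral_proj n r (Z : 'M[R]_n) : 'M[R]_n :=
  xget 0 [set Q | is_spectral_proj r Z Q]%classic.

Lemma spectral_projP n r (Z : 'M[R]_n) : Z^T = Z -> is_spectral_proj r Z (spectral_proj r Z).
Proof.
move=> /symmetric_spectral[V [l [VV VZ srt]]].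
have h : [set Q | is_spectral_proj r Z Q]%classic (topproj r V) by exists V, l; split.
exact: (xgetPex 0 (ex_intro _ _ h)).
Qed.

End LeaveOneOut.

(** * Kronecker products acting on vectorised tensors *)

Section TensorAlgebra.
Variables (R : realType) (k n : nat).
Local Notation N := #|{: mindex k n}|.
Implicit Types (P Q : 'I_k -> 'M[R]_n) (X : mindex k n -> R).

Definition tvec X : 'cV[R]_N := \col_c X (enum_val c).

Definition ev (c : 'I_N) : mindex k n := enum_val c.

(** The factor may vary with the mode, so that actions in a single mode and partial products are
    instances. *)
Definition kron Q : 'M[R]_N := \matrix_(c, c') \prod_l Q l (ev c l) (ev c' l).

Definition slot (j : 'I_k) (A : 'M[R]_n) : 'M[R]_N :=
  kron (fun l => if l == j then A else 1%:M).

Lemma frob_tvec X : frob X = fnorm (tvec X).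
Proof.
rewrite /frob /fnorm sqnormE; congr Num.sqrt.
rewrite (reindex _ (onW_bij _ (enum_val_bij _))) /=.
by apply: eq_bigr => c _; rewrite big_ord1 mxE.
Qed.

Lemma kron_mul P Q : kron P *m kron Q = kron (fun l => P l *m Q l).
Proof.
apply/matrixP => a b; rewrite !mxE.
rewrite (eq_bigr (fun l => \sum_i P l (ev a l) i * Q l i (ev b l))); last first.
  by move=> l _; rewrite mxE.
rewrite (bigA_distr_bigA (fun l i => P l (ev a l) i * Q l i (ev b l))).
rewrite (reindex _ (onW_bij _ (enum_val_bij {: mindex k n}))) /=.
by apply: eq_bigr => c _; rewrite !mxE -big_split.
Qed.

Lemma kronT Q : (kron Q)^T = kron (fun l => (Q l)^T).
Proof. by apply/matrixP => a b; rewrite !mxE; apply: eq_bigr => l _; rewrite mxE. Qed.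

Lemma eq_kron P Q : P =1 Q -> kron P = kron Q.
Proof. by move=> PQ; congr kron; apply/funext. Qed.

Lemma kron1 : kron (fun=> 1%:M) = 1%:M.
Proof.
apply/matrixP => a b; rewrite !mxE; case: eqP => [->|ab].
  by rewrite big1 // => l _; rewrite mxE eqxx.
have [l hl] : exists l, ev a l != ev b l.
  apply/existsP; rewrite -negb_forall; apply: contra_notN ab => /forallP h.
  by apply: enum_val_inj; apply/ffunP => l; exact/eqP.
by rewrite (bigD1 l) //= mxE (negPf hl) mul0r.
Qed.

Lemma sqnorm_kron_col Q c :
  sqnorm (col c (kron Q)) = \prod_l sqnorm (col (ev c l) (Q l)).
Proof.
have colE m p (M : 'M[R]_(m, p)) j : sqnorm (col j M) = (M^T *m M) j j.
  by rewrite sqnormE mxE; apply: eq_bigr => i _; rewrite big_ord1 !mxE expr2.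
rewrite colE kronT kron_mul mxE; apply: eq_bigr => l _; by rewrite colE.
Qed.

Lemma kron_nonexp Q b (M : 'M[R]_(N, b)) :
  (forall l, (Q l)^T = Q l) -> (forall l, Q l *m Q l = Q l) ->
  fnorm (kron Q *m M) <= fnorm M.
Proof.
move=> QT QQ.
have KT : (kron Q)^T = kron Q by rewrite kronT; apply: eq_kron.
have KK : kron Q *m kron Q = kron Q by rewrite kron_mul; apply: eq_kron.
rewrite fnorm_le ?fnorm_ge0 // fnorm_sq.
have := sqnorm_ge0 (M - kron Q *m M); rewrite sqnormB.
suff -> : fdot M (kron Q *m M) = sqnorm (kron Q *m M) by lra.
rewrite fdotC fdot_trace sqnorm_trace trmx_mul KT mulmxA [RHS]mxtrace_mulC.
by rewrite !mulmxA KK.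
Qed.

Lemma slotE j (A : 'M[R]_n) a b :
  slot j A a b = A (ev a j) (ev b j) * \prod_(l | l != j) (1%:M : 'M[R]_n) (ev a l) (ev b l).
Proof.
rewrite mxE (bigD1 j) //= eqxx; congr (_ * _).
by apply: eq_bigr => l /negPf->.
Qed.

Lemma slotB j (A B : 'M[R]_n) : slot j (A - B) = slot j A - slot j B.
Proof.
have subE p (M M' : 'M[R]_p) a b : (M - M') a b = M a b - M' a b by rewrite !mxE.
by apply/matrixP => a b; rewrite subE !slotE subE mulrBl.
Qed.

Lemma slot1 j : slot j 1%:M = 1%:M.
Proof. by rewrite -kron1; apply: eq_kron => l; case: ifP. Qed.

(* [1 - Q (x) ... (x) Q] telescopes over the modes. *)
Lemma kron_bias (Q : 'M[R]_n) X t : Q^T = Q -> Q *m Q = Q ->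
  (forall j, fnorm (slot j (1%:M - Q) *m tvec X) <= t) ->
  fnorm (tvec X - kron (fun=> Q) *m tvec X) <= k%:R * t.
Proof.
move=> QT QQ ht.
pose K m := kron (fun l : 'I_k => if (l < m)%N then Q else 1%:M).
suff h m : (m <= k)%N -> fnorm (tvec X - K m *m tvec X) <= m%:R * t.
  rewrite (_ : kron _ = K k); first exact: h.
  by apply: eq_kron => l; rewrite ltn_ord.
elim: m => [_|m IH mk].
  rewrite (_ : K 0%N = 1%:M) ?mul1mx ?subrr ?mul0r; last by rewrite -kron1; exact: eq_kron.
  by rewrite fnorm_le // sqnorm0 expr0n.
pose j : 'I_k := Ordinal mk.
have KS : K m.+1 = K m *m slot j Q.
  rewrite kron_mul; apply: eq_kron => l; rewrite -val_eqE /= ltnS leq_eqVlt.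
  by case: ltngtP => //=; rewrite ?mulmx1 ?mul1mx.
have -> : tvec X - K m.+1 *m tvec X =
   (tvec X - K m *m tvec X) + K m *m (slot j (1%:M - Q) *m tvec X).
  rewrite KS slotB slot1 mulmxBl mul1mx mulmxBr !mulmxA.
  by move: (K m *m slot j Q *m tvec X) (K m *m tvec X) (tvec X) => a b c; rewrite addrA subrK.
apply: le_trans (fnormD _ _) _; rewrite -natr1 mulrDl mul1r; apply: lerD.
  exact: IH (ltnW mk).
apply: le_trans (ht j); apply: kron_nonexp => l; case: ifP => _ //.
  by rewrite trmx1.
by rewrite mulmx1.
Qed.

End TensorAlgebra.

(** * Unfoldings and the estimator as a Kronecker action *)

Section Unfolding.
Variable R : realType.

Lemma insert_at_bij k n (j : 'I_k.+1) :
  bijective (fun ic : 'I_n * 'I_(ncol k.+1 n) => insert_at j ic.1 (enum_val ic.2)).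
Proof.
exists (fun f : mindex k.+1 n => (f j, enum_rank (drop_at j f))) => [[i c]|f].
  congr pair; first by rewrite ffunE unlift_none.
  rewrite -[RHS]enum_valK; congr enum_rank; apply/ffunP => l.
  by rewrite !ffunE liftK.
apply/ffunP => l; rewrite enum_rankK !ffunE /=.
by case: unliftP => [l' ->|->] //; rewrite ffunE.
Qed.

Lemma sum_insert_at k n (j : 'I_k.+1) (F : mindex k.+1 n -> R) :
  \sum_f F f = \sum_i \sum_(c < ncol k.+1 n) F (insert_at j i (enum_val c)).
Proof. by rewrite (reindex _ (onW_bij _ (insert_at_bij n j))) pair_bigA. Qed.

(** [lift_perm j j' 1] sends [j] to [j'] and preserves the order of the other modes, the order in
    which [insert_at] fills them. The column space of the mode-1 unfolding therefore serves every
    mode. *)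
Lemma unfold_symmetric k n (T : mindex k.+1 n -> R) (j j' : 'I_k.+1) :
  symmetric_tensor T -> unfold j T = unfold j' T.
Proof.
move=> Tsym; apply/matrixP => i c; rewrite !mxE.
rewrite -[RHS](Tsym (lift_perm j j' 1)); congr T; apply/ffunP => l; rewrite !ffunE.
case: (unliftP j l) => [l' ->|->].
  by rewrite lift_perm_lift perm1 liftK.
by rewrite lift_perm_id unlift_none.
Qed.

(** Acting in mode [j] is left multiplication of the mode-[j] unfolding, up to reindexing of
    entries. *)
Lemma sqnorm_slot k n (T : mindex k.+1 n -> R) j (A : 'M[R]_n) :
  sqnorm (slot j A *m tvec T) = sqnorm (A *m unfold j T).
Proof.
rewrite !sqnormE.
have -> : \sum_c \sum_(o < 1) (slot j A *m tvec T) c o ^+ 2 =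
    \sum_f (slot j A *m tvec T) (enum_rank f) 0 ^+ 2.
  rewrite [RHS](reindex _ (onW_bij _ (enum_val_bij _))) /=.
  by apply: eq_bigr => c _; rewrite big_ord1 enum_valK.
rewrite (sum_insert_at j); apply: eq_bigr => i _; apply: eq_bigr => c _; congr (_ ^+ 2).
rewrite !mxE.
rewrite (reindex (enum_rank : mindex k.+1 n -> _)) /=; last exact: onW_bij (enum_rank_bij _).
rewrite (sum_insert_at j); apply: eq_bigr => i' _; rewrite (bigD1 c) //= big1 => [|c' c'c].
  rewrite addr0 slotE /ev !enum_rankK [tvec _ _ _]mxE enum_rankK [unfold _ _ _ _]mxE.
  rewrite big1 ?mulr1 => [|l lj]; first by rewrite !ffunE !unlift_none.
  rewrite mxE !ffunE.
  by case: unliftP lj => [l' _|->]; rewrite ?eqxx.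
rewrite slotE /ev !enum_rankK; have [l hl] : exists l, enum_val c l != enum_val c' l.
  apply/existsP; rewrite -negb_forall; apply: contra c'c => /forallP h.
  by apply/eqP; apply: enum_val_inj; apply/ffunP => l; apply/esym/eqP.
rewrite (bigD1 (lift j l)) //= 1?eq_sym ?neq_lift // mxE !ffunE liftK.
by rewrite (negPf hl) !(mul0r, mulr0).
Qed.

Lemma sqnorm_unfold k n (T : mindex k.+1 n -> R) j : sqnorm (unfold j T) = frob T ^+ 2.
Proof.
rewrite frob_tvec fnorm_sq -[unfold j T]mul1mx -sqnorm_slot slot1.
by rewrite mul1mx.
Qed.

(** Right multiplication by the Kronecker power contracts the row indices of its factors; symmetry
    of the projection turns it into the left action used in the first mode. *)
Lemma estimator_tvec k n r (hk : (1 < k)%N) (T : mindex k n -> R) q (U : 'M[R]_(n, r))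
    (e : esample k n) :
  tvec (estimator hk T q U e) =
  kron (fun=> U *m U^T) *m tvec (fun f => q^-1 * (if e f then T f else 0)).
Proof.
case: k hk T e => // k hk T e.
have QT : (U *m U^T)^T = U *m U^T by rewrite trmx_mul trmxK.
apply/matrixP => c o; rewrite !mxE /estimator /fold; move: (U *m U^T) QT => Q QT.
set f := enum_val c; set j := mode1 hk.
rewrite [RHS](reindex (enum_rank : mindex k.+1 n -> _)) /=; last exact: onW_bij (enum_rank_bij _).
rewrite (sum_insert_at j) exchange_big /= !mxE; apply: eq_bigr => c' _.
rewrite !mxE mulr_suml; apply: eq_bigr => i _; rewrite !mxE /ev !enum_rankK -/f.
rewrite (bigD1_ord j) //= !ffunE !unlift_none -[LHS]mulrA -[RHS]mulrA; congr (_ * _).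
rewrite [RHS]mulrC.
congr (_ * _); apply: eq_bigr => l _; rewrite !ffunE liftK.
by rewrite -{1}QT mxE.
Qed.

(** Exhibits the error as a sum of independent centred vectors, the form required by
    [vector_tail]. *)
Lemma noise_tvec k n (T : mindex k n -> R) q (e : esample k n) (K : 'M[R]_(#|{: mindex k n}|)) :
  K *m tvec T - K *m tvec (fun f => q^-1 * (if e f then T f else 0)) =
  - \sum_f ((e f)%:R / q - 1) *: (T f *: col (enum_rank f) K).
Proof.
rewrite -mulmxBr -sumrN; apply/matrixP => c o.
rewrite mxE summxE (reindex (enum_rank : mindex k n -> _)) /=; last first.
  exact: onW_bij (enum_rank_bij _).
apply: eq_bigr => f _; rewrite !mxE enum_rankK.
by case: (e f) => /=; ring.
Qed.

End Unfolding.

(** * The wedge matrix as a sum over independent wedges *)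

Section Wedges.
Variables (R : realType) (n m : nat) (A : 'M[R]_(n, m)).
Local Notation triple := ('I_n * 'I_m * 'I_n)%type.

Definition omin (a b : 'I_n) : 'I_n := if (a <= b)%N then a else b.
Definition omax (a b : 'I_n) : 'I_n := if (a <= b)%N then b else a.

(** The symmetric contribution of one wedge, without its random weight. A triple whose first index
    exceeds its last gives 0, so sums may run over all triples although only ordered ones matter. *)
Definition wedge_mx (x : triple) : 'M[R]_n :=
  \matrix_(a, b) (if (x.1.1 == omin a b) && (x.2 == omax a b)
                  then A a x.1.2 * A b x.1.2 else 0).

Lemma ominC a b : omin a b = omin b a.
Proof. by apply: val_inj; rewrite /omin; case: (leqP a b); case: (leqP b a) => //=; lia. Qed.

Lemma omaxC a b : omax a b = omax b a.
Proof. by apply: val_inj; rewrite /omax; case: (leqP a b); case: (leqP b a) => //=; lia. Qed.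

Lemma omin_omax_inj a b e : omin a e = omin b e -> omax a e = omax b e -> a = b.
Proof.
move=> /(congr1 val) /= + /(congr1 val) /=; rewrite /omin /omax => h1 h2; apply: val_inj.
by move: h1 h2; case: (leqP a e); case: (leqP b e) => //=; lia.
Qed.

Lemma wedge_mxT x : (wedge_mx x)^T = wedge_mx x.
Proof.
by apply/matrixP => a b; rewrite !mxE ominC omaxC; case: ifP => // _; rewrite mulrC.
Qed.

(** The unordered pair {a, b} is determined by [x], hence so is [b] once [a] is known. *)
Lemma wedge_mx_uniq x a b b' : wedge_mx x a b != 0 -> wedge_mx x a b' != 0 -> b = b'.
Proof.
rewrite !mxE; case: ifP => [/andP[/eqP h1 /eqP h2] _|]; last by rewrite eqxx.
case: ifP => [/andP[/eqP h3 /eqP h4] _|]; last by rewrite eqxx.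
apply: (@omin_omax_inj _ _ a); first by rewrite ominC -h1 h3 ominC.
by rewrite omaxC -h2 h4 omaxC.
Qed.

Lemma wedge_mx_sq_diag x a b : a != b -> (wedge_mx x *m wedge_mx x) a b = 0.
Proof.
move=> ab; rewrite mxE big1 // => e _.
apply/eqP; rewrite mulf_eq0; apply/norP => -[h1 h2]; case/eqP: ab.
by apply: (wedge_mx_uniq (x := x) (a := e)) => //; rewrite -wedge_mxT mxE.
Qed.

Lemma sum_triple (F : triple -> R) : \sum_x F x = \sum_i \sum_l \sum_j F (i, l, j).
Proof.
rewrite (pair_bigA _ (fun i l => \sum_j F (i, l, j))) /=.
transitivity (\sum_(il : 'I_n * 'I_m) \sum_j F (il, j)).
  by rewrite pair_bigA; apply: eq_bigr => -[].
by apply: eq_bigr => -[].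
Qed.

Lemma sum_wedge_cond (a b : 'I_n) (F : triple -> R) :
  \sum_x (if (x.1.1 == omin a b) && (x.2 == omax a b) then F x else 0) =
  \sum_l F (omin a b, l, omax a b).
Proof.
rewrite sum_triple (bigD1 (omin a b)) //= [X in _ + X]big1 ?addr0 => [|i ii]; last first.
  by apply: big1 => l _; apply: big1 => j _; rewrite (negPf ii).
apply: eq_bigr => l _; rewrite (bigD1 (omax a b)) //= !eqxx big1 ?addr0 // => j jj.
by rewrite (negPf jj) andbF.
Qed.

Lemma sum_wedge_mx (c : triple -> R) a b :
  (\sum_x c x *: wedge_mx x) a b = \sum_l c (omin a b, l, omax a b) * (A a l * A b l).
Proof.
rewrite summxE -(sum_wedge_cond a b (fun x => c x * (A a x.1.2 * A b x.1.2))).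
by apply: eq_bigr => x _; rewrite !mxE; case: ifP; rewrite ?mulr0.
Qed.

Lemma sum_pairs_delta (P : rel 'I_n) (t : 'I_n -> 'I_n -> R) a b :
  \sum_i \sum_(j | P i j) t i j * ((a == i) && (b == j))%:R = if P a b then t a b else 0.
Proof.
rewrite (bigD1 a) //= [X in _ + X]big1 ?addr0 => [|i ia]; last first.
  by apply: big1 => j _; rewrite eq_sym (negPf ia) mulr0.
case: ifP => Pab.
  rewrite (bigD1 b) //= !eqxx mulr1 big1 ?addr0 // => j /andP[_ jb].
  by rewrite [b == j]eq_sym (negPf jb) andbF mulr0.
apply: big1 => j Pj; case: (b =P j) => [bj|_]; last by rewrite andbF mulr0.
by rewrite bj Pj in Pab.
Qed.

(** An entry receives its value from exactly one of the strict upper part, its transpose and the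
    diagonal; [omin] and [omax] select the triple responsible. *)
Lemma wedge_matrix_sum (p : R) (w : wsample n m) :
  wedge_matrix p A w = \sum_x ((w x)%:R / p) *: wedge_mx x.
Proof.
apply/matrixP => a b; rewrite sum_wedge_mx mxE.
pose t i j := \sum_l p^-1 * A i l * A j l * (w (i, l, j))%:R.
have -> : (\sum_(i < n) \sum_(j < n | (i < j)%N) \sum_(l < m)
      (wedge_term p A w i l j + (wedge_term p A w i l j)^T)) a b =
   (if (a < b)%N then t a b else 0) + (if (b < a)%N then t b a else 0).
  rewrite -(sum_pairs_delta (fun i j => (i < j)%N) t a b).
  rewrite -(sum_pairs_delta (fun i j => (i < j)%N) t b a) -big_split summxE.
  apply: eq_bigr => i _; rewrite summxE -big_split; apply: eq_bigr => j _.
  rewrite summxE /= /t !mulr_suml -big_split; apply: eq_bigr => l _.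
  by rewrite !mxE.
have -> : (\sum_(i < n) \sum_(l < m) wedge_term p A w i l i) a b =
    if a == b then t a b else 0.
  rewrite -(sum_pairs_delta (fun i j => i == j) t a b) summxE; apply: eq_bigr => i _.
  rewrite (big_pred1 i) => [|j]; last by rewrite eq_sym.
  rewrite summxE /t mulr_suml; apply: eq_bigr => l _.
  by rewrite !mxE.
rewrite /omin /omax -val_eqE /=.
by case: (ltngtP a b) => ab; rewrite ?addr0 ?add0r; apply: eq_bigr => l _; ring.
Qed.

Definition wedge_noise (p : R) (w : wsample n m) : 'M[R]_n :=
  \sum_x ((w x)%:R / p - 1) *: wedge_mx x.

Lemma wedge_matrixE p w : wedge_matrix p A w = A *m A^T + wedge_noise p w.
Proof.
have -> : A *m A^T = \sum_x 1 *: wedge_mx x.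
  apply/matrixP => a b; rewrite sum_wedge_mx mxE; apply: eq_bigr => l _.
  by rewrite mxE mul1r.
rewrite wedge_matrix_sum /wedge_noise -big_split; apply: eq_bigr => x _.
by rewrite /= -scalerDl addrC subrK.
Qed.

Lemma wedge_noiseT p w : (wedge_noise p w)^T = wedge_noise p w.
Proof.
by rewrite /wedge_noise linear_sum; apply: eq_bigr => x _; rewrite linearZ /= wedge_mxT.
Qed.

(** Such a [u] picks a multiple of one row of [M]; this brings [rowmax] into the variance of a row
    of the noise. *)
Lemma sqnorm_single b (u : 'rV[R]_n) (M : 'M[R]_(n, b)) :
  (forall i j, u 0 i != 0 -> u 0 j != 0 -> i = j) ->
  sqnorm (u *m M) <= sqnorm u * rowmax M ^+ 2.
Proof.
move=> hu; have [/existsP[i ui]|] := boolP [exists i, u 0 i != 0]; last first.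
  rewrite negb_exists => /forallP h.
  have -> : u = 0 by apply/rowP => i; rewrite mxE; apply/eqP; rewrite -[_ == _]negbK h.
  by rewrite mul0mx !sqnorm0 mul0r.
have uj j : j != i -> u 0 j = 0.
  by move=> ji; apply/eqP; apply: contra_neqT ji => h; exact: hu.
have -> : u *m M = u 0 i *: row i M.
  apply/rowP => c; rewrite !mxE (bigD1 i) //= big1 ?addr0 // => j ji.
  by rewrite uj // mul0r.
have -> : sqnorm u = u 0 i ^+ 2.
  by rewrite sqnormE big_ord1 (bigD1 i) //= big1 ?addr0 // => j ji; rewrite uj // expr0n.
rewrite sqnormZ; apply: ler_wpM2l; first exact: sqr_ge0.
by rewrite -fnorm_sq ler_sqr ?nnegrE ?fnorm_ge0 ?rowmax_ge0 // le_rowmax.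
Qed.

Lemma row_wedge_mx_single x a i j :
  row a (wedge_mx x) 0 i != 0 -> row a (wedge_mx x) 0 j != 0 -> i = j.
Proof. by rewrite ![row _ _ _ _]mxE; exact: wedge_mx_uniq. Qed.

Section Bounds.
Variables (S h : R).
Hypothesis entry_le : forall a b l, (A a l * A b l) ^+ 2 <= h ^+ 2.
Hypothesis wedge_row_le : forall a, \sum_b \sum_l (A a l * A b l) ^+ 2 <= S ^+ 2 * h.

Lemma sum_sqnorm_row_wedge a : \sum_x sqnorm (row a (wedge_mx x)) <= S ^+ 2 * h.
Proof.
apply: le_trans (wedge_row_le a).
rewrite (eq_bigr (fun x => \sum_b wedge_mx x a b ^+ 2)); last first.
  by move=> x _; rewrite sqnormE big_ord1; apply: eq_bigr => b _; rewrite mxE.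
rewrite exchange_big; apply: ler_sum => b _.
rewrite -(sum_wedge_cond a b (fun x => (A a x.1.2 * A b x.1.2) ^+ 2)).
by apply: ler_sum => x _; rewrite !mxE; case: ifP => // _; rewrite expr0n.
Qed.

Lemma sqnorm_row_wedge_le x a : sqnorm (row a (wedge_mx x)) <= h ^+ 2.
Proof.
have [/existsP[i ui]|] := boolP [exists i, wedge_mx x a i != 0]; last first.
  rewrite negb_exists => /forallP h0.
  rewrite (_ : row a _ = 0) ?sqnorm0 ?sqr_ge0 //.
  by apply/rowP => i; rewrite [LHS]mxE [RHS]mxE; apply/eqP; rewrite -[_ == _]negbK; exact: h0.
rewrite sqnormE big_ord1 (bigD1 i) //= big1 ?addr0 => [|j ji].
  rewrite !mxE; case: ifP => _; first exact: entry_le.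
  by rewrite expr0n sqr_ge0.
rewrite mxE; have /eqP-> : wedge_mx x a j == 0; last by rewrite expr0n.
by apply: contra_neqT ji => h0; exact: wedge_mx_uniq h0 ui.
Qed.

End Bounds.

Definition touches (i : 'I_n) : pred triple := fun x => (x.1.1 == i) || (x.2 == i).

Lemma omin_or a b : omin a b = a /\ omax a b = b \/ omin a b = b /\ omax a b = a.
Proof. by rewrite /omin /omax; case: (a <= b)%N; [left|right]. Qed.

Lemma wedge_mx_row0 i x b : ~~ touches i x -> wedge_mx x i b = 0.
Proof.
rewrite /touches negb_or => /andP[h1 h2]; rewrite mxE; case: ifP => // /andP[/eqP e1 /eqP e2].
by case: (omin_or i b) => -[a1 a2]; move: h1 h2; rewrite e1 e2 a1 a2 eqxx // andbF.
Qed.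

Lemma coord_complM b (i a : 'I_n) (M : 'M[R]_(n, b)) c :
  (coord_compl R i *m M) a c = if a == i then 0 else M a c.
Proof.
rewrite /coord_compl mulmxBl mul1mx delta_mul !mxE.
by case: eqP => [->|_]; rewrite ?subrr ?subr0.
Qed.

Lemma mul_coord_compl b (i c : 'I_n) (M : 'M[R]_(b, n)) a :
  (M *m coord_compl R i) a c = if c == i then 0 else M a c.
Proof.
rewrite -[M *m _]trmxK trmx_mul coord_complT [LHS]mxE coord_complM.
by case: ifP => // _; rewrite mxE.
Qed.

Lemma wedge_mx_compress i x : touches i x ->
  coord_compl R i *m wedge_mx x *m coord_compl R i = 0.
Proof.
move=> tx; apply/matrixP => a b; rewrite mul_coord_compl coord_complM [RHS]mxE.
case: eqP => // /eqP bi; case: eqP => // /eqP ai; rewrite mxE.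
case: ifP => // /andP[/eqP e1 /eqP e2]; move: tx; rewrite /touches e1 e2.
by case: (omin_or a b) => -[-> ->]; rewrite (negPf ai) (negPf bi).
Qed.

(** A wedge touching [i] is supported in row and column [i], which the compression deletes. Together
    with [wedge_noise_row_splice] this separates the compressed noise from row [i] as functions of
    disjoint sets of samples. *)
Lemma wedge_noise_compress_splice p i (w w' : wsample n m) :
  coord_compl R i *m wedge_noise p (splice (touches i) w w') *m coord_compl R i =
  coord_compl R i *m wedge_noise p w' *m coord_compl R i.
Proof.
rewrite /wedge_noise !mulmx_sumr !mulmx_suml; apply: eq_bigr => x _.
rewrite ffunE; case: ifP => // tx.
by rewrite -!scalemxAr -!scalemxAl wedge_mx_compress // !scaler0.
Qed.

Lemma wedge_noise_row_splice p i (w w' : wsample n m) :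
  row i (wedge_noise p (splice (touches i) w w')) = row i (wedge_noise p w).
Proof.
apply/rowP => b; rewrite !mxE /wedge_noise !summxE; apply: eq_bigr => x _.
rewrite ffunE [LHS]mxE [RHS]mxE; case: ifP => // /negbT tx.
by rewrite (wedge_mx_row0 _ tx) !mulr0.
Qed.

End Wedges.

(** * Uniqueness of singular subspaces; row and entry bounds *)

Section SingularVectors.
Variable R : realType.

Lemma compact_svd_tr a b r (M : 'M[R]_(a, b)) U (s : 'rV[R]_r) V :
  compact_svd M U s V -> compact_svd M^T V s U.
Proof.
move=> [UU VV s0 srt ->]; split => //.
by rewrite !trmx_mul trmxK tr_diag_mx mulmxA.
Qed.

Lemma compact_svd_absorb a b r (M : 'M[R]_(a, b)) U (s : 'rV[R]_r) V U' (s' : 'rV[R]_r) V' :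
  compact_svd M U s V -> compact_svd M U' s' V' -> U *m U^T *m U' = U'.
Proof.
move=> [UU _ _ _ ME] [_ VV' s'0 _ ME'].
pose t := \row_i (s' 0 i)^-1.
have U'E : U' = M *m V' *m diag_mx t.
  rewrite {1}ME' -(mulmxA _ V'^T) VV' mulmx1 -mulmxA mulmx_diag.
  rewrite (_ : \row_j _ = const_mx 1) ?diag_const_mx ?mulmx1 //.
  by apply/rowP => i; rewrite !mxE mulfV // lt0r_neq0.
have UM : U *m U^T *m M = M.
  by rewrite ME !mulmxA -(mulmxA U) UU mulmx1.
by rewrite {1}U'E !mulmxA UM -U'E.
Qed.

(** Singular vectors are not unique, but the projection onto the column space is. Incoherence and
    the condition number each come with their own decomposition, and row norms are read off this
    projection. *)
Lemma compact_svd_left_proj a b r (M : 'M[R]_(a, b)) U (s : 'rV[R]_r) V U' (s' : 'rV[R]_r) V' :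
  compact_svd M U s V -> compact_svd M U' s' V' -> U *m U^T = U' *m U'^T.
Proof.
move=> h h'; have e1 := compact_svd_absorb h h'; have e2 := compact_svd_absorb h' h.
have : (U' *m U'^T *m U *m U^T)^T = (U *m U^T)^T by rewrite e2.
by rewrite !trmx_mul !trmxK !mulmxA e1 => ->.
Qed.

Lemma row_norm2_proj a r (U : 'M[R]_(a, r)) i : row_norm2 U i = (U *m U^T) i i.
Proof. by rewrite mxE; apply: eq_bigr => c _; rewrite mxE expr2. Qed.

Lemma sqnorm_row_svd a b r (U : 'M[R]_(a, r)) (s : 'rV[R]_r) (V : 'M[R]_(b, r)) S nu i :
  0 <= S -> V^T *m V = 1%:M -> (forall c, s 0 c ^+ 2 <= S) -> sqnorm (row i U) <= nu ->
  sqnorm (row i (U *m diag_mx s *m V^T)) <= S * nu.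
Proof.
move=> S0 VV sS Unu; rewrite row_mul -sqnormT trmx_mul trmxK sqnorm_isom // sqnormT row_mul.
apply: le_trans (ler_wpM2l S0 Unu); rewrite mul_mx_diag !sqnormE !big_ord1 mulr_sumr.
apply: ler_sum => c _; rewrite mxE exprMn mulrC; apply: ler_wpM2r; first exact: sqr_ge0.
exact: sS.
Qed.

Lemma entry_svd a b r (U : 'M[R]_(a, r)) (s : 'rV[R]_r) (V : 'M[R]_(b, r)) S nu nu' i l :
  0 <= S -> 0 <= nu -> (forall c, s 0 c ^+ 2 <= S) -> sqnorm (row i U) <= nu ->
  sqnorm (row l V) <= nu' -> (U *m diag_mx s *m V^T) i l ^+ 2 <= S * nu * nu'.
Proof.
move=> S0 nu0 sS Unu Vnu.
have -> : (U *m diag_mx s *m V^T) i l = fdot (row i U *m diag_mx s) (row l V).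
  by rewrite /fdot big_ord1 mxE; apply: eq_bigr => c _; rewrite -row_mul !mxE.
apply: le_trans (fdot_CS _ _) _; apply: ler_pM => //; try exact: sqnorm_ge0.
apply: le_trans (ler_wpM2l S0 Unu); rewrite mul_mx_diag !sqnormE !big_ord1 mulr_sumr.
apply: ler_sum => c _; rewrite mxE exprMn mulrC; apply: ler_wpM2r; first exact: sqr_ge0.
exact: sS.
Qed.

End SingularVectors.

(** * Good wedge samples and the spectral properties they imply *)

Section WedgeSpectrum.
Variables (R : realType) (n m r : nat) (A : 'M[R]_(n, m)).
Variables (U : 'M[R]_(n, r)) (s : 'rV[R]_r) (V : 'M[R]_(m, r)).
Variables (S nuU nuV p : R) (K : nat).
Hypotheses (UU : U^T *m U = 1%:M) (VV : V^T *m V = 1%:M) (AE : A = U *m diag_mx s *m V^T).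
Hypotheses (S0 : 0 <= S) (nuU0 : 0 <= nuU) (nuV0 : 0 <= nuV).
Hypothesis sS : forall c, s 0 c ^+ 2 <= S ^+ 2.
Hypothesis rowU : forall i, sqnorm (row i U) <= nuU.
Hypothesis rowV : forall l, sqnorm (row l V) <= nuV.
Let h := S ^+ 2 * nuU * nuV.
Hypotheses (h0 : 0 < h) (p01 : 0 < p <= 1) (K0 : (0 < K)%N).
Hypothesis Kh : K%:R * h / p <= S ^+ 2.

(** The threshold of [matrix_tail] at moment order [K] and variance [S ^+ 2 * h / p], where [h]
    bounds the squared entries of [A]. *)
Definition noise_level : R := Num.sqrt (4 * expR 3 * K%:R * (S ^+ 2 * h / p)).

Definition loo_proj (i : 'I_n) (w : wsample n m) : 'M[R]_n :=
  spectral_proj r (A *m A^T + coord_compl R i *m wedge_noise A p w *m coord_compl R i).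

Definition good_sample (w : wsample n m) : Prop :=
  opnorm_le (wedge_noise A p w) noise_level /\
  forall i, fnorm (row i (wedge_noise A p w *m loo_proj i w))
            <= noise_level * rowmax (loo_proj i w).

Lemma gram_svd : A *m A^T = U *m diag_mx (\row_c s 0 c ^+ 2) *m U^T.
Proof.
rewrite AE !trmx_mul trmxK tr_diag_mx !mulmxA -(mulmxA _ V^T V) VV mulmx1.
by rewrite -(mulmxA U) mulmx_diag.
Qed.

Lemma wedge_entry_le a b l : (A a l * A b l) ^+ 2 <= h ^+ 2.
Proof.
have e i : A i l ^+ 2 <= h.
  by rewrite AE; apply: entry_svd => //; exact: sqr_ge0.
by rewrite exprMn (expr2 h); apply: ler_pM => //; exact: sqr_ge0.
Qed.

(** Summing over [b] first leaves a squared column norm of [A], at most [S ^+ 2 * nuV]; the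
    remaining sum is a squared row norm, at most [S ^+ 2 * nuU]. *)
Lemma wedge_row_sum_le a : \sum_b \sum_l (A a l * A b l) ^+ 2 <= S ^+ 2 * h.
Proof.
rewrite exchange_big /=.
apply: le_trans (_ : \sum_l A a l ^+ 2 * (S ^+ 2 * nuV) <= _).
  apply: ler_sum => l _; rewrite (eq_bigr (fun b => A a l ^+ 2 * A b l ^+ 2)); last first.
    by move=> b _; rewrite exprMn.
  rewrite -mulr_sumr; apply: ler_wpM2l; first exact: sqr_ge0.
  have -> : \sum_b A b l ^+ 2 = sqnorm (row l A^T).
    by rewrite sqnormE big_ord1; apply: eq_bigr => b _; rewrite !mxE.
  by rewrite AE !trmx_mul trmxK tr_diag_mx mulmxA; apply: sqnorm_row_svd (sqr_ge0 S) _ _ _.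
rewrite -mulr_suml.
have -> : \sum_l A a l ^+ 2 = sqnorm (row a A).
  by rewrite sqnormE big_ord1; apply: eq_bigr => b _; rewrite !mxE.
have hr : sqnorm (row a A) <= S ^+ 2 * nuU by rewrite AE; apply: sqnorm_row_svd (sqr_ge0 S) _ _ _.
apply: le_trans (ler_wpM2r _ hr) _; first by nonneg.
by rewrite /h le_eqVlt; apply/orP; left; apply/eqP; ring.
Qed.

Let p0 : 0 < p. Proof. by case/andP: p01. Qed.

Let p01' : 0 <= p <= 1. Proof. by case/andP: p01 => /ltW-> ->. Qed.

Let v0 : 0 < S ^+ 2 * h / p.
Proof.
have : 0 < K%:R * h / p by rewrite divr_gt0 // mulr_gt0 // ltr0n.
by move=> /lt_le_trans/(_ Kh) S20; rewrite divr_gt0 // mulr_gt0.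
Qed.

Let sum_v i : (\sum_x sqnorm (row i (wedge_mx A x))) / p <= S ^+ 2 * h / p.
Proof.
rewrite ler_pM2r ?invr_gt0 //; apply: sum_sqnorm_row_wedge; exact: wedge_row_sum_le.
Qed.

Let max_v i x : K%:R * (sqnorm (row i (wedge_mx A x)) / p ^+ 2) <= S ^+ 2 * h / p.
Proof.
have hx : sqnorm (row i (wedge_mx A x)) <= h ^+ 2.
  by apply: sqnorm_row_wedge_le; exact: wedge_entry_le.
apply: le_trans (_ : K%:R * (h ^+ 2 / p ^+ 2) <= _).
  apply: ler_wpM2l; first exact: ler0n.
  by rewrite ler_pM2r // invr_gt0 exprn_gt0.
(* By [Kh] the largest single summand, even multiplied by [K], stays below the variance: this is the
   subgaussian regime of the tail. *)
have -> : K%:R * (h ^+ 2 / p ^+ 2) = K%:R * h / p * (h / p) by field; exact: lt0r_neq0.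
have -> : S ^+ 2 * h / p = S ^+ 2 * (h / p) by rewrite mulrA.
by apply: ler_wpM2r => //; apply: divr_ge0; exact: ltW.
Qed.

Lemma noise_level_sq : noise_level ^+ 2 = 4 * expR 3 * K%:R * (S ^+ 2 * h / p).
Proof. by rewrite sqr_sqrtr //; nonneg. Qed.

Lemma prob_opnorm_bad :
  prob p (fun w : wsample n m => ~ opnorm_le (wedge_noise A p w) noise_level)
  <= n%:R ^+ 2 * expR (- K%:R).
Proof.
apply: matrix_tail => //; first exact: wedge_mxT.
by move=> x i j; exact: wedge_mx_sq_diag.
Qed.

(* Conditionally on the wedges not touching [i] the matrix [loo_proj i w] is
   frozen, whereas row [i] of the noise only involves the wedges touching [i]. *)
Lemma prob_row_bad i :
  prob p (fun w : wsample n m => noise_level * rowmax (loo_proj i w) <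
    fnorm (row i (wedge_noise A p w *m loo_proj i w))) <= expR (- K%:R).
Proof.
rewrite /prob (expect_resample p (touches i)) -[leRHS](expect_cst ('I_n * 'I_m * 'I_n)%type p).
apply: expect_le => // w'.
have looE (w : wsample n m) : loo_proj i (splice (touches i) w w') = loo_proj i w'.
  by rewrite /loo_proj wedge_noise_compress_splice.
set Q := loo_proj i w' in looE *.
pose v := S ^+ 2 * h / p * rowmax Q ^+ 2.
have tail := @vector_tail R _ _ _ (fun x => row i (wedge_mx A x) *m Q) p v K K0 p01.
have single x : sqnorm (row i (wedge_mx A x) *m Q) <=
    sqnorm (row i (wedge_mx A x)) * rowmax Q ^+ 2.
  by apply: sqnorm_single => a b; exact: row_wedge_mx_single.
have M0 : 0 <= rowmax Q ^+ 2 := sqr_ge0 _.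
apply: le_trans (tail _ _ _).
- apply: (@prob_le _ _ _ p01' (fun w =>
    noise_level * rowmax (loo_proj i (splice (touches i) w w')) <
    fnorm (row i (wedge_noise A p (splice (touches i) w w') *m
      loo_proj i (splice (touches i) w w'))))) => w.
  rewrite looE row_mul wedge_noise_row_splice => hw.
  have -> : \sum_x ((w x)%:R / p - 1) *: (row i (wedge_mx A x) *m Q) =
      row i (wedge_noise A p w) *m Q.
    rewrite /wedge_noise linear_sum mulmx_suml; apply: eq_bigr => x _.
    by rewrite linearZ /= scalemxAl.
  have -> : 4 * expR 3 * K%:R * v = (noise_level * rowmax Q) ^+ 2.
    by rewrite exprMn noise_level_sq /v; ring.
  rewrite -fnorm_sq ltr_sqr ?nnegrE ?fnorm_ge0 // mulr_ge0 ?rowmax_ge0 //.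
  exact: sqrtr_ge0.
- by apply: mulr_ge0 => //; exact: ltW.
- apply: le_trans (_ : (\sum_x sqnorm (row i (wedge_mx A x))) / p * rowmax Q ^+ 2 <= _).
    rewrite mulrAC ler_pM2r ?invr_gt0 // mulr_suml; apply: ler_sum => x _; exact: single.
  by apply: ler_wpM2r.
- move=> x; apply: le_trans (_ : K%:R * (sqnorm (row i (wedge_mx A x)) / p ^+ 2)
      * rowmax Q ^+ 2 <= _).
    rewrite -mulrA; apply: ler_wpM2l; first exact: ler0n.
    rewrite mulrAC ler_pM2r ?invr_gt0 ?exprn_gt0 //.
  by apply: ler_wpM2r.
Qed.

(** Union bound: n^2 comes from the matrix tail, n from the rows. *)
Lemma prob_bad_sample :
  prob p (fun w => ~ good_sample w) <= (n%:R ^+ 2 + n%:R) * expR (- K%:R).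
Proof.
rewrite mulrDl; apply: le_trans (lerD prob_opnorm_bad (_ : prob p (fun w => exists i,
    noise_level * rowmax (loo_proj i w) <
    fnorm (row i (wedge_noise A p w *m loo_proj i w))) <= _)); last first.
  by have := prob_exists p01' prob_row_bad; rewrite card_ord.
apply: le_trans (prob_or p01' _ _); apply: prob_le => // w.
move=> /not_andP[hw|hw]; [by left|right].
by have /existsNP[i hi] := hw; exists i; rewrite ltNge; apply/negP.
Qed.

Variable sig : R.
Hypotheses (rn : (r <= n)%N) (sig0 : 0 < sig) (sigs : forall c, sig <= s 0 c ^+ 2).
Hypothesis small_noise : noise_level <= sig / 20.

Lemma gram_row_le i : fnorm (row i (A *m A^T)) <= S ^+ 2 * Num.sqrt nuU.
Proof.
rewrite fnorm_le; last by nonneg.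
rewrite exprMn sqr_sqrtr // gram_svd; apply: sqnorm_row_svd (sqr_ge0 _) _ _ _ => // c.
rewrite mxE ler_sqr ?nnegrE; [exact: sS | exact: sqr_ge0 | exact: sqr_ge0].
Qed.

Lemma good_sample_spectral (w : wsample n m) (Q := spectral_proj r (wedge_matrix p A w)) :
  good_sample w ->
  [/\ forall U' : 'M[R]_(n, r), top_eigvecs (wedge_matrix p A w) U' -> U' *m U'^T = Q,
      Q^T = Q, Q *m Q = Q,
      forall i, fnorm (row i Q) <= 2 * (S ^+ 2 * Num.sqrt nuU) / sig &
      fnorm ((1%:M - Q) *m U) <= 2 * Num.sqrt r%:R * noise_level / sig].
Proof.
move=> [wop wloo]; have tau0 : 0 <= noise_level := sqrtr_ge0 _.
have ET := wedge_noiseT A p w.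
have GT : (A *m A^T)^T = A *m A^T by rewrite trmx_mul trmxK.
have ZT : (wedge_matrix p A w)^T = wedge_matrix p A w.
  by rewrite wedge_matrixE linearD /= GT ET.
have [W [lam [WZ QE]]] := spectral_projP r ZT; rewrite -/Q in QE.
have [WW WD _] := WZ.
have dsig c : sig <= (\row_c s 0 c ^+ 2) 0 c by rewrite mxE.
have WZ' := WZ; rewrite wedge_matrixE gram_svd in WZ'.
have lamr := weyl_lower UU tau0 wop WZ' dsig.
have lamu := weyl_upper tau0 wop WZ'.
have sn := small_noise; have sp := sig0.
have gap : noise_level <= sig - noise_level by lra.
have gap' : 0 < sig - noise_level - noise_level by lra.
split.
(* Davis-Kahan with the same matrix on both sides: since there is a gap after the first [r]
   eigenvalues, two eigenbases give the same projection. *)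
- move=> U' /(top_eigvecs_topproj rn)[W' [lam' [W'Z ->]]]; have [W'W' _ _] := W'Z.
  have W'Z' := W'Z; rewrite wedge_matrixE gram_svd in W'Z'.
  have lamr' := weyl_lower UU tau0 wop W'Z' dsig.
  have := davis_kahan_proj W'Z WZ gap lamr' lamu.
  rewrite subrr mul0mx sqnorm0 pmulr_rle0 ?exprn_gt0 // => dk.
  have := sqnorm_diff_topproj rn W'W' WW.
  have -> : sqnorm ((1%:M - topproj r W) *m topproj r W') = 0.
    by apply/eqP; rewrite eq_le dk sqnorm_ge0.
  by rewrite mulr0 => /sqnorm_eq0/eqP; rewrite subr_eq0 QE => /eqP.
- by rewrite QE topprojT.
- by rewrite QE topproj_idem.
- rewrite QE; apply: (leave_one_out (Qs := fun i => loo_proj i w) rn UU sig0 _ wop dsig WZ').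
  + by rewrite tau0.
  + move=> i; rewrite -gram_svd; apply: spectral_projP.
    by rewrite linearD /= GT !trmx_mul coord_complT ET mulmxA.
  + move=> i; apply: le_trans (wloo i) _; apply: ler_wpM2r; [exact: rowmax_ge0|exact: small_noise].
  + by nonneg.
  + by move=> i; rewrite -gram_svd; exact: gram_row_le.
(* Here the invariant subspace is that of the noiseless matrix, so the perturbation is the noise
   times [U], and [sqnorm U = r%:R]. The gap is at least [sig / 2], which gives the factor 2. *)
- have GU : A *m A^T *m U = U *m diag_mx (\row_c s 0 c ^+ 2).
    by rewrite gram_svd -mulmxA UU mulmx1.
  have bea : noise_level <= sig by lra.
  have := davis_kahan WW WD GU bea _ lamu; rewrite -QE.
  move=> /(_ (fun c => or_intror (dsig c))).
  have -> : A *m A^T - wedge_matrix p A w = - wedge_noise A p w.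
    by rewrite wedge_matrixE opprD addrA subrr add0r.
  rewrite mulNmx sqnormN => dk.
  have Ur : sqnorm U = r%:R.
    by rewrite -sqnormT sqnorm_trace trmxK UU mxtrace1.
  have := opnorm_le_mul U wop; rewrite Ur => hop.
  have {}dk := le_trans dk hop.
  rewrite ler_pdivlMr // -ler_sqr ?nnegrE; [|by nonneg|by nonneg].
  rewrite !exprMn fnorm_sq sqr_sqrtr ?ler0n //.
  have h1 : (sig / 2) ^+ 2 <= (sig - noise_level) ^+ 2 by rewrite ler_sqr ?nnegrE; lra.
  have h2 := ler_wpM2r (sqnorm_ge0 ((1%:M - Q) *m U)) h1.
  have {}h2 := le_trans h2 dk; rewrite exprMn in h2.
  by lra.
Qed.

End WedgeSpectrum.

(** * Choice of the moment order, the sampling step, and the constants *)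

Section Assembly.
Variable R : realType.

Lemma ln2_ge_half : 1 / 2 <= ln 2 :> R.
Proof.
rewrite -[leLHS]expRK ler_ln ?posrE ?expR_gt0 //.
by have := @expR_le1D2x R (1 / 2); lra.
Qed.

(** [K] is (a + 2) ln n rounded up: the 2 pays for n^2, and the rounding costs at most 1 <= 2 (a -
    1) ln n because ln n >= 1/2. *)
Lemma moment_order (a : R) n : 2 <= a -> (1 < n)%N -> exists K : nat,
  [/\ (0 < K)%N, K%:R <= 3 * (a * ln n%:R) &
      n%:R ^+ 2 * expR (- K%:R) <= n%:R `^ (- a)].
Proof.
move=> a2 n1; have n0 : 0 < n%:R :> R by rewrite ltr0n (ltn_trans _ n1).
set L := ln n%:R; have L2 : 1 / 2 <= L.
  by apply: le_trans ln2_ge_half _; rewrite ler_ln ?posrE // ler_nat.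
have x0 : 0 <= (a + 2) * L by apply: mulr_ge0; lra.
have /andP[tx xt] := truncn_itv x0.
exists (Num.truncn ((a + 2) * L)).+1; split => //.
  by rewrite -natr1; nra.
rewrite /powR gt_eqF // -[n%:R in X in X * _](lnK (_ : n%:R \in Num.pos)) ?posrE //.
rewrite -expRM_natl -expRD ler_expR -/L; lra.
Qed.

Lemma prob2_expect (X Y : finType) (p q : R) (E : {ffun X -> bool} -> {ffun Y -> bool} -> Prop) :
  prob2 p q E = expect p (fun w => prob q (E w)).
Proof.
apply: eq_bigr => w _; rewrite mulr_sumr; apply: eq_bigr => e _; by rewrite mulrA.
Qed.

Lemma prob_compl (X : finType) (p : R) (P : {ffun X -> bool} -> Prop) :
  prob p (fun w => ~ P w) = 1 - prob p P.
Proof.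
suff : prob p (fun w => ~ P w) + prob p P = 1 by lra.
rewrite /prob -expectD -[RHS](expect_cst X p); apply: eq_expect => w.
by rewrite asbool_neg; case: asboolP => _ /=; ring.
Qed.

Lemma prob2_ge (X Y : finType) (p q d d' : R) (good : {ffun X -> bool} -> Prop)
    (E : {ffun X -> bool} -> {ffun Y -> bool} -> Prop) :
  0 <= p <= 1 -> 0 <= q <= 1 -> 0 <= d -> prob p (fun w => ~ good w) <= d' ->
  (forall w, good w -> prob q (fun e => ~ E w e) <= d) -> 1 - (d + d') <= prob2 p q E.
Proof.
move=> p01 q01 d0 bad hE; rewrite prob2_expect.
suff : 1 - d <= expect p (fun w => prob q (E w)) + prob p (fun w => ~ good w) by lra.
rewrite -[leLHS](expect_cst X p) -expectD; apply: expect_le => // w.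
have EE : prob q (E w) = 1 - prob q (fun e => ~ E w e) by rewrite prob_compl subKr.
case: asboolP => [_|/contrapT/hE]; last by rewrite EE; lra.
suff : 0 <= prob q (E w) by lra.
by apply: expect_ge0 => // e; case: ifP.
Qed.

Lemma card_mindex k n : #|{: mindex k n}| = (n ^ k)%N.
Proof. by rewrite card_ffun !card_ord. Qed.

Lemma unfold_entry k n (T : mindex k n -> R) j f :
  T f = unfold j T (f j) (enum_rank (drop_at j f)).
Proof.
rewrite mxE enum_rankK; congr T; apply/ffunP => l; rewrite ffunE.
by case: unliftP => [l' ->|->] //; rewrite ffunE.
Qed.

(** Each summand is an entry of [T] times a column of the Kronecker power, whose squared norm
    factorises over the modes into at most (b^2)^k. There are n^k of them; the extra 3 in the
    variance lets [K <= 3 q n^k] cover the largest summand. *)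
Lemma sampling_tail k n (T : mindex k n -> R) (Q : 'M[R]_n) (h b q : R) K :
  (0 < K)%N -> 0 < q <= 1 -> 0 <= h -> 0 <= b -> Q^T = Q ->
  (forall i, fnorm (row i Q) <= b) -> (forall f, T f ^+ 2 <= h) ->
  K%:R <= 3 * (q * n%:R ^+ k) ->
  prob q (fun e : esample k n =>
    4 * expR 3 * K%:R * (3 * n%:R ^+ k * (h * (b ^+ 2) ^+ k) / q) <
    sqnorm (kron (fun=> Q) *m tvec T -
      kron (fun=> Q) *m tvec (fun f => q^-1 * (if e f then T f else 0)))) <= expR (- K%:R).
Proof.
move=> K0 q01 h0 b0 QT Qb Th Kq; have /andP[q0 q1] := q01.
have q01' : 0 <= q <= 1 by rewrite ltW.
pose H f := T f *: col (enum_rank f) (kron (fun=> Q) : 'M[R]_#|{: mindex k n}|).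
have HE f : sqnorm (H f) <= h * (b ^+ 2) ^+ k.
  rewrite sqnormZ sqnorm_kron_col; apply: ler_pM => //; first exact: sqr_ge0.
    by apply: prodr_ge0 => l _; exact: sqnorm_ge0.
  have -> : (b ^+ 2) ^+ k = \prod_(l < k) b ^+ 2 by rewrite prodr_const card_ord.
  apply: ler_prod => l _; rewrite sqnorm_ge0 /= -sqnormT tr_col QT -fnorm_sq.
  by rewrite ler_sqr ?nnegrE ?fnorm_ge0.
set hq := h * (b ^+ 2) ^+ k in HE *.
have hq0 : 0 <= hq by rewrite /hq; nonneg.
apply: le_trans (@vector_tail R _ _ _ H q (3 * n%:R ^+ k * hq / q) K K0 q01 _ _ _).
- by apply: prob_le => // e; rewrite noise_tvec sqnormN.
- by nonneg.
- rewrite ler_pM2r ?invr_gt0 //; apply: le_trans (ler_sum _ (fun f _ => HE f)) _.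
  rewrite sumr_const card_mindex -[_ *+ _]mulr_natl natrX -mulrA.
  by have : 0 <= n%:R ^+ k * hq; [nonneg|lra].
- move=> f; apply: le_trans (_ : K%:R * (hq / q ^+ 2) <= _).
    by apply: ler_wpM2l; [exact: ler0n|rewrite ler_pM2r ?invr_gt0 ?exprn_gt0].
  have -> : 3 * n%:R ^+ k * hq / q = 3 * (q * n%:R ^+ k) * (hq / q ^+ 2).
    by field; exact: lt0r_neq0.
  by apply: ler_wpM2r Kq; nonneg.
Qed.

(** By symmetry all modes share one unfolding [A], and [A] factors as [U] times [U^T *m A]; hence
    each of the [k] telescoping terms is governed by [(1%:M - Q) *m U]. *)
Lemma tensor_bias k n m (hk : (1 < k)%N) (T : mindex k n -> R) (Q : 'M[R]_n)
    (U : 'M[R]_(n, m)) : symmetric_tensor T -> Q^T = Q -> Q *m Q = Q ->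
  U^T *m U = 1%:M -> U *m U^T *m unfold (mode1 hk) T = unfold (mode1 hk) T ->
  fnorm (tvec T - kron (fun=> Q) *m tvec T) <=
  k%:R * (fnorm ((1%:M - Q) *m U) * frob T).
Proof.
case: k hk T => // k hk T Tsym QT QQ UU UT; apply: kron_bias => // j.
have -> : fnorm (slot j (1%:M - Q) *m tvec T) = fnorm ((1%:M - Q) *m unfold (mode1 hk) T).
  by rewrite /fnorm sqnorm_slot (unfold_symmetric j (mode1 hk) Tsym).
rewrite -UT -mulmxA mulmxA; apply: le_trans (fnormM _ _) _.
apply: ler_wpM2l; first exact: fnorm_ge0.
rewrite fnorm_le ?sqrtr_ge0 // -(sqnorm_unfold T (mode1 hk)).
exact: sqnorm_coisom.
Qed.

Lemma powR_half_sq (x : R) k : 0 < x -> (x `^ (3 / 2 + k%:R / 2)) ^+ 2 = x ^+ (k + 3).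
Proof.
move=> x0; rewrite expr2 -powRD; last by rewrite gt_eqF // implybT.
rewrite -powR_mulrn ?ltW // natrD; congr powR; lra.
Qed.

Lemma expR3_le4 : expR 3 <= expR 4 :> R.
Proof. by rewrite ler_expR; lra. Qed.

Lemma expR2_sq : expR 2 ^+ 2 = expR 4 :> R.
Proof. by rewrite expr2 -expRD; congr expR; lra. Qed.

(** The constant 7 comes from squaring: 4 * 4 * 3 = 48 <= 49, and exp(3) <= exp(4). *)
Lemma bias_constant (S sig rho p aL K : R) : 0 < sig -> 0 <= rho -> 0 < p ->
  0 <= K <= 3 * aL ->
  2 * Num.sqrt (4 * expR 3 * K * (S ^+ 2 * (S ^+ 2 * rho) / p)) / sig <=
  7 * expR 2 * (S ^+ 2 / sig) * Num.sqrt (aL * rho / p).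
Proof.
move=> sig0 rho0 p0 /andP[K0 KL]; have aL0 : 0 <= aL by lra.
have -> : 7 * expR 2 * (S ^+ 2 / sig) * Num.sqrt (aL * rho / p) =
          7 * expR 2 * S ^+ 2 * Num.sqrt (aL * rho / p) / sig by ring.
rewrite ler_pM2r ?invr_gt0 //.
have r0 : 0 <= aL * rho / p by nonneg.
rewrite -ler_sqr ?nnegrE; [|by nonneg|by nonneg].
rewrite !exprMn !sqr_sqrtr //; last by nonneg.
rewrite expR2_sq.
have y0 : 0 <= S ^+ 2 ^+ 2 * rho / p by nonneg.
have e3 := expR_ge0 (3 : R).
have h1 := ler_wpM2l e3 KL.
have h2 := ler_wpM2r aL0 expR3_le4.
have h3 : 16 * expR 3 * K <= 49 * expR 4 * aL.
  by have := mulr_ge0 (expR_ge0 (4 : R)) aL0; lra.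
rewrite -subr_ge0 in h3; have h4 := mulr_ge0 h3 y0.
by rewrite -subr_ge0; from_nonneg h4; ring.
Qed.

(** After squaring, both sides share the factor [Z]. What remains is 12 * 3 = 36 <= 49, exp(3) <=
    exp(4), [S <= F] and 1 <= (k - 1) r. *)
Lemma noise_constant (S F kappa2 mu1 mu2 r L a n q K : R) k :
  0 <= S <= F -> 0 < mu1 -> 0 < mu2 -> 1 <= r -> 0 < n -> 0 < q -> (1 < k)%N ->
  0 <= kappa2 -> 0 <= K <= 3 * (a * L) ->
  Num.sqrt (4 * expR 3 * K * (3 * n ^+ k * (S ^+ 2 * (mu1 * mu2 * r ^+ 2 / n ^+ k) *
    ((2 * (kappa2 * Num.sqrt (mu1 * r / n))) ^+ 2) ^+ k) / q)) <=
  7 * expR 2 * (2 ^+ k * r `^ (3 / 2 + k%:R / 2) * kappa2 ^+ k *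
    Num.sqrt (a * (k%:R - 1) * mu1 ^+ k.+1 * mu2 * L / (q * n ^+ k))) * F.
Proof.
move=> /andP[S0 SF] m1 m2 r1 n0 q0 k1 kap0 /andP[K0 KL].
have r0 : 0 < r by lra.
have k2 : 1 <= k%:R - 1 :> R by rewrite lerBrDr (_ : 1 + 1 = 2%:R) ?ler_nat.
have aL0 : 0 <= a * L by lra.
pose Z := 4 ^+ k * (kappa2 ^+ k) ^+ 2 * mu1 ^+ k.+1 * mu2 * r ^+ k.+2 / (q * n ^+ k).
have Z0 : 0 <= Z by rewrite /Z; nonneg.
have F0 : 0 <= F by lra.
have arg0 : 0 <= a * (k%:R - 1) * mu1 ^+ k.+1 * mu2 * L / (q * n ^+ k).
  have -> : a * (k%:R - 1) * mu1 ^+ k.+1 * mu2 * L = a * L * (k%:R - 1) * mu1 ^+ k.+1 * mu2 by ring.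
  have : 0 <= k%:R - 1 :> R by lra.
  by move=> ?; nonneg.
have kp : 0 <= k%:R - 1 :> R by lra.
have m0 : 0 <= mu1 * r / n by nonneg.
rewrite -ler_sqr ?nnegrE; [|exact: sqrtr_ge0|by apply: mulr_ge0 => //; nonneg; exact: powR_ge0].
rewrite sqr_sqrtr; last by nonneg.
have -> : 4 * expR 3 * K * (3 * n ^+ k * (S ^+ 2 * (mu1 * mu2 * r ^+ 2 / n ^+ k) *
    ((2 * (kappa2 * Num.sqrt (mu1 * r / n))) ^+ 2) ^+ k) / q) = 12 * expR 3 * K * S ^+ 2 * Z.
  have -> : (2 * (kappa2 * Num.sqrt (mu1 * r / n))) ^+ 2 = 4 * kappa2 ^+ 2 * (mu1 * r / n).
    by rewrite 2!exprMn sqr_sqrtr //; ring.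
  rewrite /Z -[kappa2 ^+ k ^+ 2]exprM [(k * 2)%N]mulnC exprM.
  rewrite (exprMn _ (4 * kappa2 ^+ 2)) (exprMn _ 4) (exprMn _ (mu1 * r)) (exprMn _ mu1) exprVn.
  rewrite (exprS mu1) (exprS r k.+1) (exprS r k).
  have : n ^+ k != 0 by rewrite gt_eqF // exprn_gt0.
  move: (4 ^+ k : R) (kappa2 ^+ 2 ^+ k) (mu1 ^+ k) (r ^+ k) (n ^+ k) (expR 3 : R).
  move=> c4 ck cm cr cn e cn0; field.
  by rewrite cn0 gt_eqF.
rewrite !exprMn sqr_sqrtr // expR2_sq powR_half_sq //.
have -> : (7 ^+ 2 * expR 4 * (2 ^+ k ^+ 2 * r ^+ (k + 3) * kappa2 ^+ k ^+ 2 *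
   (a * (k%:R - 1) * mu1 ^+ k.+1 * mu2 * L / (q * n ^+ k))) * F ^+ 2) =
   49 * expR 4 * (a * L) * ((k%:R - 1) * r * F ^+ 2) * Z.
  rewrite /Z.
  have -> : (2 ^+ k ^+ 2 : R) = 4 ^+ k by rewrite -exprM mulnC exprM; congr (_ ^+ _); ring.
  rewrite addn3 (exprS r k.+2); move: (r ^+ k.+2) (mu1 ^+ k.+1) => cr cm.
  by move: (n ^+ k) (kappa2 ^+ k ^+ 2) (4 ^+ k : R) => cn ck c4; ring.
apply: ler_wpM2r => //.
have e3 := expR_ge0 (3 : R); have e4 := expR_ge0 (4 : R).
have h1 : 12 * expR 3 * K <= 49 * expR 4 * (a * L).
  have h1 := ler_wpM2l e3 KL; have h2 := ler_wpM2r aL0 expR3_le4.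
  by have := mulr_ge0 e4 aL0; lra.
apply: ler_pM => //; [by nonneg|by nonneg|].
apply: le_trans (_ : F ^+ 2 <= _); first by rewrite ler_sqr ?nnegrE.
rewrite -[leLHS]mul1r; apply: ler_wpM2r; first exact: sqr_ge0.
by rewrite -[leLHS]mul1r; apply: ler_pM.
Qed.

End Assembly.

(** * Error decomposition and the final estimate *)

Section MainEstimate.
Variable R : realType.

(** The squared row norms of [U] add up to [r > 0], so their common bound is positive. This yields
    the positivity of [mu1] and [mu2], which the theorem does not assume. *)
Lemma svd_scale_gt0 a r (U : 'M[R]_(a, r)) mu : (0 < r)%N -> U^T *m U = 1%:M ->
  (forall i, row_norm2 U i <= mu * r%:R / a%:R) -> 0 < mu * r%:R / a%:R.
Proof.
move=> r0 UU hU; rewrite ltNge; apply/negP => nu0.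
have : sqnorm U <= 0.
  rewrite sqnorm_rows; apply: sumr_le0 => i _; rewrite -row_norm2E; exact: le_trans (hU i) nu0.
by rewrite -sqnormT sqnorm_trace trmxK UU mxtrace1 lern0; case: r r0 {U UU hU nu0}.
Qed.

Lemma estimator_error k n r (hk : (1 < k)%N) (T : mindex k n -> R) q (U : 'M[R]_(n, r))
    (e : esample k n) :
  frob (fun f => T f - estimator hk T q U e f) <=
  fnorm (tvec T - kron (fun=> U *m U^T) *m tvec T) +
  fnorm (kron (fun=> U *m U^T) *m tvec T -
         kron (fun=> U *m U^T) *m tvec (fun f => q^-1 * (if e f then T f else 0))).
Proof.
rewrite -estimator_tvec frob_tvec.
apply: le_trans (fnormD _ _); rewrite addrA subrK.
rewrite (_ : tvec _ = tvec T - tvec (estimator hk T q U e)) //.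
by apply/matrixP => c o; rewrite !mxE.
Qed.

Lemma prob_never (X : finType) (p : R) (P : {ffun X -> bool} -> Prop) :
  (forall w, ~ P w) -> prob p P = 0.
Proof.
by move=> NP; rewrite -[RHS](expect_cst X p); apply: eq_expect => w; rewrite asboolF.
Qed.

Lemma sampling_rate (x y e c p : R) : 0 <= x -> y <= 3 * x -> 1 <= e -> 1 <= c ->
  4800 * e * c * x <= p -> y <= p /\ 1600 * (e * c * y) <= p.
Proof.
move=> x0 yx e1 c1 hp; have ec : 1 * 1 <= e * c by apply: ler_pM.
have h1 := ler_wpM2r x0 ec; have h2 := ler_wpM2l (le_trans ler01 (le_trans _ ec)) yx.
by rewrite mulr1 in h2; have := h2 (lexx _); split; lra.
Qed.

Lemma singular_value_le a b r (U : 'M[R]_(a, r)) (s : 'rV[R]_r) (V : 'M[R]_(b, r)) c :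
  U^T *m U = 1%:M -> V^T *m V = 1%:M -> s 0 c ^+ 2 <= sqnorm (U *m diag_mx s *m V^T).
Proof.
move=> UU VV; rewrite -mulmxA sqnorm_isom // -sqnormT trmx_mul trmxK sqnorm_isom // sqnormT.
apply: le_trans (sqnorm_row_le _ c); rewrite sqnormE big_ord1 (bigD1 c) //=.
by rewrite !mxE eqxx mulr1n lerDl sumr_ge0 // => *; exact: sqr_ge0.
Qed.

Lemma fnorm_unfold k n (hk : (1 < k)%N) (T : mindex k n -> R) :
  fnorm (unfold (mode1 hk) T) = frob T.
Proof.
case: k hk T => // k hk T.
by rewrite /fnorm sqnorm_unfold sqrtr_sqr ger0_norm ?sqrtr_ge0.
Qed.

End MainEstimate.

Theorem theorem4p1 (R : realType) (a : R) (ha : 2 <= a) :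
  exists C0 C C' : R, [/\ 0 < C0, 0 < C, 0 < C' &
  forall (k n r : nat) (hk : (1 < k)%N) (T : mindex k n -> R) (mu1 mu2 kappa p q : R),
    (1 < n)%N ->
    symmetric_tensor T ->
    incoherent T mu1 mu2 ->
    \rank (unfold (mode1 hk) T) = r ->
    cond_number (unfold (mode1 hk) T) kappa ->
    0 < p <= 1 -> 0 < q <= 1 ->
    C0 * kappa ^+ 4 * a * mu1 * mu2 * r%:R ^+ 2 * ln n%:R / n%:R ^+ k <= p ->
    a * (k%:R - 1) * ln n%:R / n%:R ^+ k <= q ->
    1 - C' * n%:R `^ (- a) <=
    prob2 p q (fun (w : wsample n (ncol k n)) (e : esample k n) =>
      forall U : 'M[R]_(n, r),
        top_eigvecs (wedge_matrix p (unfold (mode1 hk) T) w) U ->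
        frob (fun f => T f - estimator hk T q U e f) <=
        C * (k%:R * Num.sqrt r%:R * kappa ^+ 2 *
               Num.sqrt (a * mu1 * mu2 * r%:R ^+ 2 * ln n%:R / (p * n%:R ^+ k))
             + 2 ^+ k * r%:R `^ (3 / 2 + k%:R / 2) * kappa ^+ (2 * k) *
               Num.sqrt (a * (k%:R - 1) * mu1 ^+ k.+1 * mu2 * ln n%:R / (q * n%:R ^+ k)))
          * frob T)].
Proof.
(* [4800 = 4 * 20 ^ 2 * 3]: moments of order [K <= 3 a ln n] give
   [noise_level <= sig / 20]. *)
exists (4800 * expR 3), (7 * expR 2), 3.
have e2 := expR_gt0 (2 : R); have e3 := expR_gt0 (3 : R).
split; [lra | lra | lra |].
move=> k n r hk T mu1 mu2 kappa p q n1 Tsym inc rk cond p01 q01 hp hq.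
have /andP[p0 p1] := p01; have /andP[q0 q1] := q01.
have p01' : 0 <= p <= 1 by rewrite ltW.
have q01' : 0 <= q <= 1 by rewrite ltW.
have [K [K0 K3 Ka]] := moment_order ha n1.
have nR0 : 0 < n%:R :> R by rewrite ltr0n (ltn_trans _ n1).
have na0 : 0 <= n%:R `^ (- a) :> R := powR_ge0 _ _.
have n1R : 1 <= n%:R :> R by rewrite ler1n (ltn_trans _ n1).
have eK0 := expR_ge0 (- K%:R : R).
have nK : n%:R * expR (- K%:R) <= n%:R `^ (- a).
  apply: le_trans Ka; rewrite expr2; apply: ler_wpM2r => //.
  by rewrite -[leLHS]mul1r ler_pM2r.
have eKa : expR (- K%:R) <= n%:R `^ (- a).
  by apply: le_trans nK; rewrite -[leLHS]mul1r; apply: ler_wpM2r.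
set A := unfold (mode1 hk) T in rk cond hp *.
have frobA : frob T = fnorm A by rewrite /A fnorm_unfold.
(* In rank zero there is no singular value to constrain [kappa], but the tensor and its estimate
   both vanish. *)
have [r0|rpos] := posnP r.
  have A0 : A = 0 by apply/eqP; rewrite -mxrank_eq0 rk r0.
  have F0 : frob T = 0 by rewrite frobA A0 /fnorm sqnorm0 sqrtr0.
  have T0 f : T f = 0 by rewrite (unfold_entry T (mode1 hk)) -/A A0 mxE.
  apply: le_trans (_ : 1 - (n%:R `^ (- a) + 0) <= _); first lra.
  apply: (@prob2_ge _ _ _ _ _ _ _ (fun=> True)) => // [|w _].
    by rewrite prob_never // => w; exact.
  rewrite prob_never // => e; apply => U _; rewrite F0 mulr0 frob_tvec.
  have -> : tvec (fun f => T f - estimator hk T q U e f) = 0.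
    have -> : tvec (fun f => T f - estimator hk T q U e f) = - tvec (estimator hk T q U e).
      by apply/matrixP => c o; rewrite !mxE T0 sub0r.
    rewrite estimator_tvec (_ : tvec _ = 0) ?mulmx0 ?oppr0 //.
    by apply/matrixP => c o; rewrite !mxE T0 if_same mulr0.
  by rewrite /fnorm sqnorm0 sqrtr0.
subst r.
have [U [s [V [svd hkappa]]]] := cond.
have [U1 [s1 [V1 [svd1 [rU1 rV1]]]]] := inc (mode1 hk).
rewrite -/A in U1 s1 V1 svd1 rU1 rV1.
have [UU VV spos ssort AE] := svd.
set r := \rank A in U s V U1 s1 V1 svd1 rU1 rV1 svd hkappa UU VV spos ssort AE rpos hp *.
have rR0 : 0 < r%:R :> R by rewrite ltr0n.
have rR1 : 1 <= r%:R :> R by rewrite ler1n.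
pose nuU := mu1 * r%:R / n%:R; pose nuV := mu2 * r%:R / (ncol k n)%:R.
have nuU0 : 0 < nuU by case: svd1 => UU1 _ _ _ _; exact: svd_scale_gt0 rU1.
have nuV0 : 0 < nuV by case: svd1 => _ VV1 _ _ _; exact: svd_scale_gt0 rV1.
have rowU i : sqnorm (row i U) <= nuU.
  by rewrite -row_norm2E row_norm2_proj (compact_svd_left_proj svd svd1) -row_norm2_proj.
have rowV i : sqnorm (row i V) <= nuV.
  rewrite -row_norm2E row_norm2_proj.
  by rewrite (compact_svd_left_proj (compact_svd_tr svd) (compact_svd_tr svd1)) -row_norm2_proj.
have ncolE : n%:R * (ncol k n)%:R = n%:R ^+ k :> R.
  by rewrite /ncol card_ffun !card_ord -natrM -expnS prednK ?natrX // (ltn_trans _ hk).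
have nk0 : 0 < n%:R ^+ k :> R by rewrite exprn_gt0.
have m0 : 0 < (ncol k n)%:R :> R by rewrite -(pmulr_rgt0 _ nR0) ncolE.
have mu10 : 0 < mu1 by move: nuU0; rewrite /nuU pmulr_lgt0 ?invr_gt0 // pmulr_lgt0.
have mu20 : 0 < mu2 by move: nuV0; rewrite /nuV pmulr_lgt0 ?invr_gt0 // pmulr_lgt0.
pose i0 : 'I_r := Ordinal rpos.
have lastP : (r.-1 < r)%N by rewrite prednK.
pose i1 : 'I_r := Ordinal lastP.
pose S := s 0 i0; pose smin := s 0 i1.
have S0 : 0 < S := spos i0; have smin0 : 0 < smin := spos i1.
have kE : kappa = S / smin := hkappa i0 i1 erefl erefl.
have sS c : s 0 c <= S by apply: ssort.
have smins c : smin <= s 0 c by apply: ssort; rewrite /= -ltnS prednK.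
pose sig := smin ^+ 2.
have sig0 : 0 < sig by rewrite exprn_gt0.
(* Chosen so that [S ^+ 2 * rho] bounds the squared entries of [T]. *)
pose rho := mu1 * mu2 * r%:R ^+ 2 / n%:R ^+ k.
have rho0 : 0 < rho by rewrite divr_gt0 ?mulr_gt0 // exprn_gt0.
have hE : S ^+ 2 * nuU * nuV = S ^+ 2 * rho.
  by rewrite /nuU /nuV /rho -ncolE; field; rewrite !gt_eqF.
have kap0 : 0 < kappa by rewrite kE divr_gt0.
have kap1 : 1 <= kappa by rewrite kE ler_pdivlMr // mul1r smins.
have Skap : S ^+ 2 = kappa ^+ 2 * sig by rewrite kE /sig; field; rewrite gt_eqF.
set L := ln n%:R in K3 hp hq *.
pose aL := a * L; rewrite -/aL in K3.
have KR0 : 0 <= K%:R :> R by exact: ler0n.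
have aL0 : 0 <= aL.
  by apply: mulr_ge0; [exact: le_trans ha | exact: ln_ge0].
have hp' : 4800 * expR 3 * kappa ^+ 4 * (aL * rho) <= p.
  by apply: le_trans hp; rewrite le_eqVlt; apply/orP; left; apply/eqP; rewrite /aL /rho; ring.
have aLr0 : 0 <= aL * rho by rewrite mulr_ge0 // ltW.
have Krho : K%:R * rho <= 3 * (aL * rho) by rewrite mulrA ler_pM2r.
have k4 : 1 <= kappa ^+ 4 by rewrite exprn_ege1.
have e31 : 1 <= expR 3 :> R by rewrite -expR0 ler_expR.
have [Krp Krp'] := sampling_rate aLr0 Krho e31 k4 hp'.
have h0 : 0 < S ^+ 2 * nuU * nuV by rewrite hE mulr_gt0 // exprn_gt0.
have sS2 c : s 0 c ^+ 2 <= S ^+ 2 by rewrite ler_sqr ?nnegrE // ltW.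
have sigs c : sig <= s 0 c ^+ 2 by rewrite ler_sqr ?nnegrE // ltW.
have Kh : K%:R * (S ^+ 2 * nuU * nuV) / p <= S ^+ 2.
  rewrite hE ler_pdivrMr // mulrCA; apply: ler_wpM2l => //; exact: sqr_ge0.
(* After squaring, the noise carries S^4 = kappa^4 sig^2 against sig^2 / 400: this is the origin of
   [kappa ^+ 4] in the sampling rate. *)
have small : noise_level S nuU nuV p K <= sig / 20.
  have t0 : 0 <= sig / 20 by apply: divr_ge0 => //; exact: ltW.
  rewrite -[leRHS]ger0_norm // -sqrtr_sqr; apply: ler_wsqrtr; rewrite hE Skap.
  rewrite mulrA ler_pdivrMr //.
  have s4 : 0 <= sig ^+ 2 := sqr_ge0 _.
  have h3 := ler_wpM2l s4 Krp'.
  by rewrite -subr_ge0 in h3; rewrite -subr_ge0; have h4 := divr_ge0 h3 (ler0n R 400);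
    from_nonneg h4; field.
have rn : (r <= n)%N := rank_leq_row A.
pose good := @good_sample R n (ncol k n) r A S nuU nuV p K.
have bad : prob p (fun w => ~ good w) <= 2 * n%:R `^ (- a).
  have hb := @prob_bad_sample R n (ncol k n) r A U s V S nuU nuV p K UU VV AE
    (ltW nuU0) (ltW nuV0) sS2 rowU rowV h0 p01 K0 Kh.
  by apply: le_trans hb _; rewrite mulrDl mulrDl !mul1r; apply: lerD.
(* Three failure events of probability at most n^(-a) each: operator norm, rows of the noise, entry
   sampling. *)
apply: le_trans (_ : 1 - (n%:R `^ (- a) + 2 * n%:R `^ (- a)) <= _); first lra.
apply: (prob2_ge p01' q01' na0 bad) => w wgood; apply: le_trans eKa.
have [Quniq QT QQ Qrow Qbias] := @good_sample_spectral R n (ncol k n) r A U s V S nuU nuV p K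
    (* From here the wedge sample is fixed and good, so [Q] is deterministic with respect to the
       entry sample. *)
    UU VV AE (ltW nuU0) sS2 rowU sig rn sig0 sigs small w wgood.
move: (spectral_proj r (wedge_matrix p A w)) Quniq QT QQ Qrow Qbias => Q Quniq QT QQ Qrow Qbias.
pose b := 2 * (kappa ^+ 2 * Num.sqrt (mu1 * r%:R / n%:R)).
have bE : 2 * (S ^+ 2 * Num.sqrt nuU) / sig = b.
  by rewrite Skap /b -/nuU; field; rewrite gt_eqF.
rewrite bE in Qrow.
have b0 : 0 <= b by rewrite /b; nonneg.
have Th f : T f ^+ 2 <= S ^+ 2 * rho.
  rewrite (unfold_entry T (mode1 hk)) -/A AE -hE.
  by apply: entry_svd => //; [exact: sqr_ge0|exact: ltW].
have k1R : 1 <= k%:R - 1 :> R by rewrite lerBrDr (_ : 1 + 1 = 2%:R) ?ler_nat.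
have Kq : K%:R <= 3 * (q * n%:R ^+ k).
  apply: le_trans K3 _; rewrite ler_pM2l //.
  move: hq; rewrite ler_pdivrMr // => hq; apply: le_trans hq.
  have -> : a * (k%:R - 1) * L = aL * (k%:R - 1) by rewrite /aL; ring.
  by rewrite -[leLHS]mulr1; apply: ler_wpM2l.
have h0' : 0 <= S ^+ 2 * rho by rewrite -hE ltW.
apply: le_trans (sampling_tail K0 q01 h0' b0 QT Qrow Th Kq).
apply: prob_le => // e; apply: contra_notP => /negP; rewrite -leNgt => noise U' /Quniq U'Q.
have noise_le := noise_constant (S := S) (F := frob T) (kappa2 := kappa ^+ 2) (mu1 := mu1)
  (mu2 := mu2) (r := r%:R) (L := L) (a := a) (n := n%:R) (q := q) (K := K%:R) (k := k).
have SF : S <= frob T.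
  have S2 : S ^+ 2 <= fnorm A ^+ 2.
    by rewrite fnorm_sq; have := singular_value_le s i0 UU VV; rewrite -AE.
  by rewrite frobA -ler_sqr ?nnegrE ?fnorm_ge0 //; exact: ltW.
have {}noise_le := noise_le (introT andP (conj (ltW S0) SF)) mu10 mu20 rR1 nR0 q0 hk
  (sqr_ge0 _) (introT andP (conj KR0 K3)).
(* The two terms of the bound are treated separately: the bias holds for every good wedge sample,
   the noise on the event from [sampling_tail]. *)
apply: le_trans (estimator_error _ _ _ _ _) _; rewrite U'Q mulrDr mulrDl; apply: lerD.
  have UT : U *m U^T *m unfold (mode1 hk) T = unfold (mode1 hk) T.
    by rewrite -/A AE !mulmxA -(mulmxA U U^T U) UU mulmx1.
  apply: le_trans (tensor_bias Tsym QT QQ UU UT) _.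
  rewrite mulrA; apply: ler_wpM2r; first exact: sqrtr_ge0.
  have := bias_constant S sig0 (ltW rho0) p0 (introT andP (conj KR0 K3)).
  rewrite -hE -/(noise_level S nuU nuV p K) => hb.
  apply: le_trans (ler_wpM2l (ler0n R k) Qbias) _.
  have sr0 : 0 <= k%:R * Num.sqrt r%:R :> R by nonneg.
  have hb' := ler_wpM2l sr0 hb.
  have kS : S ^+ 2 / sig = kappa ^+ 2 by rewrite Skap mulfK // gt_eqF.
  have aE : a * mu1 * mu2 * r%:R ^+ 2 * L / (p * n%:R ^+ k) = aL * rho / p.
    by rewrite /aL /rho; field; rewrite !gt_eqF.
  rewrite aE; rewrite kS in hb'.
  apply: le_trans (_ : k%:R * Num.sqrt r%:R * (2 * noise_level S nuU nuV p K / sig) <= _).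
    by rewrite le_eqVlt; apply/orP; left; apply/eqP; ring.
  apply: le_trans hb' _.
  by rewrite le_eqVlt; apply/orP; left; apply/eqP; ring.
rewrite exprM; apply: le_trans noise_le.
rewrite fnorm_le ?sqrtr_ge0 // sqr_sqrtr //.
by apply: mulr_ge0; nonneg.
Qed.
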